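(* Let $H$ be a finite dimensional RKHS in $\mathcal{F}$; that is, for some integer $m\ge 1$ and some set $X=\{x_i\}_{i=1}^n\subset\mathbb{B}^m$ of $n$ distinct points we have $H\sim DA_m(X)$ (with the kernel function $k_i$ of $H$ corresponding to the point $x_i$). The following are equivalent: (1) $X$ lies in a single complex geodesic in $\mathbb{B}^m=\mathbb{CH}^m$. (2) For each $1<i<j\le n$, the set $\{x_1,x_i,x_j\}$ lies in a single complex geodesic in $\mathbb{B}^m=\mathbb{CH}^m$. (3) There is a renumbering of $X$ (and correspondingly of the kernel functions of $H$) after which, with $m_1\in M(H)$ the multiplier of norm one which satisfies $m_1(x_j)=0$ for $j=2,\dots,n$ and which maximizes $\operatorname{Re} m_1(x_1)$, we have $$m_1(x_1)=\prod_{j=2}^n\delta(x_1,x_j).$$ (4) $H$ is $r$-orthogonal. That is, $H\sim\tilde H$ for some finite dimensional RKHS $\tilde H$ which carries a conjugation operator taking the basis of reproducing kernels of $\tilde H$ to its dual basis (the $i$-th kernel going to the $i$-th dual basis vector). (5) $H\sim\tilde H$ for a finite dimensional RKHS $\tilde H$ whose Gram matrix is an orthogonal matrix. (6) $H$ is an $r$-model space; that is, there is a finite Blaschke product $B$ with simple zeros such that $H\sim K_B$.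
   Context: Inner products are linear in the first variable and conjugate linear in the second. A finite dimensional RKHS is a finite dimensional complex Hilbert space $H$ together with a designated basis $\{k_i\}_{i=1}^n$ of $H$, whose vectors are called the reproducing kernels (or kernel functions) of $H$. Its dual basis $\{k_i^{\#}\}_{i=1}^n\subset H$ is defined by $\langle k_i,k_j^{\#}\rangle=\delta_{ij}$ (Kronecker delta). Its Gram matrix is the $n\times n$ matrix $(k_{ij})$ with $k_{ij}=\langle k_i,k_j\rangle$. If the index set is identified with a set of points $\{x_i\}$ (via $k_i\leftrightarrow x_i$), each $h\in H$ is regarded as the function $h(x_i)=\langle h,k_i\rangle$ on the index set. Rescaling: two finite dimensional RKHS $H,\tilde H$ with kernels $\{k_i\}_{i=1}^n,\{\tilde k_i\}_{i=1}^n$ are rescalings of each other, written $H\sim\tilde H$, if there are nonzero complex scalars $\lambda_1,\dots,\lambda_n$ with $\langle k_i,k_j\rangle=\lambda_i\overline{\lambda_j}\langle\tilde k_i,\tilde k_j\rangle$ for all $1\le i,j\le n$ (the kernels of the two spaces being indexed correspondingly). Drury-Arveson spaces: $\mathbb{B}^m$ is the open unit ball of $\mathbb{C}^m$; $DA_m$ is the Hilbert space of functions on $\mathbb{B}^m$ with reproducing kernels $k_z(w)=\frac{1}{1-\langle w,z\rangle}$, $z\in\mathbb{B}^m$, so $\langle k_z,k_w\rangle=k_z(w)$. For finite $X\subset\mathbb{B}^m$, $DA_m(X)$ is the subspace of $DA_m$ spanned by $\{k_x:x\in X\}$, regarded as an RKHS with these functions as its kernel functions. $\mathcal{F}$ is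 the class of finite dimensional RKHS $H$ such that $H\sim DA_m(X)$ for some $m\ge1$ and some finite $X\subset\mathbb{B}^m$. Complex geodesics: the ball $\mathbb{B}^m$ is the model of complex hyperbolic space $\mathbb{CH}^m$, with automorphism group the group of biholomorphic self-maps of $\mathbb{B}^m$. The disk $\mathbb{B}^1=\{(z,0,\dots,0):|z|<1\}\subset\mathbb{B}^m$ is a complex geodesic, and the complex geodesics are exactly the images of this disk under automorphisms of the ball. Multipliers: $M(H)$ is the algebra of functions $m$ on the index set $X$ acting on $H$ by pointwise multiplication (i.e. $(mh)(x_i)=m(x_i)h(x_i)$), normed by the operator norm of this multiplication operator on $H$. Metric $\delta$: $\delta(x_i,x_j)=\delta(k_i,k_j)=\sqrt{1-\frac{|k_{ij}|^2}{k_{ii}k_{jj}}}$, equivalently the operator norm $\|P_i-P_j\|$, where $P_i$ is the orthogonal projection of $H$ onto the span of $k_i$. A conjugation operator on a Hilbert space $H$ is a conjugate linear map $J:H\to H$ with $\|Jh\|=\|h\|$ for all $h\in H$ and $J^2=I$. A (complex) square matrix is orthogonal if its inverse equals its transpose (not conjugate transpose). Model spaces: $H^2$ is the classical Hardy space on the unit disk $\mathbb{B}^1\subset\mathbb{C}$. For a finite Blaschke product $B$ with simple zeros $z_1,\dots,z_n\in\mathbb{B}^1$, $K_B=H^2\ominus BH^2$, regarded as an RKHS whose kernel functions are $k_i(w)=\frac{1}{1-w\overline{z_i}}$, $i=1,\dots,n$ (so $\langle f,k_i\rangle=f(z_i)$ for $f\in K_B$). *)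

(* Defs.v *)
From HB Require Import structures.
From mathcomp Require Import all_boot all_order all_fingroup all_algebra.
From mathcomp Require Import all_classical all_reals all_analysis.
From mathcomp Require Import complex.

Set Implicit Arguments.
Unset Strict Implicit.
Unset Printing Implicit Defensive.

Import Order.TTheory GRing.Theory Num.Theory Num.Def.
Import numFieldNormedType.Exports.

Local Open Scope classical_set_scope.
Local Open Scope ring_scope.

(* {dot V for conjC} is the type of positive definite Hermitian forms which
   are linear in the first variable and conjugate linear in the second. *)
Definition dot_norm (R : realType) (V : lmodType R[i])
    (f : {dot V for conjC}) (u : V) : R :=
  Num.sqrt (complex.Re (f u u)).

Record fdRKHS (R : realType) (n : nat) := FdRKHS {
  hilbert :> vectType R[i];
  hdot : {dot hilbert for conjC};
  kern : 'I_n -> hilbert;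
  kern_basis : basis_of fullv [tuple kern i | i < n]
}.
Arguments hdot {R n} H : rename.
Arguments kern {R n} H i : rename.
Arguments kern_basis {R n} H : rename.

Section FiniteDimensionalRKHS.
Variables (R : realType) (n : nat).
Implicit Types H : fdRKHS R n.

Definition gram H : 'M[R[i]]_n :=
  \matrix_(i, j) hdot H (kern H i) (kern H j).

Definition dual_basis H (d : 'I_n -> H) : Prop :=
  forall i j, hdot H (kern H i) (d j) = (i == j)%:R.

Definition rescaling H (H' : fdRKHS R n) : Prop :=
  exists2 l : 'I_n -> R[i], forall i, l i != 0 &
    forall i j, gram H i j = l i * (l j)^* * gram H' i j.

(* A nonnegative real number seen in R[i]: by the Cauchy-Schwarz inequality
   the argument of the square root lies in [0, 1]. *)
Definition delta H (i j : 'I_n) : R[i] :=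
  sqrtC (1 - `|gram H i j| ^+ 2 / (gram H i i * gram H j j)).

(* h as a function on the index set *)
Definition heval H (h : H) (i : 'I_n) : R[i] := hdot H h (kern H i).

(* Pointwise multiplication by m: since the kernels form a basis, exactly one
   g satisfies the condition, and the default value 0 is never used. *)
Definition mult_op H (m : 'I_n -> R[i]) (h : H) : H :=
  xget 0 [set g : H | forall i, heval g i = m i * heval h i].

Definition mult_norm H (m : 'I_n -> R[i]) : R :=
  sup [set dot_norm (hdot H) (mult_op m h) |
        h in [set h : H | dot_norm (hdot H) h <= 1]].

Definition conjugation_operator H (J : H -> H) : Prop :=
  [/\ forall (a : R[i]) (u v : H), J (a *: u + v) = a^* *: J u + J v,
      forall u : H, dot_norm (hdot H) (J u) = dot_norm (hdot H) u
    & involutive J].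

Lemma renumber_subproof H (s : 'S_n) :
  basis_of fullv [tuple kern H (s i) | i < n].
Proof.
have -> : [tuple kern H (s i) | i < n] =
    [seq kern H i | i <- [seq s i | i : 'I_n]] :> seq _ by rewrite -map_comp.
have /(perm_map (kern H)) Hp : perm_eq [seq s i | i : 'I_n] (enum 'I_n).
  apply: uniq_perm; [|exact: enum_uniq|].
    by rewrite map_inj_uniq ?enum_uniq //; exact: perm_inj.
  move=> i; rewrite mem_enum; apply/mapP.
  by exists ((s^-1)%g i); rewrite ?mem_enum // permKV.
by rewrite (perm_basis _ Hp); exact: kern_basis.
Qed.

(* H with its kernels renumbered: the i-th kernel is now kern H (s i) *)
Definition renumber (s : 'S_n) H : fdRKHS R n :=
  FdRKHS (hdot H) (renumber_subproof H s).

End FiniteDimensionalRKHS.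

Section ExtremalMultiplier.
Variables (R : realType) (n : nat).
Implicit Types (H : fdRKHS R n.+1) (m : 'I_n.+1 -> R[i]).

Definition admissible_multiplier H m : Prop :=
  mult_norm H m = 1 /\ forall j, j != ord0 -> m j = 0.

Definition extremal_multiplier H m : Prop :=
  admissible_multiplier H m /\
  forall m', admissible_multiplier H m' ->
    complex.Re (m' ord0) <= complex.Re (m ord0).

End ExtremalMultiplier.

(* The Hilbert space of functions on T with reproducing kernel K: an element f
   is the function t |-> rdot f (rkernel t), which determines it. *)
Record rkhs (R : realType) (T : Type) (K : T -> T -> R[i]) := Rkhs {
  rspace :> lmodType R[i];
  rdot : {dot rspace for conjC};
  rkernel : T -> rspace;
  rkernelE : forall s t, rdot (rkernel s) (rkernel t) = K s t;
  rfun_inj : forall f g : rspace,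
    (forall t, rdot f (rkernel t) = rdot g (rkernel t)) -> f = g;
  rcomplete : forall u : nat -> rspace,
    (forall e : R, 0 < e -> exists N, forall p q, (N <= p)%N -> (N <= q)%N ->
       dot_norm rdot (u p - u q) < e) ->
    exists l, forall e : R, 0 < e -> exists N, forall p, (N <= p)%N ->
       dot_norm rdot (u p - l) < e
}.
Arguments rdot {R T K} E : rename.
Arguments rkernel {R T K} E t : rename.

Section Ball.
Variables (R : realType) (m : nat).

(* dotmx is the standard Hermitian inner product of row vectors. *)
Definition unit_ball : set 'rV[R[i]]_m := [set z | dotmx z z < 1].

Definition Cspace : normedModType R[i] := 'rV[R[i]]_m.

(* f is total, but only its restriction to the open set unit_ball matters;
   differentiable is Frechet differentiability over R[i]. *)
Definition holomorphic_self_map (f : 'rV[R[i]]_m -> 'rV[R[i]]_m) : Prop :=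
  forall z : Cspace, unit_ball z ->
    unit_ball (f z) /\ differentiable (f : Cspace -> Cspace) z.

Definition ball_automorphism (f : 'rV[R[i]]_m -> 'rV[R[i]]_m) : Prop :=
  holomorphic_self_map f /\
  exists g, [/\ holomorphic_self_map g,
                forall z, unit_ball z -> g (f z) = z
              & forall z, unit_ball z -> f (g z) = z].

Definition standard_disk : set 'rV[R[i]]_m :=
  [set z | unit_ball z /\ forall j : 'I_m, (0 < j)%N -> z ord0 j = 0].

Definition complex_geodesic (G : set 'rV[R[i]]_m) : Prop :=
  exists2 f, ball_automorphism f & G = f @` standard_disk.

Definition in_one_geodesic (X : set 'rV[R[i]]_m) : Prop :=
  exists2 G, complex_geodesic G & X `<=` G.

(* kernel at z, evaluated at w *)
Definition drury_arveson_kernel (z w : unit_ball) : R[i] :=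
  (1 - dotmx (val w) (val z))^-1.

Definition drury_arveson := rkhs drury_arveson_kernel.

(* D is the span of the kernel functions of DA at the points X i *)
Definition is_span_of_kernels n (DA : drury_arveson) (X : 'I_n -> unit_ball)
    (D : fdRKHS R n) : Prop :=
  exists j : {linear D -> DA},
    (forall u v : D, rdot DA (j u) (j v) = hdot D u v) /\
    (forall i, j (kern D i) = rkernel DA (X i)).

Definition rescaling_of_DA n (DA : drury_arveson) (X : 'I_n -> unit_ball)
    (H : fdRKHS R n) : Prop :=
  exists2 D, is_span_of_kernels DA X D & rescaling H D.

End Ball.
Arguments unit_ball R m : clear implicits.
Arguments drury_arveson R m : clear implicits.

Section ModelSpace.
Variable R : realType.

Definition unit_disk : set R[i] := [set z | `|z| < 1].

Definition square_summable (a : nat -> R[i]) : Prop :=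
  cvgn (series (fun k => complex.Re `|a k| ^+ 2)).

Definition taylor_series (f : unit_disk -> R[i]) (a : nat -> R[i]) : Prop :=
  forall z : unit_disk,
    (series (fun k => a k * val z ^+ k) : nat -> R[i]^o) @ \oo --> (f z : R[i]^o).

Definition hardy : set (unit_disk -> R[i]) :=
  [set f | exists2 a, square_summable a & taylor_series f a].

Definition taylor_coef (f : unit_disk -> R[i]) : nat -> R[i] :=
  xget (fun=> 0) (taylor_series f).

Definition hardy_dot (f g : unit_disk -> R[i]) : R[i] :=
  limn (series (fun k => taylor_coef f k * (taylor_coef g k)^* )
        : nat -> R[i]^o).

Variable n : nat.
Implicit Types z : 'I_n -> unit_disk.

(* The finite Blaschke product with zeros z i, up to the unimodular c *)
Definition blaschke (c : R[i]) z (w : unit_disk) : R[i] :=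
  c * \prod_(i < n) ((val w - val (z i)) / (1 - (val (z i))^* * val w)).

Definition model_space (B : unit_disk -> R[i]) : set (unit_disk -> R[i]) :=
  [set f | hardy f /\
     forall g, hardy g -> hardy_dot f (fun w => B w * g w) = 0].

(* D is K_B, regarded as an RKHS with the Szego kernels at the points z i *)
Definition is_model_RKHS (B : unit_disk -> R[i]) z (D : fdRKHS R n) : Prop :=
  exists j : D -> unit_disk -> R[i],
    [/\ forall (a : R[i]) (u v : D) w, j (a *: u + v) w = a * j u w + j v w,
        set_bij [set: D] (model_space B) j,
        forall u v : D, hardy_dot (j u) (j v) = hdot D u v
      & forall i w, j (kern D i) w = (1 - val w * (val (z i))^* )^-1].

Definition r_model_space (H : fdRKHS R n) : Prop :=
  exists c z D, [/\ `|c| = 1, injective z, is_model_RKHS (blaschke c z) z D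
                  & rescaling H D].

End ModelSpace.

Definition r_orthogonal (R : realType) (n : nat) (H : fdRKHS R n) : Prop :=
  exists2 D : fdRKHS R n, rescaling H D &
    exists J d, [/\ conjugation_operator (H := D) J, dual_basis (H := D) d
                  & forall i, J (kern D i) = d i].

Definition orthogonal_matrix (R : realType) (n : nat) (A : 'M[R[i]]_n) : Prop :=
  A \in unitmx /\ invmx A = A^T.

(* Main.v *)
Require Import Defs.
From HB Require Import structures.
From mathcomp Require Import all_boot all_order all_fingroup all_algebra.
From mathcomp Require Import all_classical all_reals all_analysis.
From mathcomp Require Import complex.
From mathcomp Require Import ring lra.
Import Order.TTheory GRing.Theory Num.Theory.
Import numFieldNormedType.Exports.
Local Open Scope classical_set_scope.
Local Open Scope ring_scope.

Set Implicit Arguments.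
Unset Strict Implicit.
Unset Printing Implicit Defensive.
Local Notation conjC := Num.Def.conjC.

(** All the conditions say that, once one of the points is moved to the centre
    of the ball, the points lie on one complex line through the centre.

    The involutive automorphism [ball_inv a] of the ball exchanges a and 0, and
    it changes the kernel 1 / (1 - <w, z>) by a rescaling only
    ([ball_inv_dot]). So the Gram matrix of H keeps the form
    l_i l_j^* / (1 - <y_j, y_i>) when the points x_i are replaced by
    y_i = ball_inv x_b x_i, for which y_b = 0 ([pick_form_recenter]). With a
    point at 0 this form determines all the <y_j, y_i> ([pick_form_dot]), so H
    decides whether the y_i are on a line.

    Geodesics. The Schwarz lemma, applied after recentring, shows that
    automorphisms of the ball preserve the norm of ball_inv b a
    ([ball_automorphism_pick]), and a map fixing 0 with this property preserves
    the norms and the moduli of inner products ([pick_isometry_dot_norm]);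
    hence points of a geodesic are pairwise proportional after recentring
    ([geodesic_parallel]). Conversely a reflection and an involution carry the
    standard disk onto the geodesic through collinear recentred points
    ([line_geodesic]). As proportionality concerns pairs, triples containing
    the base point are enough. The Schwarz lemma itself rests on a maximum
    principle at the centre of a disk, proved with Riemann sums: the exponential
    unrolls an annulus to a rectangle, where Goursat's bisection argument makes
    the difference of the means over the two circles as small as desired.

    From a line to the algebraic conditions. For points z_i of the disk,
    Lagrange interpolation inverts the Pick matrix K, with entries
    1 / (1 - z_j z_i^* ): K D K^T is diagonal for an explicit diagonal D ([disk_pick_inverse]).
    Distributing square roots of D over the kernels gives an orthogonal Gram
    matrix ([orthogonal_of_on_line]), and the row of K^-1 at the base point
    gives the norm of the dual vector, which is what the extremal multiplier
    measures ([extremal_product_iff], [extremal_dual_of_line]).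

    From the algebraic conditions to a line. Both arguments detect an equality
    case. If the Gram matrix can be rescaled to be orthogonal, a family of
    Cauchy-Schwarz inequalities has to be an equality
    ([line_of_orthogonal_rescaling]). If the extremal value is the product of
    the distances, a product of contractions, one for each point other than the
    base point, attains its norm on the dual vector, so that every factor does
    ([line_of_extremal_dual]).

    Conjugations taking kernels to dual vectors exist exactly when the Gram
    matrix of the dual basis, which is the inverse of the Gram matrix of the
    kernels, is its transpose. Finally a model space is spanned by Szego
    kernels at points of the disk ([model_space_szego_comb]), whose Gram matrix
    is of the above form for points on a line. *)

(** * Bisection of the square *)

Section Bisection.
Variable R : realType.

Lemma nested_dyadic_point (s : nat -> R) :
  (forall k, s k <= s k.+1) ->
  (forall k, s k.+1 + 2^-1 ^+ k.+1 <= s k + 2^-1 ^+ k) ->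
  exists x, forall k, s k <= x <= s k + 2^-1 ^+ k.
Proof.
move=> sS sD.
have s_le k m : s k <= s (k + m)%N.
  by elim: m => [|m IH]; rewrite ?addn0// addnS; exact: le_trans IH _.
have d_le k m : s (k + m)%N + 2^-1 ^+ (k + m) <= s k + 2^-1 ^+ k.
  by elim: m => [|m IH]; rewrite ?addn0// addnS; exact: le_trans IH.
have p_ge0 k : 0 <= (2^-1 : R) ^+ k by rewrite exprn_ge0// invr_ge0.
have ub k j : s j <= s k + 2^-1 ^+ k.
  case: (leqP k j) => [kj|/ltnW jk].
    by rewrite -(subnKC kj); apply: le_trans (d_le k (j - k)%N); rewrite lerDl.
  by apply: le_trans (s_le j (k - j)%N) _; rewrite subnKC// lerDl.
exists (sup (range s)) => k; apply/andP; split.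
  apply: ub_le_sup; last by exists k.
  by exists (s 0 + 2^-1 ^+ 0) => _ [j _ <-].
by apply: ge_sup => [|_ [j _ <-]]; [exists (s 0), 0%N|].
Qed.

(** If P fails on the unit square, it fails on some quarter of every square on
    which it fails; the corners of a nested sequence of such quarters converge
    to a point, near which the second hypothesis applies. *)
Lemma bisection (P : R -> R -> nat -> Prop) :
  (forall s t k, let h := 2^-1 ^+ k.+1 in
     P s t k.+1 -> P (s + h) t k.+1 -> P s (t + h) k.+1 ->
     P (s + h) (t + h) k.+1 -> P s t k) ->
  (forall x y, 0 <= x <= 1 -> 0 <= y <= 1 ->
     exists K, forall s t k, (K <= k)%N -> s <= x <= s + 2^-1 ^+ k ->
       t <= y <= t + 2^-1 ^+ k -> P s t k) ->
  P 0 0 0%N.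
Proof.
move=> split loc; apply: contrapT => nP.
pose sub (a b : R) k := a <= b /\ b + 2^-1 ^+ k.+1 <= a + 2^-1 ^+ k.
have half k : 2^-1 ^+ k.+1 + 2^-1 ^+ k.+1 = (2^-1 : R) ^+ k.
  by rewrite exprS; lra.
have sub0 a k : sub a a k.
  by split=> //; rewrite -(half k) lerD2l lerDl exprn_ge0// invr_ge0.
have sub1 a k : sub a (a + 2^-1 ^+ k.+1) k.
  by split; [rewrite lerDl exprn_ge0 ?invr_ge0|rewrite -addrA half].
have step (x : R * R * nat) : exists y : R * R * nat, ~ P x.1.1 x.1.2 x.2 ->
    [/\ ~ P y.1.1 y.1.2 y.2, y.2 = x.2.+1, sub x.1.1 y.1.1 x.2
      & sub x.1.2 y.1.2 x.2].
  case: x => -[s t] k /=; pose h : R := 2^-1 ^+ k.+1.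
  have [H|/contrapT H] := pselect (~ P s t k); last by exists (0, 0, 0%N).
  have [H1|H1] := pselect (P s t k.+1); last first.
    by exists (s, t, k.+1); split.
  have [H2|H2] := pselect (P (s + h) t k.+1); last first.
    by exists (s + h, t, k.+1); split => //; exact: sub1.
  have [H3|H3] := pselect (P s (t + h) k.+1); last first.
    by exists (s, t + h, k.+1); split => //; exact: sub1.
  have [H4|H4] := pselect (P (s + h) (t + h) k.+1); last first.
    by exists (s + h, t + h, k.+1); split => //; exact: sub1.
  by case: H; exact: (@split s t k H1 H2 H3 H4).
have [nxt nxtP] := choice step.
pose x k := iter k nxt (0, 0, 0%N).
have xP k : ~ P (x k).1.1 (x k).1.2 (x k).2 /\ (x k).2 = k.
  elim: k => [//|k [IH1 IH2]].
  by have [H1 H2 _ _] := nxtP _ IH1; split; [exact: H1|rewrite [LHS]H2 IH2].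
have xS k : sub (x k).1.1 (x k.+1).1.1 k /\ sub (x k).1.2 (x k.+1).1.2 k.
  by have [H1 H2] := xP k; have [_ _] := nxtP _ H1; rewrite H2.
have [a aP] := @nested_dyadic_point (fun k => (x k).1.1)
  (fun k => (xS k).1.1) (fun k => (xS k).1.2).
have [b bP] := @nested_dyadic_point (fun k => (x k).1.2)
  (fun k => (xS k).2.1) (fun k => (xS k).2.2).
have a01 : 0 <= a <= 1 by have := aP 0%N; rewrite /= add0r expr0.
have b01 : 0 <= b <= 1 by have := bP 0%N; rewrite /= add0r expr0.
have [K KP] := loc a b a01 b01.
have [H1 H2] := xP K; apply: H1; rewrite H2.
exact: KP.
Qed.
End Bisection.

(** * Riemann sums along contours and Goursat's theorem *)

Section ContourSums.
Variable C : numFieldType.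
Implicit Types (F G : C -> C) (N : nat) (p d c al be : C).

(** The Riemann sum with N steps of the integral of F along the segment from p
    to p + d, with the values taken at the beginning of each step. *)
Definition edge F N p d : C :=
  \sum_(j < N) d / N%:R * F (p + j%:R * (d / N%:R)).

(** The corresponding sum along the boundary of the parallelogram with corner c
    and sides al, be, up to orientation. *)
Definition contour F N c al be : C :=
  (edge F N c al - edge F N (c + be) al)
  + (edge F N (c + al) be - edge F N c be).

Lemma edge_double F N p d :
  edge F (N + N) p d = edge F N p (d / 2) + edge F N (p + d / 2) (d / 2).
Proof.
have [->|N0] := posnP N; first by rewrite /edge !big_ord0 addr0.
have N1 : N%:R != 0 :> C by rewrite pnatr_eq0 -lt0n.
have h : d / (N + N)%:R = d / 2 / N%:R.
  by rewrite addnn -muln2 natrM; field.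
rewrite /edge big_split_ord /= h; congr (_ + _).
apply: eq_bigr => j _; congr (_ * F _); rewrite natrD; field => //.
Qed.

(** The sums along the inner edges cancel as integrals do, without an error
    term, because the number of steps is doubled with the subdivision. *)
Lemma contour_double F N c al be :
  contour F (N + N) c al be =
    contour F N c (al / 2) (be / 2) + contour F N (c + al / 2) (al / 2) (be / 2)
    + contour F N (c + be / 2) (al / 2) (be / 2)
    + contour F N (c + al / 2 + be / 2) (al / 2) (be / 2).
Proof.
rewrite /contour !edge_double.
rewrite (_ : c + be / 2 + be / 2 = c + be); last by field.
rewrite (_ : c + al / 2 + al / 2 = c + al); last by field.
rewrite (_ : c + al / 2 + be / 2 + be / 2 = c + be + al / 2); last by field.
rewrite (_ : c + al / 2 + be / 2 + al / 2 = c + al + be / 2); last by field.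
rewrite (_ : c + be / 2 + al / 2 = c + al / 2 + be / 2); last by field.
ring.
Qed.

Lemma edgeB F G N p d :
  edge (fun w => F w - G w) N p d = edge F N p d - edge G N p d.
Proof. by rewrite /edge -sumrB; apply: eq_bigr => j _; rewrite mulrBr. Qed.

(** For an affine function the error of the sum along an edge depends only on
    the direction of the edge, so opposite edges cancel. *)
Lemma contour_affine (m l : C) N c al be :
  contour (fun w => m + l * w) N c al be = 0.
Proof.
have [->|N0] := posnP N; first by rewrite /contour /edge !big_ord0; ring.
have N1 : N%:R != 0 :> C by rewrite pnatr_eq0 -lt0n.
have E p q d : edge (fun w => m + l * w) N p d - edge (fun w => m + l * w) N q d
   = l * (p - q) * d.
  rewrite /edge -sumrB (eq_bigr (fun=> l * (p - q) * (d / N%:R))).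
    by rewrite sumr_const card_ord -mulr_natr; field.
  by move=> j _; ring.
by rewrite /contour !E; ring.
Qed.

Lemma edge_norm_le F N p d (eta : C) : (0 < N)%N ->
  (forall j, (j < N)%N -> `|F (p + j%:R / N%:R * d)| <= eta) ->
  `|edge F N p d| <= `|d| * eta.
Proof.
move=> N0 H; have N1 : N%:R != 0 :> C by rewrite pnatr_eq0 -lt0n.
apply: le_trans (ler_norm_sum _ _ _) _.
have -> : `|d| * eta = \sum_(j < N) `|d| / N%:R * eta.
  by rewrite sumr_const card_ord -mulr_natr; field.
apply: ler_sum => j _; rewrite !normrM normfV normr_nat.
apply: ler_wpM2l; first by rewrite divr_ge0.
rewrite (_ : j%:R * (d / N%:R) = j%:R / N%:R * d) ?H//; ring.
Qed.

(** By [contour_affine], only the distance of F to an affine function counts. *)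
Lemma contour_norm_le F N c al be (m l eta : C) : (0 < N)%N ->
  (forall x y, 0 <= x <= 1 -> 0 <= y <= 1 ->
     let w := c + x * al + y * be in `|F w - (m + l * w)| <= eta) ->
  `|contour F N c al be| <= 2 * (`|al| + `|be|) * eta.
Proof.
move=> N0 H; pose G w := F w - (m + l * w).
have -> : contour F N c al be = contour G N c al be.
  have := contour_affine m l N c al be; rewrite /contour !edgeB => A.
  by rewrite -[LHS]subr0 -A; ring.
have u j : (j < N)%N -> 0 <= (j%:R / N%:R : C) <= 1.
  move=> jN; rewrite divr_ge0//= ler_pdivrMr ?ltr0n// mul1r ler_nat; exact: ltnW.
have u0 : 0 <= (0 : C) <= 1 by rewrite lexx ler01.
have u1 : 0 <= (1 : C) <= 1 by rewrite lexx ler01.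
have E1 : `|edge G N c al| <= `|al| * eta.
  apply: edge_norm_le => // j /u jN; have := H _ 0 jN u0.
  by rewrite /= mul0r addr0.
have E2 : `|edge G N (c + be) al| <= `|al| * eta.
  apply: edge_norm_le => // j /u jN; have := H _ 1 jN u1.
  by rewrite /= mul1r addrAC.
have E3 : `|edge G N (c + al) be| <= `|be| * eta.
  apply: edge_norm_le => // j /u jN; have := H 1 _ u1 jN.
  by rewrite /= mul1r.
have E4 : `|edge G N c be| <= `|be| * eta.
  apply: edge_norm_le => // j /u jN; have := H 0 _ u0 jN.
  by rewrite /= mul0r addr0.
apply: le_trans (ler_normD _ _) _.
have -> : 2 * (`|al| + `|be|) * eta =
  (`|al| * eta + `|al| * eta) + (`|be| * eta + `|be| * eta) by ring.
by apply: lerD; apply: le_trans (ler_normB _ _) _; apply: lerD.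
Qed.
End ContourSums.

(** Without division, so that the point z itself needs no exception in
    estimates. *)
Definition cderiv (K : numFieldType) (f : K -> K) (z l : K) : Prop :=
  forall e, 0 < e -> exists2 d, 0 < d &
    forall w, `|w - z| <= d -> `|f w - f z - l * (w - z)| <= e * `|w - z|.

Definition cdiff (K : numFieldType) (f : K -> K) (z : K) : Prop :=
  exists l, cderiv f z l.

Section Goursat.
Variable R : realType.
Local Notation C := R[i].
Local Notation rc := (real_complex R).

Lemma dyadic_small (d : C) : 0 < d -> exists K, forall k, (K <= k)%N ->
  2^-1 ^+ k <= d.
Proof.
move=> d0; have dr : d = rc (complex.Re d).
  by apply/esym/RRe_real; rewrite ger0_real// ltW.
have d1 : 0 < complex.Re d by rewrite -ltcR -dr.
have : (2^-1 ^+ n : R) @[n --> \oo] --> (0 : R).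
  by apply: cvg_expr; rewrite ger0_norm ?invr_ge0// invf_lt1 ?ltr1n.
move=> /cvgrPdist_le /(_ _ d1) [K _ H]; exists K => k /H.
rewrite sub0r normrN ger0_norm ?exprn_ge0 ?invr_ge0// => h.
by rewrite dr (_ : 2^-1 ^+ k = rc (2^-1 ^+ k)) ?lecR// rmorphXn fmorphV /= rmorph_nat.
Qed.

(** Goursat's argument for Riemann sums. The bound to be proved on a small square
    is e times the square of its side, which adds up exactly when a square is
    cut in four. Near a point of differentiability, F is affine up to an error
    that is small relative to the side, and the perimeter contributes the second
    factor. *)
Lemma goursat (F : C -> C) (c al be : C) :
  (forall s t : R, 0 <= s <= 1 -> 0 <= t <= 1 ->
     cdiff F (c + rc s * al + rc t * be)) ->
  forall e, 0 < e -> exists n0, forall n, (n0 <= n)%N ->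
    `|contour F (2 ^ n) c al be| <= e.
Proof.
move=> dF e e0.
pose h k : R := 2^-1 ^+ k.
have h_ge0 k : 0 <= h k by rewrite exprn_ge0// invr_ge0.
have hS k : h k.+1 = h k / 2 by rewrite /h exprSr.
have hC k : rc (h k) = 2^-1 ^+ k by rewrite rmorphXn fmorphV /= rmorph_nat.
pose P s t k := exists n0, forall n, (n0 <= n)%N ->
  `|contour F (2 ^ n) (c + rc s * al + rc t * be) (rc (h k) * al) (rc (h k) * be)|
    <= e * rc (h k) ^+ 2.
suff : P 0 0 0%N.
  move=> [n0 H]; exists n0 => n /H.
  by rewrite /h expr0 !rmorph0 !mul0r !addr0 rmorph1 !mul1r expr1n mulr1.
apply: bisection => [s t k /= [n1 H1] [n2 H2] [n3 H3] [n4 H4]|x y x01 y01].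
  exists (maxn (maxn n1 n2) (maxn n3 n4)).+1 => -[//|n].
  rewrite ltnS !geq_max => /andP[/andP[L1 L2] /andP[L3 L4]].
  rewrite expnS mul2n -addnn contour_double.
  have {H1} := H1 n L1; have {H2} := H2 n L2.
  have {H3} := H3 n L3; have {H4} := H4 n L4.
  rewrite -/(h k.+1) !rmorphD /=.
  have E b : rc (h k.+1) * b = rc (h k) * b / 2.
    by rewrite hS rmorphM fmorphV /= rmorph_nat; field.
  have -> : c + (rc s + rc (h k.+1)) * al + (rc t + rc (h k.+1)) * be =
    c + rc s * al + rc t * be + rc (h k) * al / 2 + rc (h k) * be / 2.
    by rewrite -!E; ring.
  have -> : c + rc s * al + (rc t + rc (h k.+1)) * be =
    c + rc s * al + rc t * be + rc (h k) * be / 2 by rewrite -!E; ring.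
  have -> : c + (rc s + rc (h k.+1)) * al + rc t * be =
    c + rc s * al + rc t * be + rc (h k) * al / 2 by rewrite -!E; ring.
  rewrite !E => H4 H3 H2 H1.
  have -> : e * rc (h k) ^+ 2 = e * rc (h k.+1) ^+ 2 + e * rc (h k.+1) ^+ 2 +
    e * rc (h k.+1) ^+ 2 + e * rc (h k.+1) ^+ 2.
    by rewrite hS rmorphM fmorphV /= rmorph_nat; field.
  apply: le_trans (ler_normD _ _) _; apply: lerD; last exact: H4.
  apply: le_trans (ler_normD _ _) _; apply: lerD; last exact: H3.
  by apply: le_trans (ler_normD _ _) _; apply: lerD; [exact: H1|exact: H2].
set p := c + rc x * al + rc y * be.
have [l dl] := dF x y x01 y01.
pose L := `|al| + `|be|; have L0 : 0 <= L by rewrite addr_ge0.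
(* 2 L^2 is the constant produced by contour_norm_le for the sides al and be *)
pose e' := e / (2 * L ^+ 2 + 1).
have D0 : 0 < 2 * L ^+ 2 + 1 by rewrite ltr_pwDr// mulr_ge0// exprn_ge0.
have e'0 : 0 < e' by rewrite divr_gt0.
have [d d0 {}dl] := dl e' e'0.
have d'0 : 0 < d / (L + 1) by rewrite divr_gt0// ltr_pwDr.
have [K HK] := dyadic_small d'0.
exists K => s t k kK sx ty; exists 0%N => n _.
have bd (x' y' : C) : 0 <= x' <= 1 -> 0 <= y' <= 1 ->
    `|c + rc s * al + rc t * be + x' * (rc (h k) * al) + y' * (rc (h k) * be) - p|
      <= rc (h k) * L.
  have key (u : R) (v : R) (z : C) : u <= v <= u + h k -> 0 <= z <= 1 ->
      `|rc u + z * rc (h k) - rc v| <= rc (h k).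
    have rcr a : rc a \is Num.real by apply/complex_realP; exists a.
    move=> /andP[uv1 uv2] /andP[z0 z1]; rewrite real_ler_norml; last first.
      by rewrite rpredB ?rpredD ?rpredM ?rcr ?(ger0_real z0).
    apply/andP; split.
      rewrite lerBrDl; apply: (@le_trans _ _ (rc u)).
        by rewrite lerBlDr -rmorphD lecR.
      by rewrite lerDl mulr_ge0// ler0c.
    rewrite lerBlDr addrC; apply: lerD; last by rewrite lecR.
    by rewrite -[leRHS]mul1r ler_wpM2r// ler0c.
  move=> X Y; rewrite (_ : _ - p = (rc s + x' * rc (h k) - rc x) * al +
     (rc t + y' * rc (h k) - rc y) * be); last by rewrite /p; ring.
  apply: le_trans (ler_normD _ _) _; rewrite !normrM mulrDr.
  by apply: lerD; apply: ler_wpM2r => //; exact: key.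
have := @contour_norm_le _ F (2 ^ n) (c + rc s * al + rc t * be)
  (rc (h k) * al) (rc (h k) * be) (F p - l * p) l (e' * (rc (h k) * L)).
rewrite expn_gt0 => /(_ isT) G; apply: le_trans (G _) _.
  move=> x' y' X Y /=; set w := (X in F X); rewrite (_ : F w - (F p - l * p + l * w)
     = F w - F p - l * (w - p)); last by ring.
  have B := bd _ _ X Y.
  apply: le_trans (dl _ _) _; last by rewrite ler_pM2l.
  apply: le_trans B _; rewrite hC.
  apply: le_trans (ler_wpM2r L0 (HK _ kK)) _.
  rewrite mulrAC ler_pdivrMr ?ltr_pwDr// ler_pM2l//.
  by rewrite lerDl ler01.
rewrite !normrM (ger0_norm (_ : 0 <= rc (h k))) ?ler0c//.
rewrite -mulrDr -/L (_ : _ * _ * _ = e' * (2 * L ^+ 2) * rc (h k) ^+ 2); last by ring.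
apply: ler_wpM2r; first by rewrite exprn_ge0// ler0c.
by rewrite mulrAC ler_pdivrMr// ler_pM2l// lerDl ler01.
Qed.
End Goursat.

(** * Complex differentiability and the exponential *)

Section ComplexDifferentiability.
Variable K : numFieldType.
Implicit Types (f g : K -> K) (z l : K).

Lemma is_derive_cderiv f z l : is_derive z 1 f l -> cderiv f z l.
Proof.
move=> [df dl] e e0.
have : h^-1 *: ((f \o shift z) (h *: 1) - f z) @[h --> 0^'] --> l.
  by rewrite -dl; exact: df.
move=> /cvgrPdist_le /(_ e e0) /nbhs_ballP[d /= d0 H].
exists (d / 2); first by rewrite divr_gt0.
move=> w wd; have [->|wz] := eqVneq w z; first by rewrite !subrr mulr0 subrr normr0 mulr0.
have wz0 : w - z != 0 by rewrite subr_eq0.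
have := H (w - z); rewrite /ball /= sub0r normrN => /(_ _ wz0).
have -> : `|w - z| < d.
  by apply: le_lt_trans wd _; rewrite gtr_pMr// invf_lt1 ?ltr1n.
move=> /(_ isT); rewrite [_ *: 1]mulr1 subrK => B.
have -> : f w - f z - l * (w - z) = - ((l - (w - z)^-1 * (f w - f z)) * (w - z)).
  by field.
by rewrite normrN normrM ler_wpM2r.
Qed.

Lemma cderiv_is_derive f z l : cderiv f z l -> is_derive z 1 f l.
Proof.
move=> H.
have L : h^-1 *: ((f \o shift z) (h *: 1) - f z) @[h --> 0^'] --> l.
  apply/cvgrPdist_le => e /H[d d0 {}H].
  apply/nbhs_ballP; exists d => //= h; rewrite /ball /= sub0r normrN => hd h0.
  rewrite [_ *: 1]mulr1; have := H (h + z); rewrite addrK => /(_ (ltW hd)) B.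
  change (h^-1 *: (f (h + z) - f z)) with (h^-1 * (f (h + z) - f z)).
  rewrite -(ler_pM2r (_ : 0 < `|h|)) ?normr_gt0// -normrM.
  have E : f (h + z) - f z - l * h = - ((l - h^-1 * (f (h + z) - f z)) * h) by field.
  by rewrite -normrN -E.
have D : derivable f z 1 by apply/cvg_ex; exists l.
by apply: DeriveDef => //; apply/cvg_lim.
Qed.

Lemma cdiffP f z : cdiff f z <-> derivable f z 1.
Proof.
split=> [[l /cderiv_is_derive[]]//|/derivableP/is_derive_cderiv D].
by exists ('D_1 f z).
Qed.

(** The order of a numFieldType is partial, which excludes the minimum; half the
    harmonic mean serves instead. *)
Lemma pos_lower_bound (x y : K) : 0 < x -> 0 < y ->
  exists2 m, 0 < m & m <= x /\ m <= y.
Proof.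
move=> x0 y0; exists (x * y / (x + y)); first by rewrite divr_gt0 ?mulr_gt0 ?addr_gt0.
by split; rewrite ler_pdivrMr ?addr_gt0// mulrDr ?(mulrC x y) ?lerDl ?lerDr mulr_ge0 ?ltW.
Qed.

Lemma cdiff_ext f g z : (forall w, f w = g w) -> cdiff f z -> cdiff g z.
Proof. by move=> /funext ->. Qed.

Lemma cdiffM f g z : cdiff f z -> cdiff g z -> cdiff (fun w => f w * g w) z.
Proof. by move=> /cdiffP df /cdiffP dg; apply/cdiffP; exact: derivableM. Qed.

Lemma cdiffD f g z : cdiff f z -> cdiff g z -> cdiff (fun w => f w + g w) z.
Proof. by move=> /cdiffP df /cdiffP dg; apply/cdiffP; exact: derivableD. Qed.

Lemma cdiffV f z : f z != 0 -> cdiff f z -> cdiff (fun w => (f w)^-1) z.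
Proof. by move=> f0 /cdiffP df; apply/cdiffP; exact: derivableV. Qed.

Lemma cdiff_cst l z : cdiff (fun=> l) z.
Proof. by apply/cdiffP; exact: derivable_cst. Qed.

Lemma cdiffX f n z : cdiff f z -> cdiff (fun w => f w ^+ n) z.
Proof.
move=> df; elim: n => [|n IH]; first exact: cdiff_cst.
by apply: cdiff_ext (cdiffM df IH) => w; rewrite exprS.
Qed.

Lemma cdiff_id z : cdiff id z.
Proof. by apply/cdiffP; exact: derivable_id. Qed.

Lemma cdiff_continuous f z : cdiff f z ->
  forall e, 0 < e -> exists2 d, 0 < d & forall w, `|w - z| <= d -> `|f w - f z| <= e.
Proof.
move=> [l /(_ 1 ltr01)[d d0 H]] e e0.
have D0 : 0 < `|l| + 1 by rewrite ltr_wpDl.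
have E0 : 0 < e / (`|l| + 1) by rewrite divr_gt0.
have [m m0 [md me]] := pos_lower_bound d0 E0.
exists m => // w wm; have w1 := le_trans wm md; have w2 := le_trans wm me.
have -> : f w - f z = (f w - f z - l * (w - z)) + l * (w - z) by ring.
apply: le_trans (ler_normD _ _) _; rewrite normrM.
apply: (@le_trans _ _ ((`|l| + 1) * `|w - z|)); last by rewrite mulrC -ler_pdivlMr.
by rewrite mulrDl mul1r addrC lerD2l; have := H w w1; rewrite mul1r.
Qed.

Lemma cdiff_comp f g z : cdiff g z -> cdiff f (g z) -> cdiff (fun w => f (g w)) z.
Proof.
move=> /cdiffP/derivable1_diffP dg /cdiffP/derivable1_diffP df; apply/cdiffP.
apply/derivable1_diffP; exact: differentiable_comp.
Qed.
End ComplexDifferentiability.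

Section ComplexExponential.
Variable R : realType.
Local Notation C := R[i].
Local Notation rc := (real_complex R).

Definition cexp (w : C) : C :=
  Complex (expR (complex.Re w) * cos (complex.Im w))
          (expR (complex.Re w) * sin (complex.Im w)).

Lemma cexpD w z : cexp (w + z) = cexp w * cexp z.
Proof.
case: w z => [a b] [c d]; apply/eqP; rewrite eq_complex /= expRD cosD sinD.
by apply/andP; split; apply/eqP; ring.
Qed.

Lemma cexp0 : cexp 0 = 1.
Proof. by apply/eqP; rewrite eq_complex /= expR0 cos0 sin0 mulr1 mulr0 !eqxx. Qed.

Lemma norm_cexp w : `|cexp w| = rc (expR (complex.Re w)).
Proof.
rewrite normc_def /= !exprMn -mulrDr cos2Dsin2 mulr1 sqrtr_sqr.
by rewrite ger0_norm ?expR_ge0.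
Qed.

Lemma cexpD2pi w : cexp (w + Complex 0 (pi *+ 2)) = cexp w.
Proof. by rewrite cexpD /cexp /= expR0 cos2pi sin2pi mulr1 mulr0 mulr1. Qed.

Lemma cderiv_cexp0 : cderiv cexp 0 1.
Proof.
move=> e e0.
have er : e = rc (complex.Re e) by apply/esym/RRe_real; rewrite ger0_real// ltW.
have e1 : 0 < complex.Re e by rewrite -ltcR -er.
move: (complex.Re e) er e1 => {e0} {}e -> e0.
(* the real part costs 4 e' and the imaginary part 5 e' *)
have e80 : 0 < e / 9 by rewrite divr_gt0.
have [e' e'0 [e'1 e'8]] := pos_lower_bound ltr01 e80.
have [d1 d10 H1] := is_derive_cderiv (is_derive_expR 0) e'0.
have [d2 d20 H2] := is_derive_cderiv (is_derive_cos 0) e'0.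
have [d3 d30 H3] := is_derive_cderiv (is_derive_sin 0) e'0.
pose d := Num.min (Num.min d1 d2) (Num.min d3 e').
have d0 : 0 < d by rewrite !lt_min d10 d20 d30 e'0.
exists (rc d); first by rewrite ltcR.
move=> w; rewrite !subr0 cexp0 mul1r => wd.
have [xw yw] : `|complex.Re w| <= complex.Re `|w| /\ `|complex.Im w| <= complex.Re `|w|.
  rewrite normc_def /=; split; rewrite -sqrtr_sqr ler_sqrt ?addr_ge0 ?sqr_ge0//.
    by rewrite lerDl sqr_ge0.
  by rewrite lerDr sqr_ge0.
have wr : `|w| = rc (complex.Re `|w|) by apply/esym/RRe_real; rewrite ger0_real.
rewrite wr lecR in wd; rewrite wr.
have wn (u : C) : `|u| <= rc (`|complex.Re u| + `|complex.Im u|).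
  rewrite normc_def lecR -[leRHS]ger0_norm ?addr_ge0// -sqrtr_sqr ler_sqrt ?sqr_ge0//.
  rewrite sqrrD !real_normK ?num_real// -addrA lerD2l lerDr mulrn_wge0// mulr_ge0//.
apply: le_trans (wn _) _; rewrite -rmorphM lecR.
move: (complex.Re `|w|) xw yw wd {wr wn} => N; case: w => x y /= xN yN Nd.
have N0 : 0 <= N by exact: le_trans xN.
move: Nd; rewrite !le_min => /andP[/andP[N1 N2] /andP[N3 N4]].
have := H1 x; rewrite subr0 expR0 mul1r => /(_ (le_trans xN N1)) {}H1.
have := H2 y; rewrite subr0 cos0 sin0 oppr0 mul0r subr0 => /(_ (le_trans yN N2)) {}H2.
have := H3 y; rewrite subr0 sin0 cos0 mul1r subr0 => /(_ (le_trans yN N3)) {}H3.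
have A1 : `|expR x - 1 - x| <= e' * N by apply: le_trans H1 _; rewrite ler_pM2l.
have A2 : `|cos y - 1| <= e' * N by apply: le_trans H2 _; rewrite ler_pM2l.
have A3 : `|sin y - y| <= e' * N by apply: le_trans H3 _; rewrite ler_pM2l.
have N11 : N <= 1 by exact: le_trans N4 e'1.
have A4 : `|expR x - 1| <= 2 * N.
  rewrite (_ : expR x - 1 = (expR x - 1 - x) + x); last by ring.
  apply: le_trans (ler_normD _ _) _; rewrite mulr2n mulrDl mul1r lerD//.
  by apply: le_trans A1 _; rewrite ler_piMl.
have A5 : `|expR x| <= 3.
  rewrite (_ : expR x = (expR x - 1) + 1); last by ring.
  by apply: le_trans (ler_normD _ _) _; rewrite normr1; lra.
have B1 : `|expR x * cos y - 1 - x| <= 4 * (e' * N).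
  rewrite (_ : _ - x = expR x * (cos y - 1) + (expR x - 1 - x)); last by ring.
  apply: le_trans (ler_normD _ _) _; rewrite normrM.
  have : `|expR x| * `|cos y - 1| <= 3 * (e' * N) by rewrite ler_pM.
  by lra.
have B2 : `|expR x * sin y - y| <= 4 * (e' * N) + e' * N.
  rewrite (_ : _ - y = expR x * (sin y - y) + (expR x - 1) * y); last by ring.
  apply: le_trans (ler_normD _ _) _; rewrite !normrM.
  apply: (@le_trans _ _ (3 * (e' * N) + 2 * (e' * N))); last by lra.
  apply: lerD; first by rewrite ler_pM.
  apply: (@le_trans _ _ ((2 * N) * N)); first by rewrite ler_pM.
  by rewrite -mulrA ler_pM2l// ler_wpM2r.
rewrite ?oppr0 addr0; apply: le_trans (lerD B1 B2) _.
have : e' * N <= e / 9 * N by rewrite ler_wpM2r.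
have : 0 <= e * N by rewrite mulr_ge0// ltW.
lra.
Qed.

Lemma cdiff_cexp z : cdiff cexp z.
Proof.
exists (cexp z) => e e0.
have cz0 : 0 < `|cexp z| by rewrite norm_cexp ltcR expR_gt0.
have e'0 : 0 < e / `|cexp z| by rewrite divr_gt0.
have [d d0 H] := cderiv_cexp0 e'0; exists d => // w wz.
rewrite -{1}(subrK z w) cexpD.
have := H (w - z); rewrite subr0 cexp0 mul1r => /(_ wz) B.
rewrite (_ : _ - _ = (cexp (w - z) - 1 - (w - z)) * cexp z); last by ring.
by rewrite normrM -ler_pdivlMr// mulrAC.
Qed.
End ComplexExponential.

(** * The maximum principle and the Schwarz lemma on the disk *)

Section MaximumPrinciple.
Variable R : realType.
Local Notation C := R[i].
Local Notation rc := (real_complex R).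
Implicit Types (f u : C -> C) (p z w M : C).

(** The exponential maps the rectangle with sides [s0, 0] and [0, 2 pi] onto the
    annulus between the circle of radius exp s0 and the unit circle. The
    horizontal edges cancel by periodicity, so Goursat's theorem compares the
    mean of f over the roots of unity of order 2^n with its mean over a circle
    on which f is close to f 0. *)
Lemma norm_le_of_center_circle f M :
  (forall z, `|z| <= 1 -> cdiff f z) -> (forall z, `|z| = 1 -> `|f z| <= M) ->
  `|f 0| <= M.
Proof.
move=> df fM; apply/ler_addgt0Pr => e e0.
pose be : C := Complex 0 (pi *+ 2).
have be0 : 0 < `|be|.
  by rewrite normr_gt0 eq_complex /= negb_and (@gt_eqF _ _ (pi *+ 2)) ?orbT// mulrn_wgt0// pi_gt0.
have e20 : 0 < e / 2 by rewrite divr_gt0.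
have df0 : cdiff f 0 by apply: df; rewrite normr0 ler01.
have [d d0 fd] := cdiff_continuous df0 e20.
have dr : d = rc (complex.Re d) by apply/esym/RRe_real; rewrite ger0_real// ltW.
have d1 : 0 < complex.Re d by rewrite -ltcR -dr.
pose s0 : R := Num.min 0 (ln (complex.Re d)).
have s00 : s0 <= 0 by rewrite ge_min lexx.
have s0d : rc (expR s0) <= d.
  rewrite dr lecR; apply: (@le_trans _ _ (expR (ln (complex.Re d)))).
    by rewrite ler_expR ge_min lexx orbT.
  by rewrite lnK.
pose F w := f (cexp w).
have dF s t : 0 <= s <= 1 -> 0 <= t <= 1 ->
    cdiff F (rc s0 + rc s * rc (- s0) + rc t * be).
  move=> /andP[_ s1] _; apply: cdiff_comp; first exact: cdiff_cexp.
  apply: df; rewrite norm_cexp -(rmorph1 rc) lecR -expR0 ler_expR /=.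
  rewrite !mul0r !mulr0 !subr0 !addr0 mulrN -{1}(mul1r s0) -mulrBl.
  by rewrite mulr_ge0_le0// subr_ge0.
have eb0 : 0 < e / 2 * `|be| by rewrite mulr_gt0.
have [n /(_ n (leqnn n))] := goursat dF eb0.
set N := (2 ^ n)%N; have N0 : (0 < N)%N by rewrite expn_gt0.
have Re0 (j : nat) : complex.Re (j%:R / N%:R * be) = 0.
  have -> : j%:R / N%:R = rc (j%:R / N%:R) by rewrite rmorphM fmorphV !rmorph_nat.
  by rewrite /= mulr0 mul0r subr0.
rewrite /contour (_ : edge F N (rc s0 + be) _ = edge F N (rc s0) (rc (- s0))); last first.
  by apply: eq_bigr => j _; rewrite addrAC /F cexpD2pi.
rewrite subrr add0r (_ : rc s0 + rc (- s0) = 0); last by rewrite rmorphN subrr.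
move=> H1.
have H2 : `|edge F N 0 be| <= `|be| * M.
  apply: edge_norm_le => // j _; apply: fM.
  by rewrite norm_cexp add0r Re0 expR0.
have H3 : `|edge F N (rc s0) be - be * f 0| <= `|be| * (e / 2).
  have -> : be * f 0 = edge (fun=> f 0) N (rc s0) be.
    rewrite /edge sumr_const card_ord -mulr_natr.
    by field; rewrite pnatr_eq0 -lt0n.
  rewrite -edgeB; apply: edge_norm_le => // j _; apply: fd.
  rewrite subr0 norm_cexp (_ : complex.Re _ = s0)//.
  by rewrite raddfD /= Re0 addr0.
rewrite -(ler_pM2l be0) -normrM.
have -> : be * f 0 = - (edge F N (rc s0) be - be * f 0)
  + (- (edge F N 0 be - edge F N (rc s0) be) + edge F N 0 be) by ring.
apply: le_trans (ler_normD _ _) _; rewrite normrN.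
have -> : `|be| * (M + e) = `|be| * (e / 2) + (e / 2 * `|be| + `|be| * M) by field.
apply: lerD => //; apply: le_trans (ler_normD _ _) _; rewrite normrN.
exact: lerD.
Qed.

(** The Moebius map mu preserves the closed disk and the circle, and takes 0 to
    p. *)
Lemma maximum_principle f M p :
  (forall z, `|z| <= 1 -> cdiff f z) -> (forall z, `|z| = 1 -> `|f z| <= M) ->
  `|p| < 1 -> `|f p| <= M.
Proof.
move=> df fM p1.
pose den z := 1 + p^* * z.
have den0 z : `|z| <= 1 -> den z != 0.
  move=> z1; rewrite /den addr_eq0; apply/eqP => /(congr1 Num.norm).
  rewrite normr1 normrN normrM norm_conjC => E.
  suff : `|p| * `|z| < 1 by rewrite -E ltxx.
  by apply: le_lt_trans p1; rewrite ler_piMr.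
pose mu z := (z + p) * (den z)^-1.
have key z : `|z| <= 1 -> `|den z| ^+ 2 - `|z + p| ^+ 2 = (1 - `|p| ^+ 2) * (1 - `|z| ^+ 2).
  by move=> _; rewrite /den !normCK !(rmorphD, rmorphM, rmorph1) /= conjCK; ring.
have p2 : 0 <= 1 - `|p| ^+ 2 by rewrite subr_ge0 exprn_ile1// ltW.
have mu_norm z : `|z| <= 1 -> `|mu z| <= 1.
  move=> z1; rewrite /mu normrM normfV ler_pdivrMr ?normr_gt0 ?den0// mul1r.
  rewrite -(@ler_pXn2r _ 2) ?nnegrE// -subr_ge0 key// mulr_ge0//.
  by rewrite subr_ge0 exprn_ile1.
have mu_norm1 z : `|z| = 1 -> `|mu z| = 1.
  move=> z1; have zl : `|z| <= 1 by rewrite z1.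
  rewrite /mu normrM normfV.
  have D : `|den z| != 0 by rewrite normr_eq0 den0.
  have := key z zl; rewrite z1 expr1n subrr mulr0 => /eqP; rewrite subr_eq0.
  rewrite eqrXn2// => /eqP <-; exact: divff.
have E : mu 0 = p by rewrite /mu /den mulr0 addr0 add0r invr1 mulr1.
suff : `|f (mu 0)| <= M by rewrite E.
apply: (@norm_le_of_center_circle (fun z => f (mu z))).
  move=> z z1; apply: cdiff_comp; last by apply: df; exact: mu_norm.
  apply: cdiffM; first by apply: cdiffD; [exact: cdiff_id|exact: cdiff_cst].
  apply: cdiffV; first exact: den0.
  apply: cdiffD; first exact: cdiff_cst.
  by apply: cdiffM; [exact: cdiff_cst|exact: cdiff_id].
by move=> z z1; apply: fM; exact: mu_norm1.
Qed.

Lemma power_bounded_le1 (a b : C) : 0 < a -> 0 <= b ->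
  (forall n, a * b ^+ n <= 1) -> b <= 1.
Proof.
move=> a0 b0 H; have br : b \is Num.real by rewrite ger0_real.
rewrite real_leNgt ?real1//; apply/negP => b1.
have c0 : 0 < a * (b - 1) by rewrite mulr_gt0// subr_gt0.
(* Bernoulli's inequality, for the exponent 2^K, contradicts the bound *)
have [K /(_ K (leqnn K)) HK] := dyadic_small c0.
have B n : 1 + n%:R * (b - 1) <= b ^+ n.
  elim: n => [|n IH]; first by rewrite mul0r addr0 expr0.
  rewrite exprS; apply: le_trans (ler_wpM2l b0 IH).
  rewrite -subr_ge0 (_ : _ - _ = n%:R * (b - 1) ^+ 2); last by rewrite -natr1; ring.
  by rewrite mulr_ge0// exprn_ge0// subr_ge0 ltW.
have := H (2 ^ K)%N; apply/negP; rewrite -real_ltNge ?real1 ?ger0_real//; last first.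
  by rewrite mulr_ge0 ?exprn_ge0// ltW.
apply: (lt_le_trans _ (ler_wpM2l (ltW a0) (B _))).
rewrite mulrDr mulr1 natrX mulrCA.
apply: (@lt_le_trans _ _ (a + 1)); first by rewrite ltrDr.
rewrite lerD2l; apply: le_trans (ler_wpM2l _ HK); last by rewrite exprn_ge0.
by rewrite -exprMn divff ?expr1n// pnatr_eq0.
Qed.

(** The maximum principle for u z (u z / z)^n gives |p| |u p / p|^(n+1) <= 1 for
    every n. The factor u z makes this function differentiable at 0 whatever
    value is given to 0 / 0, so no removable singularity has to be filled. *)
Lemma schwarz u p :
  (forall z, `|z| <= 1 -> cdiff u z) -> u 0 = 0 ->
  (forall z, `|z| = 1 -> `|u z| <= 1) -> `|p| < 1 -> `|u p| <= `|p|.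
Proof.
move=> du u0 u1 p1; have [->|pn0] := eqVneq p 0; first by rewrite u0.
have p0 : 0 < `|p| by rewrite normr_gt0.
suff : `|u p / p| <= 1 by rewrite normrM normfV ler_pdivrMr// mul1r.
apply: (@power_bounded_le1 `|p|) => // n.
case: n => [|n]; first by rewrite expr0 mulr1 ltW.
rewrite -normrX -normrM (_ : p * _ = u p * (u p / p) ^+ n); last by rewrite exprS; field.
apply: (@maximum_principle (fun z => u z * (u z / z) ^+ n)) => // [z z1|z z1]; last first.
  rewrite normrM normrX normrM normfV z1 invr1 mulr1 -exprS exprn_ile1// u1//.
have [->|zn0] := eqVneq z 0; last first.
  apply: cdiffM; first exact: du.
  apply: cdiffX; apply: cdiffM; first exact: du.
  by apply: cdiffV => //; exact: cdiff_id.
have [l ul] : cdiff u 0 by apply: du; rewrite normr0.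
exists (l ^+ n.+1) => e e0.
have [d1 d10 H1] := cdiff_continuous (cdiffX n.+1 (cdiff_id l)) e0.
have [d d0 H] := ul _ d10; exists d => // w; rewrite u0 !subr0 mul0r subr0 => wd.
have [->|w0] := eqVneq w 0; first by rewrite u0 mul0r mulr0 subr0 normr0 mulr0.
have -> : u w * (u w / w) ^+ n - l ^+ n.+1 * w = ((u w / w) ^+ n.+1 - l ^+ n.+1) * w.
  by rewrite (exprS (u w / w)); field.
rewrite normrM ler_wpM2r//; apply: H1.
have := H w; rewrite u0 !subr0 => /(_ wd).
rewrite -ler_pdivrMr ?normr_gt0// -normfV -normrM; congr (`|_| <= _); field => //.
Qed.
End MaximumPrinciple.

(** * Hermitian forms and the involutions of the ball *)

Lemma one_subM_neq0 (K : numDomainType) (a b : K) :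
  `|a| < 1 -> `|b| < 1 -> 1 - a * b != 0.
Proof.
move=> a1 b1; rewrite subr_eq0; apply/eqP => /(congr1 Num.norm).
rewrite normr1 normrM => E.
have : `|a| * `|b| < 1 by apply: mulr_ilt1.
by rewrite -E ltxx.
Qed.

Section DotForms.
Variables (C : numClosedFieldType) (U : lmodType C) (f : {dot U for conjC}).
Implicit Types (u v w : U) (a : C).

Lemma dotDl u v w : f (u + v) w = f u w + f v w. Proof. exact: linearDl. Qed.
Lemma dotBl u v w : f (u - v) w = f u w - f v w. Proof. exact: linearBl. Qed.
Lemma dotZl a u v : f (a *: u) v = a * f u v. Proof. exact: linearZl_LR. Qed.
Lemma dotDr u v w : f w (u + v) = f w u + f w v. Proof. exact: linearDr. Qed.
Lemma dotBr u v w : f w (u - v) = f w u - f w v. Proof. exact: linearBr. Qed.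
Lemma dotZr a u v : f u (a *: v) = a^* * f u v. Proof. exact: linearZr_LR. Qed.
Lemma dot0l u : f 0 u = 0. Proof. exact: linear0l. Qed.
Lemma dot0r u : f u 0 = 0. Proof. exact: linear0r. Qed.
Lemma dotC u v : f u v = (f v u)^*.
Proof. by rewrite (hermC f) expr0 mul1r. Qed.
Lemma dot_ge0 u : 0 <= f u u. Proof. exact: dnorm_ge0. Qed.
Lemma dot_conj u : (f u u)^* = f u u. Proof. by rewrite -dotC. Qed.

(** The defect, multiplied by f v v, is the square norm of
    f v v *: u - f u v *: v. *)
Lemma cauchy_schwarz u v : `|f u v| ^+ 2 <= f u u * f v v.
Proof.
have [->|v0] := eqVneq v 0; first by rewrite !dot0r normr0 expr0n mulr0.
have vv : 0 < f v v by rewrite dnorm_gt0.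
rewrite -subr_ge0 -(pmulr_lge0 _ vv).
rewrite (_ : _ * f v v = f (f v v *: u - f u v *: v) (f v v *: u - f u v *: v)).
  exact: dot_ge0.
rewrite dotBl !dotBr !dotZl !dotZr (dotC v u) normCK dot_conj; ring.
Qed.

Lemma cauchy_schwarz_eq u v : `|f u v| ^+ 2 = f u u * f v v ->
  f v v *: u = f u v *: v.
Proof.
move=> E; apply/eqP; rewrite -subr_eq0 -(dnorm_eq0 f) dotBl !dotBr !dotZl !dotZr.
rewrite (dotC v u) dot_conj; move: E; rewrite normCK => E.
rewrite (_ : _ - _ = f v v * (f u u * f v v - f u v * (f u v)^*)); last by ring.
by rewrite E subrr mulr0.
Qed.
End DotForms.

Section Ball.
Variables (C : numClosedFieldType) (m : nat).
Local Notation V := 'rV[C]_m.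
Local Notation "''[' u , v ]" := (dotmx (C := C) (n := m) u v) : ring_scope.
Implicit Types (a u v w z : V).

Lemma dotmxBl u v w : '[u - v, w] = '[u, w] - '[v, w]. Proof. exact: dotBl. Qed.
Lemma dotmxZl c u v : '[c *: u, v] = c * '[u, v]. Proof. exact: dotZl. Qed.
Lemma dotmxBr u v w : '[w, u - v] = '[w, u] - '[w, v]. Proof. exact: dotBr. Qed.
Lemma dotmxZr c u v : '[u, c *: v] = c^* * '[u, v]. Proof. exact: dotZr. Qed.
Lemma dotmx0l u : '[0, u] = 0. Proof. exact: dot0l. Qed.
Lemma dotmx0r u : '[u, 0] = 0. Proof. exact: dot0r. Qed.
Lemma dotmxC u v : '[u, v] = '[v, u]^*. Proof. exact: dotC. Qed.
Lemma dotmx_ge0 u : 0 <= '[u, u]. Proof. exact: dot_ge0. Qed.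
Lemma dotmx_gt0 u : (0 < '[u, u]) = (u != 0). Proof. exact: dnorm_gt0. Qed.
Lemma dotmx_eq0 u : ('[u, u] == 0) = (u == 0). Proof. exact: dnorm_eq0. Qed.

Lemma dotmx_sum u v : '[u, v] = \sum_j u 0 j * (v 0 j)^*.
Proof. by rewrite dotmxE mxE; apply: eq_bigr => j _; rewrite !mxE. Qed.

Lemma dotmx_delta j : '[delta_mx 0 j, delta_mx 0 j] = 1.
Proof.
rewrite dotmx_sum (bigD1 j)//= big1 => [|i ij]; first by rewrite mxE !eqxx conjC1 mulr1 addr0.
by rewrite mxE (negbTE ij) andbF mul0r.
Qed.

Definition unit_dir v := (sqrtC '[v, v])^-1 *: v.

Lemma dot_unit_dir v : '[v, unit_dir v] = sqrtC '[v, v].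
Proof.
have [->|v0] := eqVneq v 0; first by rewrite !dotmx0l sqrtC0.
have n0 : 0 < sqrtC '[v, v] by rewrite sqrtC_gt0 dotmx_gt0.
rewrite dotmxZr conj_Creal; last by rewrite gtr0_real// invr_gt0.
by rewrite -[X in _ * X]sqrtCK; field; rewrite gt_eqF.
Qed.

Lemma unit_dir_norm v : v != 0 -> '[unit_dir v, unit_dir v] = 1.
Proof.
move=> v0; rewrite [LHS]dotmxZl dot_unit_dir mulVf// gt_eqF//.
by rewrite sqrtC_gt0 dotmx_gt0.
Qed.

Lemma ball_dot_lt1 u v : '[u, u] < 1 -> '[v, v] < 1 -> `|'[u, v]| < 1.
Proof.
move=> u1 v1; rewrite -(@ltr_pXn2r _ 2) ?nnegrE// expr1n.
apply: le_lt_trans (cauchy_schwarz _ u v) _.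
by apply: mulr_ilt1 => //; exact: dotmx_ge0.
Qed.

Lemma ball_den_neq0 u v : '[u, u] < 1 -> '[v, v] < 1 -> 1 - '[u, v] != 0.
Proof.
move=> u1 v1; rewrite subr_eq0; apply/eqP => /(congr1 Num.norm).
by rewrite normr1 => E; have := ball_dot_lt1 u1 v1; rewrite -E ltxx.
Qed.

Definition ball_s a : C := sqrtC (1 - '[a, a]).

(** The involutive automorphism of the ball which exchanges 0 and a. The usual
    coefficient (1 - s) / <a, a> of the projection on a is written 1 / (1 + s),
    so that a = 0 needs no exception. *)
Definition ball_inv a z : V :=
  (1 - '[z, a])^-1 *: (a - ball_s a *: z - ('[z, a] / (1 + ball_s a)) *: a).

Lemma ball_inv_zero a : ball_inv a 0 = a.
Proof.
by rewrite /ball_inv dotmx0l subr0 invr1 scale1r scaler0 mul0r scale0r !subr0.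
Qed.

Section Inv.
Variable a : V.
Hypothesis a1 : '[a, a] < 1.
Let s := ball_s a.

Lemma ball_s_gt0 : 0 < s. Proof. by rewrite sqrtC_gt0 subr_gt0. Qed.
Lemma ball_s_sqr : '[a, a] = 1 - s * s.
Proof. by rewrite -expr2 sqrtCK; ring. Qed.
Lemma ball_s_conj : s^* = s.
Proof. by rewrite conj_Creal// ger0_real// ltW// ball_s_gt0. Qed.
Lemma ball_s1_neq0 : 1 + s != 0.
Proof. by rewrite gt_eqF// addr_gt0// ball_s_gt0. Qed.

(** Up to a rescaling, the kernel 1 / (1 - <z, w>) is invariant. *)
Lemma ball_inv_dot z w : '[z, z] < 1 -> '[w, w] < 1 ->
  1 - '[ball_inv a z, ball_inv a w] =
  (1 - '[a, a]) * (1 - '[z, w]) / ((1 - '[z, a]) * (1 - '[a, w])).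
Proof.
move=> z1 w1; have Dz := ball_den_neq0 z1 a1; have Dw := ball_den_neq0 a1 w1.
have s1 := ball_s1_neq0.
rewrite /ball_inv dotmxZl dotmxZr !dotmxBl !dotmxBr !dotmxZl !dotmxZr fmorphV rmorphB rmorph1 /=.
rewrite -(dotmxC a w) !rmorphM !fmorphV !rmorphD !rmorph1 /= -/s ball_s_conj -(dotmxC a w).
by rewrite ball_s_sqr; field; rewrite s1 Dz Dw.
Qed.

Lemma ball_invK z : '[z, z] < 1 -> ball_inv a (ball_inv a z) = z.
Proof.
move=> z1; have Dz := ball_den_neq0 z1 a1; have s1 := ball_s1_neq0.
have s0 : s != 0 by rewrite gt_eqF// ball_s_gt0.
have E : '[ball_inv a z, a] = ('[a, a] - '[z, a]) / (1 - '[z, a]).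
  rewrite /ball_inv dotmxZl !dotmxBl !dotmxZl -/s ball_s_sqr; field; by rewrite s1 Dz.
rewrite {1}/ball_inv E -/s /ball_inv -/s ball_s_sqr.
set t := '[z, a] in Dz *; clearbody t.
have D2 : 1 - (1 - s * s - t) / (1 - t) != 0.
  by rewrite (_ : _ - _ = s * s / (1 - t)) ?mulf_neq0 ?invr_neq0//; field.
have D3 : 1 - t - (1 - s * s - t) != 0.
  by rewrite (_ : _ - _ = s * s) ?mulf_neq0//; ring.
by apply/rowP => j; rewrite !mxE; field; rewrite s1 Dz D3.
Qed.

Lemma ball_inv_inj u v : '[u, u] < 1 -> '[v, v] < 1 ->
  ball_inv a u = ball_inv a v -> u = v.
Proof. by move=> u1 v1 E; rewrite -(ball_invK u1) E (ball_invK v1). Qed.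

Lemma ball_inv_center : ball_inv a a = 0.
Proof.
have Da := ball_den_neq0 a1 a1; have s1 := ball_s1_neq0.
rewrite /ball_inv; apply/rowP => j; rewrite !mxE -/s ball_s_sqr.
apply/eqP; rewrite mulf_eq0; apply/orP; right; apply/eqP; field => //.
Qed.

Lemma ball_inv_ball z : '[z, z] < 1 -> '[ball_inv a z, ball_inv a z] < 1.
Proof.
move=> z1; rewrite -subr_gt0 ball_inv_dot// (dotmxC a z).
rewrite (_ : 1 - '[z, a]^* = (1 - '[z, a])^*); last by rewrite rmorphB rmorph1.
by apply: divr_gt0; rewrite ?mul_conjC_gt0 ?ball_den_neq0// mulr_gt0 ?subr_gt0.
Qed.
End Inv.

(** Reduces the Schwarz lemma on the ball to functions of one variable: G is
    restricted to the disk spanned by a vector w in the direction of z, and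
    composed with the coordinate in the direction of G z. The vector w has norm
    r < 1, so that the closed disk stays in the ball, and r tends to 1. *)
Lemma slice_bound_norm_le (G : V -> V) :
  (forall z, '[z, z] < 1 -> '[G z, G z] < 1) -> G 0 = 0 ->
  (forall w v (p : C), '[w, w] < 1 -> '[v, v] = 1 -> `|p| < 1 ->
     `|'[G (p *: w), v]| <= `|p|) ->
  forall z, '[z, z] < 1 -> '[G z, G z] <= '[z, z].
Proof.
move=> GB G0 slice z z1; have z0 := dotmx_ge0 z.
have g0 := dotmx_ge0 (G z).
have [->|zn0] := eqVneq z 0; first by rewrite G0.
have zp : 0 < '[z, z] by rewrite dotmx_gt0.
have [->|gn0] := eqVneq (G z) 0; first by rewrite dotmx0l.
have gp : 0 < '[G z, G z] by rewrite dotmx_gt0.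
suff H (r : C) : '[z, z] < r ^+ 2 -> r ^+ 2 < 1 -> 0 < r ->
    '[G z, G z] * r ^+ 2 <= '[z, z].
  apply/ler_addgt0Pr => e e0.
  have e1 : 0 < 1 - '[z, z] by rewrite subr_gt0.
  have [d d0 [de d1]] := pos_lower_bound e0 e1.
  pose r := sqrtC (1 - d / 2).
  have d2 : d / 2 < 1 - '[z, z].
    by apply: lt_le_trans d1; rewrite gtr_pMr// invf_lt1 ?ltr1n.
  have rp : 0 < 1 - d / 2.
    by rewrite subr_gt0; apply: lt_le_trans d2 _; rewrite lerBlDr lerDl.
  have r2 : r ^+ 2 = 1 - d / 2 by rewrite sqrtCK.
  have := H r; rewrite r2 sqrtC_gt0 rp => /(_ _ _ isT) {}H.
  have : '[G z, G z] * (1 - d / 2) <= '[z, z].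
    apply: H; first by rewrite ltrBrDl -ltrBrDr.
    by rewrite ltrBlDr ltrDl divr_gt0.
  rewrite mulrBr mulr1 lerBlDr => /le_trans; apply; rewrite lerD2l.
  have g1 := GB z z1.
  apply: le_trans de; apply: (@le_trans _ _ (1 * d)); last by rewrite mul1r.
  apply: ler_pM => //; rewrite ?divr_ge0 ?ltW//.
  by rewrite gtr_pMr// invf_lt1 ?ltr1n.
move=> zr r1 r0.
pose n := sqrtC '[z, z]; have n0 : 0 < n by rewrite sqrtC_gt0.
have n2 : n ^+ 2 = '[z, z] by rewrite sqrtCK.
pose w := (r / n) *: z.
have wB : '[w, w] = r ^+ 2.
  rewrite dotmxZl dotmxZr conj_Creal; last by rewrite gtr0_real// divr_gt0.
  by rewrite -n2; field; rewrite gt_eqF.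
pose k := sqrtC '[G z, G z]; have k0 : 0 < k by rewrite sqrtC_gt0.
have k2 : k ^+ 2 = '[G z, G z] by rewrite sqrtCK.
pose v := unit_dir (G z); have v1 : '[v, v] = 1 by exact: unit_dir_norm.
have rn : `|n / r| < 1.
  rewrite ger0_norm ?divr_ge0 ?ltW// ltr_pdivrMr// mul1r.
  by rewrite -(@ltr_pXn2r _ 2) ?nnegrE ?ltW// n2.
have := @slice w v (n / r); rewrite wB v1 => /(_ r1 erefl rn).
have -> : (n / r) *: w = z.
  by rewrite /w scalerA (_ : _ * _ = 1) ?scale1r//; field; rewrite !gt_eqF.
rewrite dot_unit_dir -/k (gtr0_norm k0) (gtr0_norm (divr_gt0 n0 r0)) ler_pdivlMr// => S.
by rewrite -n2 -k2 -exprMn ler_pXn2r// ?nnegrE ?mulr_ge0// ltW.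
Qed.
End Ball.

(** * The Schwarz lemma on the ball *)

Section VectorDifferentiability.
Variables (K : numFieldType) (m : nat).
Local Notation V := 'rV[K]_m.
Implicit Types (G : V -> V) (k : V -> K) (z c : V) (b : 'I_m -> K).

Lemma differentiable_functional (U : normedModType K) (G : U -> V) (z : U) b :
  differentiable G z -> differentiable (fun w => \sum_j G w 0 j * b j : K) z.
Proof.
move=> dG.
have -> : (fun w => \sum_j G w 0 j * b j) = \sum_j (fun w => G w 0 j * b j : K).
  by apply/funext => w; rewrite fct_sumE.
apply: differentiable_sum => j; apply: differentiableM; last exact: differentiable_cst.
exact: (differentiable_comp dG (differentiable_coord _ _ _)).
Qed.

Lemma differentiable_scalev k G z : differentiable k z -> differentiable G z ->
  differentiable (fun w => k w *: G w) z.
Proof.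
move=> dk dG.
have -> : (fun w => k w *: G w) = \sum_j (fun w => (k w * G w 0 j) *: delta_mx 0 j).
  apply/funext => w; rewrite fct_sumE [G w in LHS]row_sum_delta scaler_sumr.
  by apply: eq_bigr => j _; rewrite scalerA.
apply: differentiable_sum => j; apply: differentiableZl; apply: differentiableM => //.
exact: (differentiable_comp dG (differentiable_coord _ _ _)).
Qed.

Lemma differentiable_id z : differentiable (id : V -> V) z.
Proof. exact: ex_diff. Qed.

Lemma differentiable_fractional (c : V) (s k : K) b z :
  let d w := \sum_j w 0 j * b j in 1 - d z != 0 ->
  differentiable (fun w : V => (1 - d w)^-1 *: (c - s *: w - (d w / k) *: c)) z.
Proof.
move=> d d0.
have dd : differentiable (d : V -> K) z.
  exact: (differentiable_functional b (differentiable_id z)).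
apply: differentiable_scalev.
  by apply: differentiableV => //; apply: differentiableB.
apply: differentiableB.
  apply: differentiableB; first exact: differentiable_cst.
  exact: differentiableZ (differentiable_id z).
apply: differentiableZl; apply: differentiableM => //.
Qed.

Lemma differentiable_reflection (c : V) b z :
  differentiable (fun w : V => w - (\sum_j w 0 j * b j) *: c) z.
Proof.
apply: differentiableB; first exact: differentiable_id.
apply: differentiableZl; exact: (differentiable_functional b (differentiable_id z)).
Qed.

Lemma differentiable_slice G z b (t : K) :
  differentiable G (t *: z) -> cdiff (fun t => \sum_j G (t *: z) 0 j * b j) t.
Proof.
move=> dG; apply/cdiffP; apply/derivable1_diffP.
apply: (@differentiable_functional K (fun t : K => G (t *: z))).
by apply: (@differentiable_comp _ _ _ _ (fun t : K => t *: z) G).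
Qed.
End VectorDifferentiability.

Section SchwarzPick.
Variables (R : realType) (m : nat).
Local Notation C := R[i].
Local Notation V := 'rV[C]_m.
Local Notation "''[' u , v ]" := (dotmx (C := C) (n := m) u v) : ring_scope.
Local Notation ball := (unit_ball R m).
Implicit Types (f g G : V -> V) (a b u v w z : V).

Lemma holomorphic_comp f g : holomorphic_self_map f -> holomorphic_self_map g ->
  holomorphic_self_map (f \o g).
Proof.
move=> hf hg z zB; have [gB dg] := hg z zB; have [fB df] := hf _ gB.
split; first exact: fB.
exact: (@differentiable_comp _ (Cspace R m) (Cspace R m) (Cspace R m) g f z dg df).
Qed.

Lemma holomorphic_ball_inv a : ball a -> holomorphic_self_map (ball_inv a).
Proof.
move=> aB z zB; split; first exact: (ball_inv_ball aB zB).
have E w : '[w, a] = \sum_j w 0 j * (a 0 j)^* by exact: dotmx_sum.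
have -> : ball_inv a = fun w => (1 - \sum_j w 0 j * (a 0 j)^*)^-1 *:
   (a - ball_s a *: w - ((\sum_j w 0 j * (a 0 j)^*) / (1 + ball_s a)) *: a).
  by apply/funext => w; rewrite /ball_inv E.
apply: (@differentiable_fractional C m a (ball_s a) (1 + ball_s a) (fun j => (a 0 j)^* )).
rewrite -E; exact: (ball_den_neq0 zB aB).
Qed.

Lemma schwarz_ball G : holomorphic_self_map G -> G 0 = 0 ->
  forall z, ball z -> '[G z, G z] <= '[z, z].
Proof.
move=> hG G0; apply: (@slice_bound_norm_le C m G _ G0).
  by move=> z zB; have [gB _] := hG z zB; exact: gB.
move=> w v p w1 v1 p1.
have tB t : `|t| <= 1 -> ball (t *: w).
  move=> t1; rewrite /unit_ball /= dotmxZl dotmxZr mulrA -normCK.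
  apply: le_lt_trans w1; rewrite ler_piMl ?dotmx_ge0//.
  by rewrite exprn_ile1.
apply: (@schwarz R (fun t => '[G (t *: w), v])) => //.
- move=> t t1; apply: (@cdiff_ext _ (fun t => \sum_j G (t *: w) 0 j * (v 0 j)^*)).
    by move=> x; rewrite dotmx_sum.
  by apply: (@differentiable_slice R[i] m); have [_] := hG _ (tB t t1).
- by rewrite scale0r G0 dotmx0l.
- move=> t t1; rewrite -(@ler_pXn2r _ 2) ?nnegrE ?normr_ge0 ?ler01// expr1n.
  apply: le_trans (cauchy_schwarz _ _ _) _; rewrite [X in _ * X]v1 mulr1.
  have t1' : `|t| <= 1 by rewrite t1 lexx.
  by have [/ltW gB _] := hG _ (tB t t1'); exact: gB.
Qed.
End SchwarzPick.

(** * The Schwarz-Pick lemma and complex geodesics *)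

Section Parallel.
Variables (C : numClosedFieldType) (m : nat).
Local Notation V := 'rV[C]_m.
Local Notation "''[' u , v ]" := (dotmx (C := C) (n := m) u v) : ring_scope.
Implicit Types (a b u v w z : V) (g : V -> V).

(** Linear dependence, in a form that is visibly preserved by the maps which
    preserve norms and moduli of inner products. *)
Definition parallel u v : Prop := `|'[u, v]| ^+ 2 = '[u, u] * '[v, v].

Lemma parallelC u v : parallel u v -> parallel v u.
Proof. by rewrite /parallel dotmxC norm_conjC mulrC. Qed.

Lemma parallel0l v : parallel 0 v.
Proof. by rewrite /parallel !dotmx0l normr0 expr0n mul0r. Qed.

Lemma parallel_refl u : parallel u u.
Proof. by rewrite /parallel ger0_norm// dotmx_ge0. Qed.

Lemma parallelZZ (c d : C) v : parallel (c *: v) (d *: v).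
Proof.
rewrite /parallel !dotmxZl !dotmxZr !normrM !exprMn norm_conjC !normCK.
by rewrite -(dotmxC v v); ring.
Qed.

Lemma parallel_eqn u v : parallel u v -> '[v, v] *: u = '[u, v] *: v.
Proof. exact: cauchy_schwarz_eq. Qed.

Lemma ball_inv_norm b a : '[b, b] < 1 -> '[a, a] < 1 ->
  1 - '[ball_inv b a, ball_inv b a] =
  (1 - '[b, b]) * (1 - '[a, a]) / `|1 - '[a, b]| ^+ 2.
Proof.
by move=> b1 a1; rewrite ball_inv_dot// (dotmxC b a) normCK rmorphB rmorph1.
Qed.

Lemma ball_inv0 z : ball_inv 0 z = - z.
Proof.
rewrite /ball_inv /ball_s dotmx0r dotmx0l subr0 invr1 scale1r sqrtC1 scaler0 subr0.
by rewrite scale1r sub0r.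
Qed.

(** A map which fixes 0 and preserves the pseudo-hyperbolic distance commutes
    with multiplication by 1/2, and so preserves |<a, b>|: the values of
    |1 - t <a, b>|^2 at t = 1 and t = 1/2 determine |<a, b>|^2. *)
Lemma pick_isometry_dot_norm g :
  (forall z, '[z, z] < 1 -> '[g z, g z] < 1) -> g 0 = 0 ->
  (forall a b, '[a, a] < 1 -> '[b, b] < 1 ->
     '[ball_inv (g b) (g a), ball_inv (g b) (g a)] = '[ball_inv b a, ball_inv b a]) ->
  forall a b, '[a, a] < 1 -> '[b, b] < 1 ->
    '[g a, g a] = '[a, a] /\ `|'[g a, g b]| ^+ 2 = `|'[a, b]| ^+ 2.
Proof.
move=> gB g0 gI.
have N0 : '[0 : V, 0] < 1 by rewrite dotmx0l.
have gN a : '[a, a] < 1 -> '[g a, g a] = '[a, a].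
  move=> a1; have := gI a 0 a1 N0; rewrite g0 !ball_inv0.
  by rewrite -[- g a]scaleN1r -[- a]scaleN1r !dotmxZl !dotmxZr rmorphN1 !mulN1r !opprK.
have gD a b : '[a, a] < 1 -> '[b, b] < 1 ->
    `|1 - '[g a, g b]| ^+ 2 = `|1 - '[a, b]| ^+ 2.
  move=> a1 b1; have ga1 := gB a a1; have gb1 := gB b b1.
  have := congr1 (fun x => 1 - x) (gI a b a1 b1).
  rewrite /= !ball_inv_norm// !gN//.
  have c0 : (1 - '[b, b]) * (1 - '[a, a]) != 0.
    by rewrite mulf_neq0// gt_eqF// subr_gt0.
  by move=> /(mulfI c0)/invr_inj.
have conj2 : (2^-1 : C)^* = 2^-1 by rewrite conj_Creal// rpredV ?realn.
have halfB a : '[a, a] < 1 -> '[2^-1 *: a, 2^-1 *: a] < 1.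
  move=> a1; rewrite dotmxZl dotmxZr conj2; apply: le_lt_trans a1.
  by rewrite mulrA ler_piMl ?dotmx_ge0// -invfM invf_le1 ?mulr_gt0// -natrM ler1n.
have g_half a : '[a, a] < 1 -> g (2^-1 *: a) = 2^-1 *: g a.
  move=> a1; have h1 := halfB a a1.
  set w := '[g (2^-1 *: a), g a].
  have wN : `|w| <= 2^-1 * '[a, a].
    rewrite -(@ler_pXn2r _ 2) ?nnegrE ?mulr_ge0 ?invr_ge0 ?dotmx_ge0//.
    apply: le_trans (cauchy_schwarz _ _ _) _; rewrite [X in X * _]gN// [X in _ * X]gN//.
    rewrite [dotmx (_ *: _) _]dotmxZl dotmxZr conj2 le_eqVlt; apply/orP; left.
    by apply/eqP; ring.
  have wE := gD _ _ h1 a1; rewrite -/w dotmxZl in wE.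
  set n := 2^-1 * '[a, a] in wN wE.
  have n0 : 0 <= n by rewrite mulr_ge0 ?dotmx_ge0// invr_ge0.
  have n1 : n < 1.
    by apply: le_lt_trans a1; rewrite ler_piMl ?dotmx_ge0// invf_le1// ler1n.
  have {wE} wE : (1 - w) * (1 - w^*) = (1 - n) ^+ 2.
    rewrite (_ : 1 - w^* = (1 - w)^*); last by rewrite rmorphB rmorph1.
    rewrite -normCK wE.
    by rewrite ger0_norm// subr_ge0 ltW.
  (* |1 - w| = 1 - n and |w| <= n force w = n *)
  have {wN} wN : w * w^* <= n ^+ 2 by rewrite -normCK ler_pXn2r ?nnegrE.
  have wn0 : (w - n) * (w - n)^* <= 0.
    rewrite rmorphB /= (conj_Creal (ger0_real n0)).
    rewrite (_ : _ * _ = (1 - n) * (w * w^* - n ^+ 2) + n * ((1 - w) * (1 - w^*) - (1 - n) ^+ 2)); last by ring.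
    rewrite wE subrr mulr0 addr0 mulr_ge0_le0 ?subr_ge0 ?subr_le0// ltW//.
  have {wn0} wn : w = n.
    apply/eqP; rewrite -subr_eq0 -normr_eq0 -sqrf_eq0 eq_le.
    by rewrite normCK wn0 mul_conjC_ge0.
  apply/eqP; rewrite -subr_eq0 -dotmx_eq0 dotmxBl !dotmxBr !dotmxZl !dotmxZr conj2.
  rewrite (dotmxC (g a) (g _)) -/w wn (conj_Creal (ger0_real n0)) !gN//.
  rewrite dotmxZl dotmxZr conj2 -/n; apply/eqP; rewrite /n; ring.
move=> a b a1 b1; split; first exact: gN.
have h1 := halfB a a1.
have E1 := gD _ _ a1 b1; have E2 := gD _ _ h1 b1.
rewrite g_half// !dotmxZl in E2.
move: E1 E2; rewrite !normCK !rmorphB !rmorphM !rmorph1 /= conj2.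
set w := '[g a, g b]; set w' := '[a, b] => E1 E2.
have -> : w * w^* = 2 * ((1 - w) * (1 - w^*)) -
    4 * ((1 - 2^-1 * w) * (1 - 2^-1 * w^*)) + 2 by field.
by rewrite E1 E2; field.
Qed.
End Parallel.

Lemma parallel_rV1 (C : numClosedFieldType) (u v : 'rV[C]_1) : parallel u v.
Proof.
have E (w : 'rV[C]_1) : w = w 0 0 *: const_mx 1.
  by apply/rowP => t; rewrite !mxE ord1 mulr1.
by rewrite (E u) (E v); exact: parallelZZ.
Qed.

Section Geodesics.
Variables (R : realType) (m : nat).
Local Notation C := R[i].
Local Notation V := 'rV[C]_m.
Local Notation "''[' u , v ]" := (dotmx (C := C) (n := m) u v) : ring_scope.
Local Notation ball := (unit_ball R m).
Implicit Types (f g G : V -> V) (a b u v w z : V).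

Lemma ball_inv_in b a : ball b -> ball a -> ball (ball_inv b a).
Proof. by move=> bB aB; have [] := holomorphic_ball_inv bB aB. Qed.

(** The Schwarz lemma for the map ball_inv (f b) o f o ball_inv b, which fixes
    0. *)
Lemma schwarz_pick f a b : holomorphic_self_map f -> ball a -> ball b ->
  '[ball_inv (f b) (f a), ball_inv (f b) (f a)] <= '[ball_inv b a, ball_inv b a].
Proof.
move=> hf aB bB; have [faB _] := hf a aB; have [fbB _] := hf b bB.
pose G z := ball_inv (f b) (f (ball_inv b z)).
have hG : holomorphic_self_map G := holomorphic_comp (holomorphic_ball_inv fbB)
  (holomorphic_comp hf (holomorphic_ball_inv bB)).
have G0 : G 0 = 0.
  rewrite /G; rewrite (ball_inv_zero b); exact: (ball_inv_center fbB).
have GE : G (ball_inv b a) = ball_inv (f b) (f a) by rewrite /G (ball_invK bB aB).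
rewrite -GE; exact: (schwarz_ball hG G0 (ball_inv_in bB aB)).
Qed.

Lemma ball_automorphism_pick f a b : ball_automorphism f -> ball a -> ball b ->
  '[ball_inv (f b) (f a), ball_inv (f b) (f a)] = '[ball_inv b a, ball_inv b a].
Proof.
move=> [hf [g [hg gf fg]]] aB bB.
have [faB _] := hf a aB; have [fbB _] := hf b bB.
have := schwarz_pick hg faB fbB; rewrite (gf _ aB) (gf _ bB) => H.
apply: le_anti; apply/andP; split; last exact: H.
exact: (schwarz_pick hf aB bB).
Qed.

Lemma ball_automorphism_comp f g : ball_automorphism f -> ball_automorphism g ->
  ball_automorphism (f \o g).
Proof.
move=> [hf [f' [hf' ff' f'f]]] [hg [g' [hg' gg' g'g]]].
split; first exact: holomorphic_comp.
exists (g' \o f'); split; first exact: holomorphic_comp.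
  by move=> z zB; have [gB _] := hg z zB; rewrite /= ff'// gg'.
by move=> z zB; have [gB _] := hf' z zB; rewrite /= g'g// f'f.
Qed.

Lemma ball_automorphism_inv a : ball a -> ball_automorphism (ball_inv a).
Proof.
move=> aB; split; first exact: (holomorphic_ball_inv aB).
exists (ball_inv a); split; first exact: (holomorphic_ball_inv aB).
  by move=> z zB; exact: (ball_invK aB zB).
by move=> z zB; exact: (ball_invK aB zB).
Qed.

Lemma standard_disk_inv b p : standard_disk b -> standard_disk p ->
  standard_disk (ball_inv b p).
Proof.
move=> [bB b0] [pB p0]; split; first exact: (ball_inv_in bB pB).
move=> j j0; rewrite /ball_inv !mxE b0// p0//.
by rewrite !mulr0 !subr0 mulr0.
Qed.

Lemma standard_disk_parallel u v : standard_disk u -> standard_disk v -> parallel u v.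
Proof.
have E w : standard_disk w ->
    w = (\sum_(j < m | j == 0%N :> nat) w 0 j) *: \row_(j < m) (j == 0%N :> nat)%:R.
  move=> [_ w0]; apply/rowP => j; rewrite !mxE.
  have [j0|j0] := eqVneq (j : nat) 0%N; last by rewrite mulr0 w0// lt0n.
  rewrite mulr1 (big_pred1 j)// => k; by rewrite -j0.
by move=> /E -> /E ->; exact: parallelZZ.
Qed.

(** Composed with involutions on both sides, the automorphism carrying the
    standard disk to the geodesic becomes a map fixing 0, which preserves
    parallelism by [pick_isometry_dot_norm]; and two vectors of the standard
    disk are parallel. *)
Lemma geodesic_parallel Y a x y : in_one_geodesic Y -> Y a -> Y x -> Y y ->
  ball a /\ parallel (ball_inv a x) (ball_inv a y).
Proof.
move=> [_ [f hf ->] YG] /YG[b bD <-] /YG[p pD <-] /YG[q qD <-].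
have [bB _] := bD; have [pB _] := pD; have [qB _] := qD.
have [fbB _] := hf.1 b bB; split; first exact: fbB.
pose g := ball_inv (f b) \o (f \o ball_inv b).
have hg : ball_automorphism g.
  apply: ball_automorphism_comp; first exact: ball_automorphism_inv.
  by apply: ball_automorphism_comp hf _; exact: ball_automorphism_inv.
have g0 : g 0 = 0.
  by rewrite /g /= ball_inv_zero (ball_inv_center fbB).
have gE z : ball z -> ball_inv (f b) (f z) = g (ball_inv b z).
  by move=> zB; rewrite /g /= (ball_invK bB zB).
have gB z : '[z, z] < 1 -> '[g z, g z] < 1.
  by move=> zB; have [gzB _] := hg.1 z zB; exact: gzB.
have gI u v : '[u, u] < 1 -> '[v, v] < 1 ->
    '[ball_inv (g v) (g u), ball_inv (g v) (g u)] = '[ball_inv v u, ball_inv v u].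
  by move=> uB vB; exact: (ball_automorphism_pick hg uB vB).
have P := pick_isometry_dot_norm gB g0 gI.
have pB' : '[ball_inv b p, ball_inv b p] < 1 := ball_inv_in bB pB.
have qB' : '[ball_inv b q, ball_inv b q] < 1 := ball_inv_in bB qB.
have := standard_disk_parallel (standard_disk_inv bD pD) (standard_disk_inv bD qD).
rewrite (gE p pB) (gE q qB) /parallel => E.
have [N1 D] := P _ _ pB' qB'; have [N2 _] := P _ _ qB' pB'.
exact: (etrans D (etrans E (congr2 *%R (esym N1) (esym N2)))).
Qed.
End Geodesics.

(** * Complex lines through the centre *)

Section Reflection.
Variables (C : numClosedFieldType) (m : nat).
Local Notation V := 'rV[C]_m.
Local Notation "''[' u , v ]" := (dotmx (C := C) (n := m) u v) : ring_scope.
Implicit Types (e u v w x z : V) (c : C).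

(** For w = 0 this is the identity. *)
Definition reflection w z : V := z - '[z, w] *: ((2 / '[w, w]) *: w).

Lemma reflection_dot w u v : '[reflection w u, reflection w v] = '[u, v].
Proof.
have [->|w0] := eqVneq w 0; first by rewrite /reflection !scaler0 !subr0.
have ww : '[w, w] != 0 by rewrite dotmx_eq0.
rewrite /reflection dotmxBl !dotmxBr !dotmxZl !dotmxZr !rmorphM fmorphV rmorph_nat /=.
by rewrite -!(dotmxC w); field.
Qed.

Lemma reflectionZ w c z : reflection w (c *: z) = c *: reflection w z.
Proof. by rewrite /reflection dotmxZl scalerBr -!scalerA. Qed.

Lemma reflectionK w : involutive (reflection w).
Proof.
move=> z; have [->|w0] := eqVneq w 0; first by rewrite /reflection !scaler0 !subr0.
have ww : '[w, w] != 0 by rewrite dotmx_eq0.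
have E : '[reflection w z, w] = - '[z, w].
  by rewrite /reflection dotmxBl !dotmxZl; field.
rewrite {1}/reflection E /reflection; apply/rowP => j; rewrite !mxE; ring.
Qed.

Lemma reflection_swap e x : '[e, e] = '[x, x] -> '[e, x] = '[x, e] ->
  reflection (e - x) e = x.
Proof.
move=> ee ex; have [E|w0] := eqVneq (e - x) 0.
  by rewrite /reflection E !scaler0 subr0; apply/eqP; rewrite -subr_eq0 E.
have ww : '[e - x, e - x] != 0 by rewrite dotmx_eq0.
rewrite /reflection scalerA.
have -> : '[e, e - x] * (2 / '[e - x, e - x]) = 1.
  have D : '[e - x, e - x] = 2 * '[e, e - x] by rewrite dotmxBl !dotmxBr -ee ex; ring.
  have inv2 (q : C) : 2 * q != 0 -> q * (2 / (2 * q)) = 1.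
    by rewrite mulf_eq0 negb_or => /andP[_ q0]; field.
  by rewrite D inv2// -D.
by rewrite scale1r opprB addrC subrK.
Qed.

(** A reflection can exchange u and c *: v only if their inner product is real,
    whence the phase c. *)
Lemma unit_phase u v : '[u, u] = 1 -> '[v, v] = 1 ->
  exists2 c : C, `|c| = 1 & exists w, reflection w u = c *: v.
Proof.
move=> u1 v1.
have [c c1 cr] : exists2 c : C, `|c| = 1 & c^* * '[u, v] = c * '[v, u].
  have [uv|uv] := eqVneq '[u, v] 0.
    by exists 1; rewrite ?normr1// (dotmxC v u) uv rmorph0 !mulr0.
  have n0 : `|'[u, v]| != 0 by rewrite normr_eq0.
  exists ('[u, v] / `|'[u, v]|); first by rewrite normrM normfV normr_id divff.
  rewrite (dotmxC v u) rmorphM fmorphV /= (conj_Creal (normr_real _)).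
  ring.
exists c => //; exists (u - c *: v); apply: reflection_swap.
  by rewrite dotmxZl dotmxZr mulrA -normCK c1 expr1n mul1r u1 v1.
by rewrite dotmxZr dotmxZl cr.
Qed.
End Reflection.

Section LineToGeodesic.
Variables (R : realType) (m : nat).
Local Notation C := R[i].
Local Notation V := 'rV[C]_m.
Local Notation "''[' u , v ]" := (dotmx (C := C) (n := m) u v) : ring_scope.
Local Notation ball := (unit_ball R m).

Lemma reflection_in (w z : V) : ball z -> ball (reflection w z).
Proof.
rewrite /unit_ball /= => zB.
exact: (eq_ind_r (fun t => t < 1) zB (reflection_dot w z z)).
Qed.

Lemma holomorphic_reflection (w : V) : holomorphic_self_map (reflection w).
Proof.
move=> z zB; split; first exact: (reflection_in w zB).
have -> : reflection w = fun u => u - (\sum_j u 0 j * (w 0 j)^*) *: ((2 / '[w, w]) *: w).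
  by apply/funext => u; rewrite /reflection dotmx_sum.
exact: (@differentiable_reflection C m ((2 / '[w, w]) *: w) (fun j => (w 0 j)^*) z).
Qed.

Lemma ball_automorphism_reflection (w : V) : ball_automorphism (reflection w).
Proof.
split; first exact: (holomorphic_reflection w).
exists (reflection w); split; first exact: (holomorphic_reflection w).
  by move=> z _; exact: (reflectionK w z).
by move=> z _; exact: (reflectionK w z).
Qed.

Lemma line_geodesic (Y : set V) (a v : V) : (0 < m)%N -> ball a -> '[v, v] = 1 ->
  (forall x, Y x -> ball x /\ exists c, ball_inv a x = c *: v) -> in_one_geodesic Y.
Proof.
move=> m0 aB v1 YP.
pose e : V := delta_mx 0 (Ordinal m0).
have e1 : '[e, e] = 1 := dotmx_delta C (Ordinal m0).
have [c c1 [w we]] := unit_phase e1 v1.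
have c0 : c != 0 by rewrite -normr_eq0 c1 oner_eq0.
exists ((ball_inv a \o reflection w) @` standard_disk (R := R) (m := m)).
  exists (ball_inv a \o reflection w); last reflexivity.
  exact: (ball_automorphism_comp (ball_automorphism_inv aB) (ball_automorphism_reflection w)).
move=> x /YP[xB [d xd]].
have E : reflection w ((d / c) *: e) = ball_inv a x.
  by rewrite reflectionZ we scalerA divfK.
exists ((d / c) *: e); last by rewrite /= E; exact: (ball_invK aB xB).
split; last first.
  move=> j j0; rewrite /e !mxE (_ : j == Ordinal m0 = false) ?andbF ?mulr0//.
  by apply/eqP => jE; rewrite jE in j0.
have := reflection_in w (ball_inv_in aB xB); rewrite -E.
by rewrite (reflectionK w).
Qed.
End LineToGeodesic.

(** * Lagrange interpolation *)

Section Interpolation.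
Variables (C : fieldType).
Implicit Types (p q : {poly C}) (t : C).

(** This is t ^ N p(1 / t) when p has degree at most N, in a form which makes
    sense for t = 0. *)
Definition homog N p t : C := \sum_(m < N.+1) p`_m * t ^+ (N - m).

Lemma homog_mul_linear N p (a b t : C) : (size p <= N.+1)%N ->
  homog N.+1 (p * (a%:P + b *: 'X)) t = (a * t + b) * homog N p t.
Proof.
move=> sp; rewrite /homog.
have E m : (p * (a%:P + b *: 'X))`_m = a * p`_m + b * (if m is m'.+1 then p`_m' else 0).
  rewrite mulrDr -scalerAr coefD coefMC coefZ mulrC coefMX; case: m => //.
under eq_bigr do rewrite E mulrDl.
rewrite big_split /= big_ord_recr /= subnn (nth_default 0 sp) mulr0 mul0r addr0.
rewrite mulrDl; congr (_ + _).
  rewrite mulr_sumr; apply: eq_bigr => m _.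
  have mN : (m <= N)%N := leq_ord m.
  by rewrite subSn// exprS; move: (t ^+ (N - m)) => e; ring.
rewrite big_ord_recl /= mulr0 mul0r add0r mulr_sumr.
by apply: eq_bigr => m _; rewrite /= /bump add1n subSS -mulrA.
Qed.

Lemma size_prod_linear (I : Type) (s : seq I) (a b : I -> C) :
  (size (\prod_(l <- s) ((a l)%:P + b l *: 'X))%R <= (size s).+1)%N.
Proof.
elim: s => [|l s IH]; first by rewrite big_nil size_poly1.
rewrite big_cons mulrC; apply: leq_trans (size_mul_leq _ _) _.
have S : (size ((a l)%:P + b l *: 'X)%R <= 2)%N.
  apply: leq_trans (size_polyD _ _) _; rewrite geq_max.
  rewrite (leq_trans (size_polyC_leq1 _))//=.
  by apply: leq_trans (size_scale_leq _ _) _; rewrite size_polyX.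
rewrite -subn1 leq_subLR add1n; apply: leq_trans (leq_add IH S) _.
by rewrite addn2.
Qed.

Lemma homog_prod_linear (I : Type) (s : seq I) (a b : I -> C) t :
  homog (size s) (\prod_(l <- s) ((a l)%:P + b l *: 'X)) t =
  \prod_(l <- s) (a l * t + b l).
Proof.
elim: s => [|l s IH].
  by rewrite !big_nil /homog big_ord_recl big_ord0 coefC /= expr0 mulr1 addr0.
rewrite !big_cons mulrC homog_mul_linear ?IH//.
exact: size_prod_linear.
Qed.

Lemma size_filter_neq n (k : 'I_n) : size [seq l <- index_enum 'I_n | l != k] = n.-1.
Proof. by rewrite -sum1_size big_filter sum1_card cardC1 card_ord. Qed.

Variables (n : nat) (z : 'I_n -> C).
Hypothesis z_inj : injective z.

Lemma vandermonde_prod_neq0 k : \prod_(l | l != k) (z k - z l) != 0.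
Proof.
by apply/prodf_neq0 => l lk; rewrite subr_eq0; apply: contraNneq lk => /z_inj ->.
Qed.

Lemma lagrange_interpolation p : (size p <= n)%N ->
  p = \sum_k (p.[z k] / \prod_(l | l != k) (z k - z l)) *:
        \prod_(l | l != k) ((- z l)%:P + 1 *: 'X).
Proof.
move=> sp; apply/eqP; rewrite -subr_eq0; apply/eqP.
apply: (@roots_geq_poly_eq0 _ _ [seq z k | k : 'I_n]).
- apply/allP => _ /mapP[k _ ->]; rewrite rootE hornerD hornerN horner_sum.
  rewrite [\sum_(i < n) _](bigD1 k)//= [X in _ - (_ + X)]big1 => [|j jk]; last first.
    rewrite hornerZ; apply/eqP; rewrite mulf_eq0; apply/orP; right.
    by rewrite horner_prod prodf_seq_eq0; apply/hasP; exists k;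
      rewrite ?mem_index_enum// eq_sym jk /= !hornerE addNr.
  rewrite hornerZ horner_prod addr0.
  rewrite [X in _ - _ * X](eq_bigr (fun l => z k - z l)); last by move=> l _; rewrite !hornerE addrC.
  by rewrite divfK ?subrr// vandermonde_prod_neq0.
- by rewrite map_inj_uniq ?enum_uniq.
rewrite size_map -cardE card_ord; apply: leq_trans (size_polyD _ _) _.
rewrite geq_max sp size_polyN; apply: leq_trans (size_sum _ _ _) _.
apply/bigmax_leqP => k _; apply: leq_trans (size_scale_leq _ _) _.
rewrite -big_filter; apply: leq_trans (size_prod_linear _ _ _) _.
by rewrite size_filter_neq prednK// (leq_ltn_trans _ (ltn_ord k)).
Qed.

(** The rational identity behind the inversion of the Pick matrix of points of
    the disk: it is the interpolation formula for the product of the 1 - c_l w,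
    l <> i, homogenized and evaluated at t. *)
Lemma lagrange_pick_identity (c : 'I_n -> C) t i :
  \sum_k \prod_(l | l != i) (1 - c l * z k) / \prod_(l | l != k) (z k - z l)
     * \prod_(l | l != k) (1 - t * z l)
  = \prod_(l | l != i) (t - c l).
Proof.
have n0 : (0 < n)%N by exact: leq_ltn_trans (ltn_ord i).
pose p := \prod_(l | l != i) (1%:P + (- c l) *: 'X).
have sp : (size p <= n)%N.
  rewrite /p -big_filter; apply: leq_trans (size_prod_linear _ _ _) _.
  by rewrite size_filter_neq prednK.
have pz k : p.[z k] = \prod_(l | l != i) (1 - c l * z k).
  by rewrite horner_prod; apply: eq_bigr => l _; rewrite !hornerE mulNr.
have hL (a b : 'I_n -> C) k : homog n.-1 (\prod_(l | l != k) ((a l)%:P + b l *: 'X)) t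
    = \prod_(l | l != k) (a l * t + b l).
  rewrite -[in LHS]big_filter -[in RHS]big_filter -(size_filter_neq k).
  exact: homog_prod_linear.
have hsum (I : finType) (F : I -> C) (q : I -> {poly C}) :
    homog n.-1 (\sum_k F k *: q k) t = \sum_k F k * homog n.-1 (q k) t.
  rewrite /homog; under eq_bigr do rewrite coef_sum mulr_suml.
  rewrite exchange_big /=; apply: eq_bigr => k _; rewrite mulr_sumr.
  by apply: eq_bigr => m _; rewrite coefZ mulrA.
have := congr1 (homog n.-1 ^~ t) (lagrange_interpolation sp).
rewrite /= hsum /p hL (eq_bigr (fun l => t - c l)) => [->|l _]; last by rewrite mul1r.
apply: eq_bigr => k _; rewrite pz hL; congr (_ * _).
by apply: eq_bigr => l _; rewrite mulNr addrC mulrC.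
Qed.
End Interpolation.

(** * Kernels of the ball: two rigidity results *)

Section DotSums.
Variables (C : numClosedFieldType) (U : lmodType C) (hd : {dot U for conjC}).

Lemma dot_suml I (r : seq I) (P : pred I) (F : I -> U) v :
  hd (\sum_(i <- r | P i) F i) v = \sum_(i <- r | P i) hd (F i) v.
Proof. exact: (big_morph (hd^~ v) (fun x y => dotDl hd x y v) (dot0l hd v)). Qed.

Lemma dot_sumr I (r : seq I) (P : pred I) (F : I -> U) v :
  hd v (\sum_(i <- r | P i) F i) = \sum_(i <- r | P i) hd v (F i).
Proof. exact: (big_morph (hd v) (fun x y => dotDr hd x y v) (dot0r hd v)). Qed.
End DotSums.

Section BallKernels.
Variables (C : numClosedFieldType) (U : lmodType C) (hd : {dot U for conjC}).
Variables (N m : nat) (k : 'I_N -> U) (y : 'I_N -> 'rV[C]_m).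
Local Notation "''[' u , v ]" := (dotmx (C := C) (n := m) u v) : ring_scope.
Hypothesis k_free : forall a : 'I_N -> C, \sum_i a i *: k i = 0 -> forall i, a i = 0.
Hypothesis y_ball : forall i, '[y i, y i] < 1.
Hypothesis k_gram : forall i j, hd (k i) (k j) = (1 - '[y j, y i])^-1.

Local Notation K i j := ((1 - '[y j, y i])^-1).
Let S (a : 'I_N -> C) := \sum_i a i *: k i.

Lemma dot_comb (a b : 'I_N -> C) :
  hd (S a) (S b) = \sum_i \sum_j a i * (b j)^* * K i j.
Proof.
rewrite dot_suml; apply: eq_bigr => i _; rewrite dotZl dot_sumr mulr_sumr.
by apply: eq_bigr => j _; rewrite dotZr k_gram mulrA.
Qed.

Lemma pick_den_neq0 i j : 1 - '[y j, y i] != 0.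
Proof. exact: ball_den_neq0. Qed.

Lemma pick_neq0 i j : K i j != 0.
Proof. by rewrite invr_eq0 pick_den_neq0. Qed.

Lemma pick_conj i j : (K i j)^* = K j i.
Proof. by rewrite fmorphV rmorphB rmorph1 /= -dotmxC. Qed.

(** The hypothesis says that the Pick matrix K becomes orthogonal after a
    diagonal rescaling. The i-th row w of K D, multiplied entrywise by the
    c-th coordinates of the points, gives vectors u c, and multiplied entrywise
    by the <y_s, y_i> it gives v. The inner products defined by K between these
    vectors follow from the hypothesis, and the sum over c of
    |<u c, v>|^2 - |u c|^2 |v|^2 is 0. So the Cauchy-Schwarz inequality is an
    equality for every c: all the u c are multiples of v, which means that all
    the y_j are multiples of y_i. *)
Lemma line_of_orthogonal_rescaling (d eps : 'I_N -> C) (b i : 'I_N) :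
  (forall l j, \sum_s K l s * d s * K j s = (l == j)%:R * eps l) ->
  (forall l, eps l * (d l)^* = 1) -> y b = 0 -> i != b -> y i != 0 ->
  forall j, '[y i, y i] *: y j = '[y j, y i] *: y i.
Proof.
move=> KdK epsd yb ib yi0 j.
have d0 l : d l != 0.
  by apply: contraTneq isT => dl; have := epsd l; rewrite dl rmorph0 mulr0 => /eqP; rewrite eq_sym oner_eq0.
have Kb s : K b s = 1 by rewrite yb dotmx0r subr0 invr1.
have Kb' s : K s b = 1 by rewrite yb dotmx0l subr0 invr1.
have A_E s t : '[y s, y t] * K t s = K t s - 1.
  have := pick_den_neq0 t s => h; by field.
pose w s := d s * K i s.
pose v s := '[y s, y i] * w s.
have vE s : v s = w s - d s.
  by rewrite /v /w mulrCA A_E mulrBr mulr1.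
have Kw l : \sum_s K l s * w s = (l == i)%:R * eps l.
  by rewrite -KdK; apply: eq_bigr => s _; rewrite mulrA.
have Kv l : \sum_s K l s * v s = (l == i)%:R * eps l - (l == b)%:R * eps l.
  rewrite -Kw -(KdK l b) -sumrB; apply: eq_bigr => s _.
  by rewrite vE Kb mulr1 mulrBr.
(* the inner product defined by K is realized by the kernels, with conjugate
   coefficients *)
pose E (u : 'I_N -> C) := S (fun s => (u s)^*).
have dotE u t : hd (E u) (E t) = \sum_l (u l)^* * \sum_s K l s * t s.
  rewrite dot_comb; apply: eq_bigr => l _; rewrite mulr_sumr.
  by apply: eq_bigr => s _; rewrite conjCK; ring.
have dotEv u : u b = 0 -> hd (E u) (E v) = (u i)^* * eps i.
  move=> ub; rewrite dotE (bigD1 i)//= Kv eqxx (negbTE ib) mul1r mul0r subr0.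
  rewrite big1 ?addr0// => l li; rewrite Kv (negbTE li) mul0r sub0r.
  by have [->|lb] := eqVneq l b; [rewrite ub rmorph0 mul0r|rewrite mul0r oppr0 mulr0].
have vb : v b = 0 by rewrite /v yb dotmx0l mul0r.
set A := '[y i, y i] in |- *; set k0 := K i i.
have A0 : A != 0 by rewrite dotmx_eq0.
have Ac : A^* = A by exact: dot_conj.
have kc : k0^* = k0 by exact: pick_conj.
have k00 : k0 != 0 by exact: pick_neq0.
have di : eps i * (d i)^* = 1 by [].
have hvv : hd (E v) (E v) = A * k0.
  rewrite dotEv// /v /w !rmorphM /= -/A -/k0 Ac kc -[RHS]mulr1 -di; ring.
pose u c s := w s * y s 0 c.
have ub c : u c b = 0 by rewrite /u yb mxE mulr0.
have huu : \sum_c hd (E (u c)) (E (u c)) = k0.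
  have wsum : \sum_s w s = 0.
    rewrite -[LHS](_ : \sum_s K b s * w s = _); last by apply: eq_bigr => s _; rewrite Kb mul1r.
    by rewrite Kw eq_sym (negbTE ib) mul0r.
  under eq_bigr do rewrite dotE.
  rewrite exchange_big /=.
  rewrite (eq_bigr (fun l => (w l)^* * ((l == i)%:R * eps l))) => [|l _].
    rewrite (bigD1 i)//= big1 ?addr0 => [|l /negbTE ->]; last by rewrite mul0r mulr0.
    by rewrite eqxx mul1r /w rmorphM /= -/k0 kc -[RHS]mulr1 -di; ring.
  transitivity ((w l)^* * \sum_s (K l s - 1) * w s).
    rewrite /u mulr_sumr; under eq_bigr do rewrite mulr_sumr.
    rewrite exchange_big /=; apply: eq_bigr => s _.
    rewrite -A_E dotmx_sum !mulr_suml !mulr_sumr; apply: eq_bigr => c _.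
    by rewrite rmorphM /=; ring.
  congr (_ * _); transitivity (\sum_s K l s * w s - \sum_s w s).
    by rewrite -sumrB; apply: eq_bigr => s _; rewrite mulrBl mul1r.
  by rewrite wsum subr0 Kw.
have cs c : `|hd (E (u c)) (E v)| ^+ 2 <= hd (E (u c)) (E (u c)) * (A * k0).
  by rewrite -hvv; exact: cauchy_schwarz.
have hsum : \sum_c (hd (E (u c)) (E (u c)) * (A * k0) - `|hd (E (u c)) (E v)| ^+ 2) = 0.
  rewrite sumrB -mulr_suml huu.
  rewrite (eq_bigr (fun c => k0 ^+ 2 * (y i 0 c * (y i 0 c)^*))) => [|c _].
    by rewrite -mulr_sumr -dotmx_sum -/A; ring.
  rewrite dotEv// normCK /u /w !rmorphM /= !conjCK -/k0 kc.
  have di' : (eps i)^* * d i = 1 by rewrite -(rmorph1 conjC) -di rmorphM /= conjCK.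
  transitivity (eps i * (d i)^* * ((eps i)^* * d i) * (k0 ^+ 2 * (y i 0 c * (y i 0 c)^*))).
    by ring.
  by rewrite di di' !mul1r.
have hc c : A * k0 * u c j = u c i * (eps i)^* * v j.
  have := psumr_eq0P (fun c _ => _) hsum => /(_ (fun c => _)) Z.
  have {Z} : hd (E (u c)) (E (u c)) * (A * k0) - `|hd (E (u c)) (E v)| ^+ 2 = 0.
    by apply: Z => // t; rewrite subr_ge0.
  move=> /eqP; rewrite subr_eq0 -hvv => /eqP/esym/cauchy_schwarz_eq.
  rewrite hvv dotEv// => /eqP; rewrite -subr_eq0 !scaler_sumr -sumrB => /eqP Z.
  have : A * k0 * (u c j)^* - (u c i)^* * eps i * (v j)^* = 0.
    apply: (k_free (a := fun s => A * k0 * (u c s)^* - (u c i)^* * eps i * (v s)^*)).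
    by rewrite -[RHS]Z; apply: eq_bigr => s _; rewrite scalerBl !scalerA.
  move=> /eqP; rewrite subr_eq0 => /eqP/(congr1 conjC).
  by rewrite !rmorphM /= !conjCK Ac kc.
have wj : w j != 0 by rewrite mulf_neq0// pick_neq0.
have di' : d i * (eps i)^* = 1 by rewrite -(rmorph1 conjC) -di rmorphM /= conjCK mulrC.
apply/rowP => c; rewrite !mxE; apply: (mulfI (mulf_neq0 k00 wj)).
have := hc c; rewrite /u /v [w i]/w -/k0 => H.
transitivity (A * k0 * (w j * y j 0 c)); first by ring.
rewrite H; transitivity ((d i * (eps i)^*) * (k0 * y i 0 c * ('[y j, y i] * w j))); first by ring.
by rewrite di'; ring.
Qed.

Lemma ball_inv_line (a : 'rV[C]_m) (c : C) : exists d, ball_inv a (c *: a) = d *: a.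
Proof.
rewrite /ball_inv; set t := '[c *: a, a].
exists ((1 - t)^-1 * (1 - ball_s a * c - t / (1 + ball_s a))).
by apply/rowP => j; rewrite !mxE; ring.
Qed.

Let Q (a : 'I_N -> C) := hd (S a) (S a).

Lemma dotmx_split (e u v : 'rV[C]_m) : '[e, e] = 1 ->
  '[u, v] = '[u, e] * '[v, e]^* + '[u - '[u, e] *: e, v - '[v, e] *: e].
Proof.
by move=> e1; rewrite dotmxBl !dotmxBr !dotmxZl !dotmxZr e1 (dotmxC e v); ring.
Qed.

Local Notation dir i := (unit_dir (y i)).
Let coef i j := '[ball_inv (y i) (y j), dir i].

(** Multiplication of k_j by the conjugate of coef i j is a contraction. With
    Psi j the component of ball_inv (y i) (y j) orthogonal to y i,
    [ball_inv_dot] writes K_jl as coef i l (coef i j)^* K_jl plus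
    <Psi l, Psi j> K_jl plus a matrix of rank one, all positive. In the case of
    equality the second term vanishes, so that Psi is 0 on the support of a. *)
Lemma kernel_contraction (a : 'I_N -> C) i : y i != 0 ->
  Q (fun j => a j * (coef i j)^* ) <= Q a /\
  (Q (fun j => a j * (coef i j)^* ) = Q a ->
   forall j, a j != 0 -> ball_inv (y i) (y j) = coef i j *: dir i).
Proof.
move=> yi0; set b := coef i.
pose Phi j := ball_inv (y i) (y j); pose Psi j := Phi j - b j *: dir i.
have e1 := unit_dir_norm yi0.
have PhiE l j : '[Phi l, Phi j] = b l * (b j)^* + '[Psi l, Psi j].
  exact: dotmx_split.
pose s := ball_s (y i).
have sc : s^* = s by exact: ball_s_conj.
pose r l := s / (1 - '[y l, y i]).
have Kr l j : K j l = (b l * (b j)^* + '[Psi l, Psi j]) * K j l + r l * (r j)^*.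
  have hlj := ball_den_neq0 (y_ball l) (y_ball j).
  have hli := ball_den_neq0 (y_ball l) (y_ball i).
  have hij := ball_den_neq0 (y_ball i) (y_ball j).
  rewrite -PhiE; have := ball_inv_dot (y_ball i) (y_ball l) (y_ball j).
  rewrite -/(Phi l) -/(Phi j) => E; rewrite -[X in X * _](subKr 1) E.
  rewrite /r rmorphM fmorphV rmorphB rmorph1 /= sc -dotmxC ball_s_sqr//.
  by rewrite -/s; field; rewrite hlj hli hij.
have decomp : Q a = Q (fun j => a j * (b j)^*) +
    (\sum_c Q (fun j => a j * (Psi j 0 c)^*) + `|\sum_j a j * (r j)^*| ^+ 2).
  rewrite /Q !dot_comb; under [X in _ = _ + (X + _)]eq_bigr do rewrite dot_comb.
  rewrite normCK rmorph_sum /= mulr_suml [X in _ = _ + (X + _)]exchange_big /=.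
  rewrite -!big_split /=; apply: eq_bigr => j _.
  rewrite mulr_sumr exchange_big /= -!big_split /=; apply: eq_bigr => l _.
  rewrite {1}Kr mulrDr mulrDl mulrDr -addrA; congr (_ + (_ + _)).
  - by rewrite rmorphM /= conjCK; ring.
  - rewrite dotmx_sum mulr_suml mulr_sumr; apply: eq_bigr => c _.
    by rewrite rmorphM /= conjCK; ring.
  by rewrite (rmorphM _ (a l)) /= conjCK; ring.
have Q0 u : 0 <= Q u by exact: dot_ge0.
have R0 : 0 <= \sum_c Q (fun j => a j * (Psi j 0 c)^*) by apply: sumr_ge0.
split; first by rewrite decomp lerDl addr_ge0// exprn_ge0.
rewrite decomp -[LHS]addr0 => /addrI/esym/eqP.
rewrite paddr_eq0// ?exprn_ge0// => /andP[/eqP Z _] j aj.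
suff : Psi j = 0 by move/eqP; rewrite subr_eq0 => /eqP.
apply/rowP => c; rewrite [RHS]mxE.
have /(_ c isT) := psumr_eq0P (fun c _ => Q0 _) Z.
move=> /eqP; rewrite /Q dnorm_eq0 => /eqP/k_free/(_ j)/eqP.
by rewrite mulf_eq0 (negbTE aj) conjC_eq0 /= => /eqP.
Qed.

Lemma kernel_contraction_seq (a : 'I_N -> C) (P : pred 'I_N) s :
  (forall i, P i -> y i != 0) ->
  Q (fun j => a j * \prod_(i <- s | P i) (coef i j)^* ) <= Q a.
Proof.
move=> Py; elim: s a => [|i s IH] a.
  rewrite le_eqVlt; apply/orP; left; apply/eqP; congr (Q _).
  by apply/funext => j; rewrite big_nil mulr1.
have [Pi|Pi] := boolP (P i); last first.
  by under [X in Q X]funext do rewrite big_cons (negbTE Pi).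
apply: le_trans (kernel_contraction a (Py i Pi)).1.
apply: le_trans (IH _); rewrite le_eqVlt; apply/orP; left; apply/eqP; congr (Q _).
by apply/funext => j; rewrite big_cons Pi mulrA.
Qed.

(** The product of the contractions attached to the points other than the base
    point kills every kernel but k_o. If it attains its norm on the dual vector
    of k_o, so does each factor, and the equality case of the contraction
    applies to all the coefficients of the dual vector; none of them vanishes
    since otherwise a shorter product would already do. *)
Lemma line_of_extremal_dual (o : 'I_N) (kappa : 'I_N -> C) :
  y o = 0 -> (forall i, i != o -> y i != 0) ->
  (forall j, hd (k j) (S kappa) = (j == o)%:R) ->
  hd (S kappa) (S kappa) * \prod_(i | i != o) '[y i, y i] = 1 ->
  forall i j, i != o -> exists c, y j = c *: y i.
Proof.
move=> yo yn0 dual ext.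
have Qk : Q kappa = kappa o.
  rewrite /Q {1}/S dot_suml (bigD1 o)//= big1 => [|j /negbTE jo].
    by rewrite dotZl dual eqxx mulr1 addr0.
  by rewrite dotZl dual jo mulr0.
have ko0 : 0 < kappa o.
  rewrite -Qk lt_def dot_ge0 andbT; apply: contraTneq isT => Z.
  by move: ext; rewrite -/(Q kappa) Z mul0r => /eqP; rewrite eq_sym oner_eq0.
have koc : (kappa o)^* = kappa o by rewrite conj_Creal// gtr0_real.
have coef_o i : (coef i o)^* * coef i o = '[y i, y i].
  have [yi0|yi0] := eqVneq (y i) 0.
    by rewrite /coef yi0 /unit_dir scaler0 !dotmx0r mulr0.
  have n0 : 0 < sqrtC '[y i, y i] by rewrite sqrtC_gt0 dotmx_gt0.
  have -> : coef i o = sqrtC '[y i, y i] by rewrite /coef yo ball_inv_zero dot_unit_dir.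
  by rewrite conj_Creal ?gtr0_real// -expr2 sqrtCK.
have coef_i i : coef i i = 0 by rewrite /coef ball_inv_center// dotmx0l.
have Qo (P : pred 'I_N) : (forall j, j != o -> kappa j * \prod_(i | P i) (coef i j)^* = 0) ->
    Q (fun j => kappa j * \prod_(i | P i) (coef i j)^* ) =
    kappa o ^+ 2 * \prod_(i | P i) '[y i, y i].
  move=> H; rewrite /Q dot_comb (bigD1 o)//= [X in _ + X]big1 ?addr0 => [|j jo]; last first.
    by rewrite big1// => l _; rewrite (H _ jo) !mul0r.
  rewrite (bigD1 o)//= [X in _ + X]big1 ?addr0 => [|j jo]; last first.
    by rewrite (H _ jo) conjC0 mulr0 mul0r.
  rewrite yo dotmx0l subr0 invr1 mulr1 rmorphM rmorph_prod /= koc.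
  have -> : \prod_(i | P i) ((coef i o)^* )^* = \prod_(i | P i) coef i o.
    by apply: eq_bigr => i _; rewrite conjCK.
  have -> : \prod_(i | P i) '[y i, y i] =
      (\prod_(i | P i) (coef i o)^* ) * \prod_(i | P i) coef i o.
    by rewrite -big_split; apply: eq_bigr => i _; rewrite -coef_o.
  by ring.
rewrite -/(Q kappa) Qk in ext.
have kn0 p : kappa p != 0.
  have [->|po] := eqVneq p o; first by rewrite gt_eqF.
  apply/eqP => kp; pose P := [pred i | (i != o) && (i != p)].
  have := @kernel_contraction_seq kappa P (index_enum 'I_N) (fun i => _).
  rewrite Qo => [H|j jo]; last first.
    have [->|jp] := eqVneq j p; first by rewrite kp mul0r.
    by rewrite (bigD1 j) /= ?jo ?jp// coef_i conjC0 mul0r mulr0.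
  have {H} : kappa o ^+ 2 * \prod_(i | P i) '[y i, y i] <= kappa o.
    by rewrite -[leRHS]Qk; apply: H => i /andP[io _]; exact: yn0.
  rewrite expr2 -mulrA -[leRHS]mulr1 ler_pM2l// => H.
  move: ext; rewrite (bigD1 p)//= mulrCA => ext.
  have : 1 <= '[y p, y p].
    by rewrite -ext ler_piMr// dotmx_ge0.
  by move=> /(lt_le_trans (y_ball p)); rewrite ltxx.
move=> i j io.
have [le_i eq_i] := kernel_contraction kappa (yn0 i io).
have E : Q (fun j => kappa j * (coef i j)^* ) = Q kappa.
  apply/eqP; rewrite eq_le le_i /=.
  pose P := [pred l | (l != o) && (l != i)].
  have := @kernel_contraction_seq (fun j => kappa j * (coef i j)^* ) P (index_enum 'I_N) (fun l => _).
  move=> H; apply: le_trans (H _); last by move=> l /andP[lo _]; exact: yn0.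
  have -> : (fun j => kappa j * (coef i j)^* * \prod_(i <- index_enum 'I_N | P i) (coef i j)^* )
     = fun j => kappa j * \prod_(i | i != o) (coef i j)^*.
    by apply/funext => t; rewrite [in RHS](bigD1 i)//= mulrA.
  rewrite Qo => [|t ti]; last by rewrite (bigD1 t)//= coef_i conjC0 mul0r mulr0.
  by rewrite Qk expr2 -mulrA ext mulr1.
have := eq_i E j (kn0 j); rewrite /unit_dir scalerA => /(congr1 (ball_inv (y i))).
rewrite ball_invK// => ->; exact: ball_inv_line.
Qed.
End BallKernels.

(** * Gram matrices and dual bases *)

Section GramMatrices.
Variables (C : numClosedFieldType) (U : vectType C) (hd : {dot U for conjC}).
Variables (n : nat) (k : 'I_n -> U).
Hypothesis k_basis : basis_of fullv [tuple k i | i < n].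

Lemma basis_coef0 (a : 'I_n -> C) : \sum_i a i *: k i = 0 -> forall i, a i = 0.
Proof.
move=> a0; move/freeP: (basis_free k_basis); apply.
by rewrite -[RHS]a0; apply: eq_bigr => i _; rewrite (nth_map i) ?size_enum_ord// nth_ord_enum.
Qed.

Lemma basis_span u : exists a : 'I_n -> C, u = \sum_i a i *: k i.
Proof.
exists (fun i => coord [tuple k i | i < n] i u).
rewrite {1}(coord_basis k_basis (memvf u)); apply: eq_bigr => i _.
by rewrite (nth_map i) ?size_enum_ord// nth_ord_enum.
Qed.

Lemma free_basis (v : 'I_n -> U) :
  (forall a : 'I_n -> C, \sum_i a i *: v i = 0 -> forall i, a i = 0) ->
  basis_of fullv [tuple v i | i < n].
Proof.
move=> vfree; rewrite basisEfree; apply/and3P; split; last first.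
- by rewrite size_tuple (size_basis k_basis).
- exact: subvf.
apply/freeP => a a0; apply: vfree; rewrite -[RHS]a0; apply: eq_bigr => i _.
by rewrite (nth_map i) ?size_enum_ord// nth_ord_enum.
Qed.

Lemma rescaled_basis (c : 'I_n -> C) : (forall i, c i != 0) ->
  basis_of fullv [tuple c i *: k i | i < n].
Proof.
move=> c0; apply: free_basis => a a0 i.
have /basis_coef0/(_ i)/eqP : \sum_i (a i * c i) *: k i = 0.
  by rewrite -[RHS]a0; apply: eq_bigr => j _; rewrite scalerA.
by rewrite mulf_eq0 (negbTE (c0 i)) orbF => /eqP.
Qed.

Lemma eval_inj u v : (forall i, hd u (k i) = hd v (k i)) -> u = v.
Proof.
move=> uv; apply/eqP; rewrite -subr_eq0 -(dnorm_eq0 hd); apply/eqP.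
have [a E] := basis_span (u - v); rewrite {2}E dot_sumr big1// => i _.
by rewrite dotZr dotBl uv subrr mulr0.
Qed.

Let G : 'M[C]_n := \matrix_(i, j) hd (k i) (k j).

Lemma gram_unit : G \in unitmx.
Proof.
rewrite -row_free_unit; apply: inj_row_free => v vG.
have v0 : \sum_i v 0 i *: k i = 0.
  apply: eval_inj => j; rewrite dot_suml dot0l; have /rowP/(_ j) := vG.
  rewrite !mxE => E; rewrite -[RHS]E; apply: eq_bigr => i _; by rewrite dotZl !mxE.
by apply/rowP => i; rewrite mxE; exact: basis_coef0 v0 i.
Qed.

Lemma dual_basis_exists : exists d : 'I_n -> U, forall i j, hd (k i) (d j) = (i == j)%:R.
Proof.
exists (fun j => \sum_s (invmx G s j)^* *: k s) => i j.
rewrite dot_sumr; have := mulmxV gram_unit => /matrixP/(_ i j); rewrite !mxE => <-.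
by apply: eq_bigr => s _; rewrite dotZr conjCK mxE mulrC.
Qed.

Lemma kern_dual_expand (d : 'I_n -> U) u : (forall i j, hd (k i) (d j) = (i == j)%:R) ->
  u = \sum_i hd u (d i) *: k i.
Proof.
move=> dual; have [a E] := basis_span u; rewrite {1}E; apply: eq_bigr => s _.
congr (_ *: _); rewrite E dot_suml (bigD1 s)//= big1 => [|r /negbTE rs].
  by rewrite dotZl dual eqxx mulr1 addr0.
by rewrite dotZl dual rs mulr0.
Qed.

Lemma dual_gram (d : 'I_n -> U) : (forall i j, hd (k i) (d j) = (i == j)%:R) ->
  invmx G = \matrix_(i, j) hd (d i) (d j).
Proof.
move=> dual; set D := \matrix_(i, j) _.
have DG : D *m G = 1%:M.
  apply/matrixP => i j; rewrite !mxE.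
  transitivity (hd (d i) (k j)).
    rewrite [d i in RHS](kern_dual_expand _ dual) dot_suml; apply: eq_bigr => s _; by rewrite !mxE dotZl.
  by rewrite dotC dual eq_sym; case: eqP; rewrite ?rmorph1 ?rmorph0.
by rewrite -[LHS]mul1mx -DG mulmxK ?gram_unit.
Qed.
End GramMatrices.

(** * Multipliers supported at one point *)

Section DotNorm.
Variables (R : realType) (V : lmodType R[i]) (hd : {dot V for conjC}).
Local Notation rc := (real_complex R).
Local Notation N := (dot_norm hd).
Implicit Types (u v : V) (c : R[i]).

Lemma Re_norm c : rc (complex.Re `|c|) = `|c|.
Proof. by apply: RRe_real; exact: normr_real. Qed.

Lemma Re_norm_ge0 c : 0 <= complex.Re `|c|.
Proof. by rewrite -ler0c Re_norm. Qed.

Lemma dot_norm_ge0 u : 0 <= N u. Proof. exact: sqrtr_ge0. Qed.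

Lemma dot_norm_sqr u : rc (N u ^+ 2) = hd u u.
Proof.
have h : 0 <= hd u u := dot_ge0 hd u.
have hr : rc (complex.Re (hd u u)) = hd u u by apply: RRe_real; exact: ger0_real.
by rewrite /dot_norm sqr_sqrtr// -ler0c hr.
Qed.

Lemma dot_norm_gt0 u : u != 0 -> 0 < N u.
Proof.
move=> u0; rewrite lt_def dot_norm_ge0 andbT; apply: contra_neq u0 => E.
by apply/eqP; rewrite -(dnorm_eq0 hd) -dot_norm_sqr E expr0n.
Qed.

Lemma dot_normZ c u : N (c *: u) = complex.Re `|c| * N u.
Proof.
apply/eqP; rewrite -(@eqrXn2 _ 2) ?mulr_ge0 ?dot_norm_ge0 ?Re_norm_ge0//.
apply/eqP/(@complexI R); rewrite dot_norm_sqr exprMn rmorphM rmorphXn /= Re_norm.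
by rewrite dot_norm_sqr dotZl dotZr mulrA -normCK.
Qed.

Lemma dot_norm_cauchy_schwarz u v : complex.Re `|hd u v| <= N u * N v.
Proof.
rewrite -(@ler_pXn2r _ 2) ?nnegrE ?mulr_ge0 ?dot_norm_ge0 ?Re_norm_ge0//.
rewrite -lecR exprMn rmorphXn /= Re_norm rmorphM /= !dot_norm_sqr.
exact: cauchy_schwarz.
Qed.
End DotNorm.

Section PointMultipliers.
Variables (R : realType) (n : nat) (H : fdRKHS R n.+1) (d : 'I_n.+1 -> H).
Local Notation rc := (real_complex R).
Local Notation hd := (hdot H).
Local Notation N := (dot_norm (hdot H)).
Hypothesis d_dual : dual_basis d.
Implicit Types m : 'I_n.+1 -> R[i].

Lemma kern_neq0 i : kern H i != 0.
Proof.
apply/eqP => k0; have := d_dual i i; rewrite k0 dot0l eqxx => /eqP.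
by rewrite eq_sym oner_eq0.
Qed.

Lemma dual_neq0 i : d i != 0.
Proof.
apply/eqP => k0; have := d_dual i i; rewrite k0 dot0r eqxx => /eqP.
by rewrite eq_sym oner_eq0.
Qed.

Lemma mult_op_point m (h : H) : (forall j, j != ord0 -> m j = 0) ->
  mult_op m h = (m ord0 * heval h ord0) *: d ord0.
Proof.
move=> m0; set g := _ *: _.
have gP i : heval g i = m i * heval h i.
  rewrite /heval /g dotZl dotC d_dual.
  have [->|i0] := eqVneq i ord0; first by rewrite conjC1 mulr1.
  by rewrite conjC0 mulr0 m0// mul0r.
apply: (eval_inj (hd := hdot H) (kern_basis H)) => i.
have := xgetPex (0 : H) (P := [set g : H | forall i, heval g i = m i * heval h i])
  (ex_intro _ g gP).
by move=> E; exact: (etrans (E i) (esym (gP i))).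
Qed.

(** A multiplier supported at one point is the rank one operator
    h |-> m_0 <h, k_0> d_0. *)
Lemma mult_norm_point m : (forall j, j != ord0 -> m j = 0) ->
  mult_norm H m = complex.Re `|m ord0| * (N (kern H ord0) * N (d ord0)).
Proof.
move=> m0; rewrite /mult_norm; set A := image _ _; set M := RHS.
have k0 := dot_norm_gt0 (hdot H) (kern_neq0 ord0).
have ubA x : A x -> x <= M.
  move=> [h /= h1 <-]; rewrite mult_op_point// dot_normZ normrM.
  rewrite -(Re_norm (m ord0)) -(Re_norm (heval h ord0)) -rmorphM /= /M mulrA.
  apply: ler_wpM2r; first exact: dot_norm_ge0.
  apply: ler_wpM2l; first exact: Re_norm_ge0.
  apply: le_trans (dot_norm_cauchy_schwarz _ _ _) _.
  by rewrite ler_piMl// ltW.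
have MA : A M.
  exists (rc (N (kern H ord0))^-1 *: kern H ord0).
    rewrite /= dot_normZ ger0_norm ?ler0c ?invr_ge0 ?(ltW k0)//= mulVf ?lexx//.
    by rewrite gt_eqF.
  rewrite mult_op_point// dot_normZ /heval dotZl -dot_norm_sqr -rmorphM normrM.
  rewrite expr2 mulrA mulVf ?gt_eqF// mul1r -(Re_norm (m ord0)).
  rewrite [ `|rc _|]ger0_norm ?ler0c ?(ltW k0)// -rmorphM /=.
  by rewrite /M mulrA.
apply/eqP; rewrite eq_le; apply/andP; split.
  by apply: ge_sup; [exists M|exact: ubA].
by apply: ub_le_sup => //; exists M.
Qed.

Let e : R := (N (kern H ord0) * N (d ord0))^-1.

Lemma extremal_value_gt0 : 0 < e.
Proof.
by rewrite invr_gt0 mulr_gt0// dot_norm_gt0 ?kern_neq0 ?dual_neq0.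
Qed.

Lemma admissible_point m : admissible_multiplier H m <->
  (forall j, j != ord0 -> m j = 0) /\ complex.Re `|m ord0| = e.
Proof.
have e0 := extremal_value_gt0.
have q0 : N (kern H ord0) * N (d ord0) != 0 by rewrite -invr_eq0 gt_eqF.
split=> [[m1 m0]|[m0 m1]].
  split=> //; rewrite mult_norm_point// in m1.
  by apply: (mulIf q0); rewrite m1 /e mulVf.
by split=> //; rewrite mult_norm_point// m1 /e mulVf.
Qed.

Lemma admissible_extremal :
  admissible_multiplier H (fun j => if j == ord0 then rc e else 0).
Proof.
have e0 := extremal_value_gt0.
apply/admissible_point; split=> [j /negbTE ->//|].
by rewrite eqxx ger0_norm// ler0c ltW.
Qed.

(** Admissibility prescribes the modulus of the value at the base point, so that
    the maximal real part is reached only by a positive value. *)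
Lemma extremal_multiplierP m : extremal_multiplier H m <->
  (forall j, j != ord0 -> m j = 0) /\ m ord0 = rc e.
Proof.
have e0 := extremal_value_gt0; split=> [[/admissible_point[m0 me] mmax]|[m0 me]].
  have := mmax _ admissible_extremal; rewrite eqxx /= => em; split=> //.
  have nm : `|m ord0| = rc e by rewrite -me Re_norm.
  have := add_Re2_Im2 (m ord0); rewrite nm -(rmorphXn rc) => /(@complexI R).
  case: (m ord0) em => a b /= em E.
  have a0 : 0 <= a := le_trans (ltW e0) em.
  have b0 : b ^+ 2 <= 0.
    by rewrite -(lerD2l (a ^+ 2)) E addr0 ler_pXn2r// nnegrE ?a0// ltW.
  have {b0} b0 : b = 0 by apply/eqP; rewrite -sqrf_eq0 eq_le b0 sqr_ge0.
  have ae : a = e.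
    apply/eqP; rewrite -(@eqrXn2 _ 2) ?a0 ?(ltW e0)//.
    by rewrite -E b0 expr0n addr0.
  by rewrite ae b0.
split=> [|m' /admissible_point[_ me']].
  by apply/admissible_point; split; rewrite // me ger0_norm// ler0c ltW.
rewrite me /= -me'; have := normc_ge_Re (m' ord0).
by rewrite -[leRHS]Re_norm lecR => /(le_trans (ler_norm _)).
Qed.

(** The extremal value is 1 / (|k_0| |d_0|), the distance from the normalized
    kernel at the base point to the span of the other kernels. Squaring removes
    the square roots contained in the metric. *)
Lemma extremal_product_iff :
  (exists2 m1, extremal_multiplier H m1 &
     m1 ord0 = \prod_(j < n.+1 | j != ord0) delta H ord0 j) <->
  hd (kern H ord0) (kern H ord0) * hd (d ord0) (d ord0) *
    \prod_(j < n.+1 | j != ord0)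
      (1 - `|gram H ord0 j| ^+ 2 / (gram H ord0 ord0 * gram H j j)) = 1.
Proof.
have e0 := extremal_value_gt0.
set D := \prod_(j < n.+1 | _) delta H _ _; set P := \prod_(j < n.+1 | _) _.
have arg_ge0 j : 0 <= 1 - `|gram H ord0 j| ^+ 2 / (gram H ord0 ord0 * gram H j j).
  have gt0 i : 0 < gram H i i by rewrite mxE dnorm_gt0 kern_neq0.
  rewrite subr_ge0 ler_pdivrMr ?mulr_gt0// mul1r !mxE; exact: cauchy_schwarz.
have D0 : 0 <= D by apply: prodr_ge0 => j _; rewrite sqrtC_ge0.
have D2 : D ^+ 2 = P.
  by rewrite -prodrXl; apply: eq_bigr => j _; rewrite sqrtCK.
have kd : hd (kern H ord0) (kern H ord0) * hd (d ord0) (d ord0) = rc e ^- 2.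
  by rewrite -!dot_norm_sqr -rmorphM -rmorphXn -fmorphV /e exprVn invrK exprMn.
have re0 : rc e != 0 by rewrite gt_eqF// ltcR.
rewrite kd; split=> [[m1 /extremal_multiplierP[_ ->] E]|E].
  by rewrite -D2 -E mulVf// expf_neq0.
exists (fun j => if j == ord0 then rc e else 0).
  by apply/extremal_multiplierP; split=> [j /negbTE ->|]; rewrite ?eqxx.
rewrite eqxx; apply/eqP; rewrite -(@eqrXn2 _ 2) ?ler0c ?(ltW e0)// D2.
by rewrite -[eqbLHS]mulr1 -E mulVKf// expf_neq0.
Qed.
End PointMultipliers.

(** * Uniqueness of power series *)

Section Tends.
Variable K : numFieldType.
Implicit Types (u v : nat -> K) (l k : K).

Definition tends u l : Prop :=
  forall e, 0 < e -> exists N, forall n, (N <= n)%N -> `|u n - l| <= e.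

Lemma tendsP u l : tends u l <-> u @ \oo --> l.
Proof.
split=> [H|/cvgrPdist_le H e /H[N _ NH]].
  apply/cvgrPdist_le => e /H[N NH]; exists N => // n /= Nn.
  by rewrite distrC; exact: NH.
by exists N => n /NH; rewrite distrC.
Qed.

Lemma tends_unique u l k : tends u l -> tends u k -> l = k.
Proof. by move=> /tendsP ul /tendsP uk; exact: (cvg_unique _ ul uk). Qed.

Lemma tends_cst l : tends (fun=> l) l.
Proof. by apply/tendsP; exact: cvg_cst. Qed.

Lemma tendsD u v l k : tends u l -> tends v k -> tends (fun n => u n + v n) (l + k).
Proof. by move=> /tendsP ul /tendsP vk; apply/tendsP; exact: cvgD. Qed.

Lemma tendsM u v l k : tends u l -> tends v k -> tends (fun n => u n * v n) (l * k).
Proof. by move=> /tendsP ul /tendsP vk; apply/tendsP; exact: cvgM. Qed.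

Lemma tendsZ c u l : tends u l -> tends (fun n => c * u n) (c * l).
Proof. exact: tendsM (tends_cst c). Qed.

Lemma tendsB u v l k : tends u l -> tends v k -> tends (fun n => u n - v n) (l - k).
Proof. by move=> /tendsP ul /tendsP vk; apply/tendsP; exact: cvgB. Qed.

Lemma tends_sum (I : finType) (u : I -> nat -> K) (l : I -> K) :
  (forall i, tends (u i) (l i)) -> tends (fun n => \sum_i u i n) (\sum_i l i).
Proof.
move=> ul; elim: (index_enum I) => [|i s IH].
  rewrite big_nil; have := tends_cst 0; congr tends; apply/funext => n.
  by rewrite big_nil.
have := tendsD (ul i) IH; rewrite big_cons; congr tends; apply/funext => n.
by rewrite big_cons.
Qed.

Lemma tends_ext u v l : u =1 v -> tends u l -> tends v l.
Proof. by move=> /funext ->. Qed.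

Lemma tends_shift u l : tends u l -> tends (fun n => u n.+1) l.
Proof. by move=> ul e /ul[N NH]; exists N => n Nn; apply: NH; exact: leqW. Qed.

Lemma tends_norm_le u l M : tends u l -> (forall n, `|u n| <= M) -> `|l| <= M.
Proof.
move=> ul uM; apply/ler_addgt0Pr => e /ul[N /(_ N (leqnn N)) H].
rewrite -[l](subKr (u N)); apply: le_trans (ler_normB _ _) _.
exact: lerD.
Qed.

Lemma tends_bounded u l : tends u l -> exists2 M, 0 <= M & forall n, `|u n| <= M.
Proof.
move=> /(_ 1 ltr01)[N NH].
exists (\sum_(i < N) `|u i| + (`|l| + 1)).
  by rewrite addr_ge0 ?sumr_ge0// addr_ge0.
move=> n; case: (ltnP n N) => nN.
  rewrite (bigD1 (Ordinal nN))//= -addrA lerDl.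
  by rewrite addr_ge0 ?sumr_ge0 ?addr_ge0.
rewrite -[u n](subrK l) addrC; apply: le_trans (ler_normD _ _) _.
have := NH n nN => H; apply: le_trans (lerD (lexx _) H) _.
by rewrite lerDr sumr_ge0.
Qed.

Lemma geometric_sum_le (x : K) n : 0 <= x -> x < 1 ->
  \sum_(j < n) x ^+ j <= (1 - x)^-1.
Proof.
move=> x0 x1; rewrite -[leRHS]mul1r ler_pdivlMr ?subr_gt0//.
have -> : (\sum_(j < n) x ^+ j) * (1 - x) = 1 - x ^+ n.
  elim: n => [|n IH]; first by rewrite big_ord0 mul0r expr0 subrr.
  by rewrite big_ord_recr /= mulrDl IH exprS; ring.
by rewrite lerBlDr lerDl exprn_ge0.
Qed.

Definition psum (a : nat -> K) (w : K) n : K := \sum_(k < n) a k * w ^+ k.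
Definition shift_coef (b : nat -> K) n : K := if n is n'.+1 then b n' else 0.

Lemma psumS (b : nat -> K) (w : K) n : psum b w n.+1 = psum b w n + b n * w ^+ n.
Proof. exact: big_ord_recr. Qed.

(** Multiplication by al + be w acts on coefficients by al + be * shift, up to
    a last term which tends to 0 for convergent series. *)
Lemma psum_mul_linear (b : nat -> K) (al be w : K) n :
  (al + be * w) * psum b w n =
  psum (fun i => al * b i + be * shift_coef b i) w n + be * (shift_coef b n * w ^+ n).
Proof.
elim: n => [|n IH]; first by rewrite /psum !big_ord0 /=; ring.
rewrite !psumS mulrDr IH /= exprS; ring.
Qed.

(** Convergence at w = 1/2 bounds the terms there, which makes the terms of
    positive degree small near 0. *)
Lemma psum_zero_coef0 (c : nat -> K) :
  (forall w, w != 0 -> `|w| < 1 -> tends (psum c w) 0) -> c 0%N = 0.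
Proof.
move=> c0; have h0 : (2^-1 : K) != 0 by rewrite invr_eq0 pnatr_eq0.
have n2 : `|2^-1 : K| = 2^-1 by rewrite ger0_norm ?invr_ge0.
have h1 : `|2^-1 : K| < 1 by rewrite n2 invf_lt1// ltr1n.
have [B B0 BH] : exists2 B, 0 <= B & forall n, `|c n * 2^-1 ^+ n| <= B.
  have := tendsB (tends_shift (c0 _ h0 h1)) (c0 _ h0 h1); rewrite subrr => T.
  have [B B0 BH] := tends_bounded T; exists B => // n.
  by have := BH n; rewrite /psum big_ord_recr /= addrAC subrr add0r.
apply/eqP; rewrite -normr_eq0 eq_le normr_ge0 andbT.
apply/ler_addgt0Pr => e e0; rewrite add0r.
have D0 : 0 < 4 * B + 1 by rewrite ltr_wpDl// mulr_ge0.
have e'0 : 0 < e / (4 * B + 1) by rewrite divr_gt0.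
have q0 : 0 < (4^-1 : K) by rewrite invr_gt0.
have [t t0 [te t4]] := pos_lower_bound e'0 q0.
have t1 : t < 1 by apply: le_lt_trans t4 _; rewrite invf_lt1// ltr1n.
have t2 : 2 * t <= 2^-1.
  apply: le_trans (ler_wpM2l _ t4) _ => //.
  by rewrite le_eqVlt; apply/orP; left; apply/eqP; field.
have tn0 : t != 0 by rewrite gt_eqF.
have tl : `|t| < 1 by rewrite gtr0_norm.
have B' : forall n, `|c 0%N - psum c t n.+1| <= 4 * B * t.
  move=> n; rewrite /psum big_ord_recl expr0 mulr1 opprD addrA subrr add0r normrN.
  apply: le_trans (ler_norm_sum _ _ _) _.
  apply: (@le_trans _ _ (\sum_(i < n) (2 * B * t) * (2 * t) ^+ i)).
    apply: ler_sum => i _; rewrite normrM normrX (gtr0_norm t0) /= /bump add1n.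
    have := BH i.+1; rewrite normrM normrX n2 => H.
    rewrite (_ : 2 * B * t * (2 * t) ^+ i = B * (2 * t) ^+ i.+1); last by rewrite exprS; ring.
    have -> : `|c i.+1| * t ^+ i.+1 = `|c i.+1| * 2^-1 ^+ i.+1 * (2 * t) ^+ i.+1.
      by rewrite -mulrA -exprMn mulKf// pnatr_eq0.
    by apply: ler_wpM2r => //; rewrite exprn_ge0// mulr_ge0// ltW.
  rewrite -mulr_sumr; have t2' : 2 * t < 1.
    by apply: le_lt_trans t2 _; rewrite invf_lt1// ltr1n.
  have t20 : 0 <= 2 * t by rewrite mulr_ge0// ltW.
  have G : \sum_(i < n) (2 * t) ^+ i <= 2.
    apply: le_trans (geometric_sum_le _ t20 t2') _.
    rewrite -[leRHS]invrK lef_pV2 ?posrE ?subr_gt0 ?invr_gt0//.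
    rewrite lerBrDr; apply: le_trans (lerD (lexx _) t2) _.
    by rewrite (_ : 2^-1 + 2^-1 = 1)//; field.
  apply: le_trans (ler_wpM2l _ G) _; first by rewrite !mulr_ge0// ltW.
  by rewrite le_eqVlt; apply/orP; left; apply/eqP; ring.
have T := tendsB (tends_cst (c 0%N)) (tends_shift (c0 t tn0 tl)).
have := tends_norm_le T B'; rewrite subr0 => /le_trans; apply.
apply: (@le_trans _ _ ((4 * B + 1) * t)).
  by apply: ler_wpM2r; [exact: ltW|rewrite lerDl].
by rewrite mulrC -ler_pdivlMr.
Qed.

(** The coefficients agree one after the other: the difference of the series,
    divided by a power of w, has sum 0 for w != 0, so its first coefficient
    is 0. *)
Lemma psum_unique (a b : nat -> K) :
  (forall w, `|w| < 1 -> exists l, tends (psum a w) l /\ tends (psum b w) l) -> a = b.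
Proof.
move=> ab; pose c (k m : nat) := a (k + m)%N - b (k + m)%N.
suff H (k : nat) : (forall w, w != 0 -> `|w| < 1 -> tends (psum (c k) w) 0) /\
    forall j, (j < k)%N -> a j = b j.
  by apply/funext => k; exact: (H k.+1).2.
elim: k => [|k [IH1 IH2]].
  split=> // w _ w1; have [l [al bl]] := ab w w1.
  have := tendsB al bl; rewrite subrr.
  apply: tends_ext => n; rewrite /psum -sumrB; apply: eq_bigr => j _.
  by rewrite /c add0n mulrBl.
have ck : c k 0%N = 0 := psum_zero_coef0 IH1.
split=> [w w0 w1|j]; last first.
  rewrite ltnS leq_eqVlt => /predU1P[->|]; last exact: IH2.
  by apply/eqP; rewrite -subr_eq0; move: ck; rewrite /c addn0 => ->.
have := tendsZ w^-1 (tends_shift (IH1 w w0 w1)); rewrite mulr0.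
apply: tends_ext => n; rewrite /psum big_ord_recl ck mul0r add0r mulr_sumr.
apply: eq_bigr => j _; rewrite /c /= /bump add1n addnS addSn exprS mulrCA.
by rewrite mulKf.
Qed.
End Tends.

(** * Square summable sequences *)

Lemma series_ord (V : zmodType) (v : nat -> V) n : series v n = \sum_(k < n) v k.
Proof. by rewrite /series /= big_mkord. Qed.

Section SquareSummable.
Variable R : realType.
Local Notation C := R[i].
Local Notation rc := (real_complex R).
Local Notation nrm x := (complex.Re `|x|).
Implicit Types (a b u : nat -> C) (x y z l : C) (M : R).

Lemma nrmM x y : nrm (x * y) = nrm x * nrm y.
Proof. by apply/(@complexI R); rewrite rmorphM /= !Re_norm normrM. Qed.

Lemma nrmD x y : nrm (x + y) <= nrm x + nrm y.
Proof. by rewrite -lecR rmorphD /= !Re_norm ler_normD. Qed.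

Lemma nrmX x n : nrm (x ^+ n) = nrm x ^+ n.
Proof. by apply/(@complexI R); rewrite rmorphXn /= !Re_norm normrX. Qed.

Lemma nrm0 : nrm (0 : C) = 0.
Proof. by apply/(@complexI R); rewrite Re_norm normr0. Qed.

Lemma nrm_lt1 x : `|x| < 1 -> nrm x < 1.
Proof. by rewrite -Re_norm -(rmorph1 rc) ltcR. Qed.

Lemma summable_tends_real (v : nat -> R) M :
  (forall n, \sum_(k < n) `|v k| <= M) -> exists l : R, tends (fun n => \sum_(k < n) v k) l.
Proof.
move=> vM.
have /normed_cvg : cvgn [normed series v].
  apply: nondecreasing_is_cvgn.
    by apply: nondecreasing_series => n _ _; exact: normr_ge0.
  by exists M => _ [n _ <-]; have := vM n; rewrite -(series_ord (fun k => `|v k|)).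
move=> /cvg_ex[l vl]; exists l; apply/tendsP; move: vl.
by rewrite (_ : series v = fun n => \sum_(k < n) v k)//; apply/funext => n; rewrite series_ord.
Qed.

Lemma summable_tends u M : (forall n, \sum_(k < n) nrm (u k) <= M) ->
  exists l, tends (fun n => \sum_(k < n) u k) l.
Proof.
move=> uM.
have reM n : \sum_(k < n) `|complex.Re (u k)| <= M.
  apply: le_trans (uM n); apply: ler_sum => k _.
  by have := normc_ge_Re (u k); rewrite -Re_norm lecR.
have imM n : \sum_(k < n) `|complex.Im (u k)| <= M.
  apply: le_trans (uM n); apply: ler_sum => k _.
  by have := normc_ge_Re (u k * 'i%C); rewrite -Re_norm lecR nrmM ReiNIm normrN normc_def /=
    expr0n expr1n add0r sqrtr1 mulr1.
have [lr Lr] := @summable_tends_real (fun k => complex.Re (u k)) M reM.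
have [li Li] := @summable_tends_real (fun k => complex.Im (u k)) M imM.
exists (Complex lr li) => e e0.
have er : e = rc (complex.Re e) by apply/esym/RRe_real; rewrite ger0_real// ltW.
have e1 : 0 < complex.Re e / 2 by rewrite divr_gt0// -ltcR -er.
have [N1 H1] := Lr _ e1; have [N2 H2] := Li _ e1.
exists (maxn N1 N2) => n; rewrite geq_max => /andP[/H1 h1 /H2 h2].
have E (v : nat -> C) : \sum_(k < n) v k =
    Complex (\sum_(k < n) complex.Re (v k)) (\sum_(k < n) complex.Im (v k)).
  elim: n {h1 h2} => [|n IH]; first by rewrite !big_ord0.
  rewrite !big_ord_recr /= IH; by case: (v n).
rewrite E -Re_norm er lecR.
rewrite (_ : Complex _ _ - _ = rc (\sum_(k < n) complex.Re (u k) - lr) +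
   'i%C * rc (\sum_(k < n) complex.Im (u k) - li)); last first.
  by apply/eqP; rewrite eq_complex /= !mul0r !mul1r !subr0 !add0r !addr0 !eqxx.
apply: le_trans (nrmD _ _) _; rewrite nrmM (splitr (complex.Re e)).
apply: lerD; rewrite !normc_def /= ?expr0n ?expr1n ?add0r ?addr0 ?sqrtr1 ?mul1r sqrtr_sqr//.
Qed.

Definition l2 a := exists M, forall n, \sum_(k < n) nrm (a k) ^+ 2 <= M.

Lemma l2P a : square_summable a <-> l2 a.
Proof.
rewrite /square_summable; set v := (fun k => nrm (a k) ^+ 2).
have sE n := series_ord v n.
split=> [|[M aM]].
  move=> /cvg_has_ub[M ub]; exists M => n; rewrite -sE.
  by apply: le_trans (ler_norm _) _; apply: ub; exists n.
apply: nondecreasing_is_cvgn.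
  by apply: nondecreasing_series => n _ _; exact: sqr_ge0.
by exists M => _ [n _ <-]; rewrite sE.
Qed.

Lemma l2_bounded a : l2 a -> exists B : C, forall n, `|a n| <= B.
Proof.
move=> [M aM]; have M0 : 0 <= M by have := aM 0%N; rewrite big_ord0.
exists (rc (M + 1)) => n; rewrite -Re_norm lecR.
have : nrm (a n) ^+ 2 <= M.
  apply: le_trans (aM n.+1); rewrite big_ord_recr /= lerDr.
  by apply: sumr_ge0 => k _; exact: sqr_ge0.
move=> H; rewrite -(@ler_pXn2r _ 2) ?nnegrE ?Re_norm_ge0 ?addr_ge0//.
by apply: le_trans H _; have : 0 <= M ^+ 2 := sqr_ge0 M; rewrite sqrrD1; lra.
Qed.

Lemma l2_prod a b : l2 a -> l2 b ->
  exists M, forall n, \sum_(k < n) nrm (a k * b k) <= M.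
Proof.
move=> [A aA] [B bB]; exists (A + B) => n; apply: le_trans (lerD (aA n) (bB n)).
rewrite -big_split; apply: ler_sum => k _; rewrite nrmM.
have key (x y : R) : 0 <= x -> 0 <= y -> x * y <= x ^+ 2 + y ^+ 2 by nra.
by apply: key; exact: Re_norm_ge0.
Qed.

Lemma l2Z (c : C) a : l2 a -> l2 (fun k => c * a k).
Proof.
move=> [A aA]; exists (nrm c ^+ 2 * A) => n.
apply: le_trans (ler_wpM2l (sqr_ge0 _) (aA n)); rewrite mulr_sumr.
by apply: ler_sum => k _; rewrite nrmM exprMn.
Qed.

Lemma l2D a b : l2 a -> l2 b -> l2 (fun k => a k + b k).
Proof.
move=> [A aA] [B bB]; exists (2 * A + 2 * B) => n.
apply: le_trans (lerD (ler_wpM2l _ (aA n)) (ler_wpM2l _ (bB n))) => //.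
rewrite !mulr_sumr -big_split; apply: ler_sum => k _.
apply: (@le_trans _ _ ((nrm (a k) + nrm (b k)) ^+ 2)).
  by rewrite ler_pXn2r ?nnegrE ?addr_ge0 ?Re_norm_ge0// nrmD.
have key (x y : R) : (x + y) ^+ 2 <= 2 * x ^+ 2 + 2 * y ^+ 2.
  by rewrite -subr_ge0 (_ : _ - _ = (x - y) ^+ 2) ?sqr_ge0//; ring.
exact: key.
Qed.

Lemma l2_sum (I : finType) (F : I -> nat -> C) :
  (forall i, l2 (F i)) -> l2 (fun k => \sum_i F i k).
Proof.
move=> lF; elim: (index_enum I) => [|i s IH].
  exists 0 => n; rewrite big1// => k _; by rewrite big_nil nrm0 expr2 mul0r.
have := l2D (lF i) IH; congr l2; apply/funext => k; by rewrite big_cons.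
Qed.

Lemma sum_shift_sqr a n :
  \sum_(k < n.+1) nrm (shift_coef a k) ^+ 2 = \sum_(k < n) nrm (a k) ^+ 2.
Proof.
by rewrite big_ord_recl (nrm0 : nrm (shift_coef a (@ord0 n)) = 0) expr2 mul0r add0r.
Qed.

Lemma l2_shift a : l2 a -> l2 (shift_coef a).
Proof.
move=> [A aA]; exists A => -[|n]; first by have := aA 0%N; rewrite !big_ord0.
by rewrite sum_shift_sqr.
Qed.

Lemma l2_geometric z : `|z| < 1 -> l2 (fun k => z ^+ k).
Proof.
move=> /nrm_lt1 z1; have z2 : nrm z ^+ 2 < 1 by rewrite exprn_ilt1 ?Re_norm_ge0.
exists (1 - nrm z ^+ 2)^-1 => n.
apply: le_trans (geometric_sum_le n (sqr_ge0 _) z2).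
by apply: ler_sum => k _; rewrite nrmX exprAC.
Qed.

Lemma convex_sqr (x y r : R) : 0 <= r -> r < 1 ->
  (x + r * y) ^+ 2 <= x ^+ 2 / (1 - r) + r * y ^+ 2.
Proof.
move=> r0 r1; have d0 : 0 < 1 - r by rewrite subr_gt0.
rewrite -subr_ge0.
rewrite (_ : _ - _ = r / (1 - r) * (x - (1 - r) * y) ^+ 2); last first.
  by field; rewrite gt_eqF.
by rewrite mulr_ge0 ?sqr_ge0// divr_ge0// ltW.
Qed.

Lemma nrm_step_sqr x y (c : C) : nrm c < 1 ->
  nrm (x + c * y) ^+ 2 <= nrm x ^+ 2 / (1 - nrm c) + nrm c * nrm y ^+ 2.
Proof.
move=> c1; apply: le_trans (convex_sqr _ _ (Re_norm_ge0 c) c1).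
rewrite ler_pXn2r ?nnegrE ?addr_ge0 ?mulr_ge0 ?Re_norm_ge0//.
by rewrite -nrmM nrmD.
Qed.

(** For the division of a power series by 1 - c w. By convexity the partial sums
    T of the squares of b satisfy T <= A / (1 - |c|) + |c| T, which bounds
    them. *)
Lemma l2_forward a b (c : C) : nrm c < 1 -> l2 a ->
  (forall n, b n = a n + c * shift_coef b n) -> l2 b.
Proof.
move=> c1 [A aA] bE; have d0 : 0 < 1 - nrm c by rewrite subr_gt0.
have A0 : 0 <= A by have := aA 0%N; rewrite big_ord0.
exists (A / (1 - nrm c) / (1 - nrm c)); elim=> [|n IH].
  by rewrite big_ord0 !divr_ge0// ltW.
apply: (@le_trans _ _ (\sum_(k < n.+1) (nrm (a k) ^+ 2 / (1 - nrm c)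
    + nrm c * nrm (shift_coef b k) ^+ 2))).
  by apply: ler_sum => k _; rewrite {1}bE nrm_step_sqr.
rewrite big_split -mulr_suml -mulr_sumr sum_shift_sqr.
rewrite [leRHS](_ : _ = A / (1 - nrm c) + nrm c * (A / (1 - nrm c) / (1 - nrm c))); last first.
  by field; rewrite gt_eqF.
apply: lerD; first by apply: ler_wpM2r; [rewrite invr_ge0 ltW|exact: aA].
by apply: ler_wpM2l IH; exact: Re_norm_ge0.
Qed.

(** For the division by w - c of a power series vanishing at c. The estimate is
    that of [l2_forward], but the recursion goes backwards and has to be stopped
    by a bound on b. *)
Lemma l2_backward a b c (M : C) : nrm c < 1 -> l2 a -> (forall n, `|b n| <= M) ->
  (forall n, b n = a n.+1 + c * b n.+1) -> l2 b.
Proof.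
move=> c1 [A aA] bM bE; have d0 : 0 < 1 - nrm c by rewrite subr_gt0.
have bM' n : nrm (b n) <= nrm M.
  rewrite -lecR !Re_norm; apply: le_trans (bM n) _; apply: real_ler_norm.
  by apply: ger0_real; exact: le_trans (bM 0%N).
exists ((A / (1 - nrm c) + nrm c * nrm M ^+ 2) / (1 - nrm c)) => n.
rewrite ler_pdivlMr// mulrBr mulr1 lerBlDr.
apply: (@le_trans _ _ (\sum_(k < n) (nrm (a k.+1) ^+ 2 / (1 - nrm c)
    + nrm c * nrm (b k.+1) ^+ 2))).
  by apply: ler_sum => k _; rewrite {1}bE nrm_step_sqr.
rewrite big_split -mulr_suml -mulr_sumr -addrA.
apply: lerD.
  apply: ler_wpM2r; first by rewrite invr_ge0 ltW.
  apply: le_trans (aA n.+1); rewrite big_ord_recl lerDr; exact: sqr_ge0.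
rewrite [X in _ + X]mulrC -mulrDr; apply: ler_wpM2l; first exact: Re_norm_ge0.
apply: (@le_trans _ _ (\sum_(k < n.+1) nrm (b k) ^+ 2)).
  by rewrite [leRHS]big_ord_recl lerDr sqr_ge0.
rewrite big_ord_recr [leRHS]addrC; apply: lerD; first exact: lexx.
by rewrite ler_pXn2r ?nnegrE ?Re_norm_ge0//; exact: bM'.
Qed.

End SquareSummable.

(** * The Hardy space *)

Section HardySpace.
Variable R : realType.
Local Notation C := R[i].
Local Notation rc := (real_complex R).
Local Notation nrm x := (complex.Re `|x|).
Local Notation disk := (unit_disk (R := R)).
Implicit Types (a b : nat -> C) (f g : disk -> C) (z w : disk) (c l : C).

Lemma tends_cvgn (u : nat -> C) l :
  tends u l <-> ((u : nat -> R[i]^o) @ \oo --> (l : R[i]^o)).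
Proof. exact: tendsP. Qed.

Definition powser f a := forall z, tends (psum a (val z)) (f z).

Lemma taylor_seriesP f a : taylor_series f a <-> powser f a.
Proof.
split=> fa z; have := fa z.
  move=> /tends_cvgn; apply: tends_ext => n; exact: series_ord.
move=> H; apply/tends_cvgn; apply: tends_ext H => n; by rewrite series_ord.
Qed.

Definition hcoef f a := l2 a /\ powser f a.

Lemma hardyP f : hardy f <-> exists a, hcoef f a.
Proof.
split=> [[a /l2P a2 /taylor_seriesP fa]|[a [/l2P a2 /taylor_seriesP fa]]]; by exists a.
Qed.

Lemma disk_lt1 z : `|val z| < 1. Proof. exact: (set_valP z). Qed.

Lemma powser_unique f a b : powser f a -> powser f b -> a = b.
Proof.
move=> fa fb; apply: psum_unique => x x1.
have xd : x \in disk by apply/mem_set.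
by exists (f (SigSub xd)); split; [exact: (fa (SigSub xd))|exact: (fb (SigSub xd))].
Qed.

Lemma taylor_coefE f a : powser f a -> taylor_coef f = a.
Proof.
move=> fa; apply: (@powser_unique f) => //; apply/taylor_seriesP.
by apply: (xgetPex (fun=> 0)); exists a; apply/taylor_seriesP.
Qed.

Lemma tends_conj (u : nat -> C) l : tends u l -> tends (fun n => (u n)^*) l^*.
Proof.
move=> ul e /ul[N NH]; exists N => n /NH; by rewrite -rmorphB /= norm_conjC.
Qed.

Lemma l2_conj a : l2 a -> l2 (fun k => (a k)^*).
Proof. by move=> [M aM]; exists M => n; under eq_bigr do rewrite norm_conjC. Qed.

Lemma hardy_dot_tends f g a b : hcoef f a -> hcoef g b ->
  tends (fun n => \sum_(k < n) a k * (b k)^*) (hardy_dot f g).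
Proof.
move=> [a2 fa] [b2 gb]; have [M abM] := l2_prod a2 (l2_conj b2).
have [l ul] := @summable_tends R (fun k => a k * (b k)^*) M abM.
suff -> : hardy_dot f g = l by [].
rewrite /hardy_dot (taylor_coefE fa) (taylor_coefE gb).
apply: (cvg_lim (@norm_hausdorff _ R[i]^o)).
apply/tends_cvgn; apply: tends_ext ul => n; by rewrite series_ord.
Qed.

Lemma hardy_dotE f g a b l : hcoef f a -> hcoef g b ->
  tends (fun n => \sum_(k < n) a k * (b k)^*) l -> hardy_dot f g = l.
Proof. by move=> fa gb; apply: tends_unique; exact: hardy_dot_tends. Qed.

Lemma l2_psum_tends a z : l2 a -> exists l, tends (psum a (val z)) l.
Proof.
move=> a2; have [M aM] := l2_prod a2 (l2_geometric (disk_lt1 z)).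
exact: (@summable_tends R (fun k => a k * val z ^+ k) M aM).
Qed.

Lemma shift_term_tends0 b z : l2 b ->
  tends (fun n => shift_coef b n * val z ^+ n) 0.
Proof.
move=> b2; have [l bl] := l2_psum_tends z (l2_shift b2).
have := tendsB (tends_shift bl) bl; rewrite subrr.
by apply: tends_ext => n; rewrite psumS; ring.
Qed.

Lemma psum_mul_linear_tends b z (al be l : C) : l2 b -> tends (psum b (val z)) l ->
  tends (psum (fun k => al * b k + be * shift_coef b k) (val z)) ((al + be * val z) * l).
Proof.
move=> b2 bl; have := tendsB (tendsZ (al + be * val z) bl) (tendsZ be (shift_term_tends0 z b2)).
rewrite mulr0 subr0; apply: tends_ext => n.
by rewrite psum_mul_linear addrK.
Qed.

Lemma hcoef_mul_linear f a (al be : C) : hcoef f a ->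
  hcoef (fun z => (al + be * val z) * f z) (fun k => al * a k + be * shift_coef a k).
Proof.
move=> [a2 fa]; split=> [|z]; first by apply: l2D; apply: l2Z => //; exact: l2_shift.
exact: psum_mul_linear_tends.
Qed.

Lemma hcoefZ f a c : hcoef f a -> hcoef (fun z => c * f z) (fun k => c * a k).
Proof.
move=> [a2 fa]; split=> [|z]; first exact: l2Z.
have := tendsZ c (fa z); apply: tends_ext => n; rewrite /psum mulr_sumr.
by apply: eq_bigr => k _; rewrite mulrA.
Qed.

Lemma hcoefD f g a b : hcoef f a -> hcoef g b ->
  hcoef (fun z => f z + g z) (fun k => a k + b k).
Proof.
move=> [a2 fa] [b2 gb]; split=> [|z]; first exact: l2D.
have := tendsD (fa z) (gb z); apply: tends_ext => n; rewrite /psum -big_split /=.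
by apply: eq_bigr => k _; rewrite mulrDl.
Qed.

Lemma hcoef_sum (I : finType) (F : I -> disk -> C) (A : I -> nat -> C) :
  (forall i, hcoef (F i) (A i)) ->
  hcoef (fun z => \sum_i F i z) (fun k => \sum_i A i k).
Proof.
move=> FA; split=> [|z]; first by apply: l2_sum => i; exact: (FA i).1.
have := tends_sum (fun i => (FA i).2 z); apply: tends_ext => n.
by rewrite exchange_big; apply: eq_bigr => k _; rewrite mulr_suml.
Qed.

Lemma den_disk_neq0 c z : `|c| < 1 -> 1 - c * val z != 0.
Proof.
move=> c1; exact: one_subM_neq0 c1 (disk_lt1 z).
Qed.

Lemma hardy_divide f c : `|c| < 1 -> hardy f -> hardy (fun z => f z / (1 - c * val z)).
Proof.
move=> c1 /hardyP[a [a2 fa]]; apply/hardyP.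
pose b := fix b n := if n is n'.+1 then a n + c * b n' else a 0%N.
have bE n : b n = a n + c * shift_coef b n.
  by case: n => [|n] //=; rewrite mulr0 addr0.
have b2 : l2 b by apply: l2_forward bE => //; exact: nrm_lt1.
exists b; split=> // z; have [l bl] := l2_psum_tends z b2.
have := psum_mul_linear_tends 1 (- c) b2 bl.
rewrite (_ : (fun k => _) = a); last first.
  by apply/funext => n; rewrite [in X in X + _]bE; ring.
move=> /(tends_unique (fa z)) ->.
by rewrite mulNr mulrC mulKf ?den_disk_neq0.
Qed.

(** The coefficients of the quotient are b n = sum_j a (n + 1 + j) z0^j. The
    recursion b n = a (n + 1) + z0 b (n + 1) says both that the product by w - z0
    is f and, by [l2_backward], that b is square summable. *)
Lemma hardy_factor f z0 : hardy f -> f z0 = 0 ->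
  exists2 g, hardy g & forall z, f z = (val z - val z0) * g z.
Proof.
move=> /hardyP[a [a2 fa]] fz0; set p := val z0.
have p1 : `|p| < 1 := disk_lt1 z0.
pose ta k j := a (k.+1 + j)%N.
have ta2 k : l2 (ta k).
  have [M aM] := a2; exists M => n; apply: le_trans (aM (k.+1 + n)%N).
  by rewrite big_split_ord /= lerDr sumr_ge0// => j _; exact: sqr_ge0.
have [b bP] := choice (fun k => l2_psum_tends z0 (ta2 k)).
have bE n : b n = a n.+1 + p * b n.+1.
  apply: tends_unique (tends_shift (bP n)) _.
  have := tendsD (tends_cst (a n.+1)) (tendsZ p (bP n.+1)); apply: tends_ext => m.
  rewrite /psum [RHS]big_ord_recl /= expr0 mulr1 /ta addn0 mulr_sumr; congr (_ + _).
  by apply: eq_bigr => j _; rewrite /bump /= add1n addSnnS exprS; change (sval z0) with p; ring.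
have b0 : a 0%N = - p * b 0%N.
  apply/eqP; rewrite mulNr -addr_eq0; apply/eqP.
  have := tends_shift (fa z0); rewrite fz0 => /(tends_unique _); apply.
  have := tendsD (tends_cst (a 0%N)) (tendsZ p (bP 0%N)); apply: tends_ext => m.
  rewrite /psum [RHS]big_ord_recl /= expr0 mulr1 /ta mulr_sumr; congr (_ + _).
  by apply: eq_bigr => j _; rewrite /bump /= exprS; change (sval z0) with p; ring.
have [B aB] := l2_bounded a2.
have bB n : `|b n| <= B * (1 - `|p|)^-1.
  apply: tends_norm_le (bP n) _ => m; apply: le_trans (ler_norm_sum _ _ _) _.
  have B0 : 0 <= B by exact: le_trans (aB 0%N).
  apply: le_trans (ler_wpM2l B0 (geometric_sum_le m (normr_ge0 p) p1)).
  rewrite mulr_sumr; apply: ler_sum => j _; rewrite normrM normrX.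
  by apply: ler_wpM2r; rewrite ?exprn_ge0// /ta.
have b2 : l2 b by apply: l2_backward bB bE => //; exact: nrm_lt1.
have [g gP] := choice (fun z => l2_psum_tends z b2).
exists g => [|z]; first by apply/hardyP; exists b.
have := psum_mul_linear_tends (- p) 1 b2 (gP z).
rewrite (_ : (fun k => _) = a); last first.
  apply/funext => -[|n] /=; first by rewrite mulr0 addr0 -b0.
  by rewrite mul1r [in X in _ + X]bE; ring.
by move=> /(tends_unique (fa z)) ->; rewrite mul1r addrC.
Qed.
End HardySpace.

(** * Blaschke products and model spaces *)

Section Blaschke.
Variables (R : realType) (n : nat).
Local Notation C := R[i].
Local Notation disk := (unit_disk (R := R)).
Variable z : 'I_n -> disk.
Implicit Types (a b : nat -> C) (f g : disk -> C) (c : C) (s : seq 'I_n).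

Let phi i (w : disk) : C := (val w - val (z i)) / (1 - (val (z i))^* * val w).

Lemma conj_disk_lt1 (w : disk) : `|(val w)^*| < 1.
Proof. by rewrite norm_conjC disk_lt1. Qed.

Lemma hardy_mul_linear f (al be : C) : hardy f ->
  hardy (fun w => (al + be * val w) * f w).
Proof.
by move=> /hardyP[a fa]; apply/hardyP; eexists; exact: hcoef_mul_linear fa.
Qed.

Lemma hardy_ext f g : f =1 g -> hardy f -> hardy g.
Proof. by move=> /funext ->. Qed.

Lemma hardyZ f c : hardy f -> hardy (fun w => c * f w).
Proof. by move=> /hardyP[a fa]; apply/hardyP; eexists; exact: hcoefZ fa. Qed.

Lemma hardy_blaschke_seq s g : hardy g ->
  hardy (fun w => (\prod_(i <- s) phi i w) * g w).
Proof.
move=> hg; elim: s => [|i s IH].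
  by apply: hardy_ext hg => w; rewrite big_nil mul1r.
have := hardy_mul_linear (- val (z i)) 1 (hardy_divide (conj_disk_lt1 (z i)) IH).
apply: hardy_ext => w; rewrite big_cons /phi; ring.
Qed.

Lemma hardy_blaschke c g : hardy g -> hardy (fun w => blaschke c z w * g w).
Proof.
move=> hg; have := hardyZ c (hardy_blaschke_seq (index_enum 'I_n) hg).
by apply: hardy_ext => w; rewrite /blaschke mulrA.
Qed.

Lemma blaschke_zero c i : blaschke c z (z i) = 0.
Proof. by rewrite /blaschke (bigD1 i)//= subrr !mul0r mulr0. Qed.

Hypothesis z_inj : injective z.

(** Each zero z i is divided out, and the quotient multiplied by
    1 - (z i)^* w, which turns w - z i into a Blaschke factor. The product is
    taken over a list for the sake of the induction. *)
Lemma hardy_factor_seq s f : uniq s -> hardy f -> (forall i, i \in s -> f (z i) = 0) ->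
  exists2 g, hardy g & forall w, f w = (\prod_(i <- s) phi i w) * g w.
Proof.
elim: s f => [|i s IH] f; first by move=> _ hf _; exists f => // w; rewrite big_nil mul1r.
move=> /= /andP[ni us] hf f0.
have [g1 hg1 fg1] := hardy_factor hf (f0 i (mem_head _ _)).
have := IH (fun w => (1 + - (val (z i))^* * val w) * g1 w) us (hardy_mul_linear _ _ hg1).
case=> [j js|g hg gE].
  have := f0 j; rewrite in_cons js orbT => /(_ isT); rewrite fg1 => /eqP.
  rewrite mulf_eq0 subr_eq0 => /orP[/eqP/val_inj/z_inj ji|/eqP ->]; last by rewrite mulr0.
  by move: ni; rewrite -ji js.
exists g => // w; rewrite big_cons -mulrA -gE fg1 /phi.
have := den_disk_neq0 w (conj_disk_lt1 (z i)) => D.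
by field.
Qed.

Lemma hardy_factor_blaschke c f : c != 0 -> hardy f -> (forall i, f (z i) = 0) ->
  exists2 g, hardy g & forall w, f w = blaschke c z w * g w.
Proof.
move=> c0 hf f0.
have [g hg gE] := hardy_factor_seq (index_enum_uniq 'I_n) hf (fun i _ => f0 i).
exists (fun w => c^-1 * g w); first exact: hardyZ.
by move=> w; rewrite gE /blaschke mulrACA mulfV// mul1r.
Qed.

Definition szego_comb (u : 'I_n -> C) (w : disk) : C :=
  \sum_i u i * (1 - val w * (val (z i))^* )^-1.

Lemma szego_hcoef c : `|c| < 1 ->
  hcoef (fun w : disk => (1 - val w * c)^-1) (fun k => c ^+ k).
Proof.
move=> c1; have c2 := l2_geometric c1; split=> // w.
have [l cl] := l2_psum_tends w c2.
have D := den_disk_neq0 w c1.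
suff <- : l = (1 - val w * c)^-1 by [].
have H : (1 + - c * val w) * l = 1.
  apply: tends_unique (tends_shift (psum_mul_linear_tends 1 (- c) c2 cl)) _.
  apply: tends_ext (tends_cst 1) => m; rewrite /psum big_ord_recl big1 => [|k _].
    by rewrite /= !expr0; ring.
  by rewrite /= /bump /= exprS; ring.
by rewrite [val w * c]mulrC; apply: (mulfI D); rewrite mulfV// -[RHS]H mulNr.
Qed.

Lemma szego_comb_hcoef u :
  hcoef (szego_comb u) (fun k => \sum_i u i * (val (z i))^* ^+ k).
Proof.
exact: (hcoef_sum (fun i => hcoefZ (u i) (szego_hcoef (conj_disk_lt1 (z i))))).
Qed.

Lemma hardy_dot_szego_comb u f a : hcoef f a ->
  hardy_dot (szego_comb u) f = \sum_i u i * (f (z i))^*.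
Proof.
move=> fa; apply: (hardy_dotE (szego_comb_hcoef u) fa).
have := tends_sum (fun i => tendsZ (u i) (tends_conj (fa.2 (z i)))).
apply: tends_ext => m.
under [RHS]eq_bigr do rewrite mulr_suml.
rewrite [RHS]exchange_big; apply: eq_bigr => i _; rewrite rmorph_sum mulr_sumr.
by apply: eq_bigr => k _; rewrite rmorphM rmorphXn /=; ring.
Qed.

Lemma szego_comb_model c u : model_space (blaschke c z) (szego_comb u).
Proof.
split; first by apply/hardyP; eexists; exact: szego_comb_hcoef.
move=> g /(hardy_blaschke c)/hardyP[a ga].
rewrite (hardy_dot_szego_comb u ga) big1// => i _.
by rewrite blaschke_zero mul0r conjC0 mulr0.
Qed.

Lemma hardy_dot_self_eq0 f a : hcoef f a -> hardy_dot f f = 0 -> forall w, f w = 0.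
Proof.
move=> fa f0; have := hardy_dot_tends fa fa; rewrite f0 => T.
have a0 k : a k = 0.
  apply/eqP; rewrite -normr_eq0 -sqrf_eq0 eq_le exprn_ge0// andbT.
  apply/ler_addgt0Pr => e /T[N /(_ (N + k.+1)%N (leq_addr _ _))].
  rewrite subr0 add0r => /(le_trans _); apply.
  apply: le_trans (real_ler_norm _); last first.
    by apply: rpred_sum => i _; apply: ger0_real; rewrite -normCK exprn_ge0.
  have kN : (k < N + k.+1)%N by rewrite addnS ltnS leq_addl.
  rewrite (bigD1 (Ordinal kN))//= -normCK lerDl sumr_ge0// => i _.
  by rewrite -normCK exprn_ge0.
move=> w; apply: tends_unique (fa.2 w) _.
apply: tends_ext (tends_cst 0) => m; rewrite /psum big1// => k _.
by rewrite a0 mul0r.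
Qed.

(** A function of the model space is determined by its values at the zeros:
    the difference with the interpolating combination of Szego kernels is
    divisible by the Blaschke product, so it is orthogonal to itself. *)
Lemma model_space_szego_comb c f u : c != 0 -> model_space (blaschke c z) f ->
  (forall i, f (z i) = szego_comb u (z i)) -> forall w, f w = szego_comb u w.
Proof.
move=> c0 [/hardyP[a fa] fB] fu.
pose h w := f w + -1 * szego_comb u w.
have ha := hcoefD fa (hcoefZ (-1) (szego_comb_hcoef u)).
have hh : hardy h by apply/hardyP; eexists; exact: ha.
have h0 i : h (z i) = 0 by rewrite /h fu mulN1r subrr.
have [g hg gE] := hardy_factor_blaschke c0 hh h0.
have hE : h = fun w => blaschke c z w * g w by apply/funext.
have fh : hardy_dot f h = 0 by rewrite hE; exact: fB.
have uh : hardy_dot (szego_comb u) h = 0.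
  by rewrite (hardy_dot_szego_comb u (f := h) ha) big1// => i _; rewrite h0 conjC0 mulr0.
have hh0 : hardy_dot h h = 0.
  apply: (hardy_dotE ha ha).
  have := tendsB (hardy_dot_tends fa ha) (hardy_dot_tends (szego_comb_hcoef u) ha).
  rewrite fh uh subrr; apply: tends_ext => m; rewrite -sumrB.
  by apply: eq_bigr => k _; ring.
move=> w; have := hardy_dot_self_eq0 ha hh0 w; rewrite mulN1r => /eqP.
by rewrite subr_eq0 => /eqP.
Qed.
End Blaschke.

(** * The Pick matrix of points of the disk *)

Section DiskPickMatrix.
Variables (C : numClosedFieldType) (n : nat) (z : 'I_n -> C).
Hypothesis z_inj : injective z.
Hypothesis z_disk : forall i, `|z i| < 1.

(** The reciprocals of the derivatives of the Blaschke product at its zeros. *)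
Definition blaschke_weight k : C :=
  (\prod_l (1 - (z l)^* * z k)) / \prod_(l | l != k) (z k - z l).

Lemma disk_den_neq0 i j : 1 - (z i)^* * z j != 0.
Proof. by apply: one_subM_neq0; rewrite ?norm_conjC. Qed.

Lemma blaschke_weight_neq0 k : blaschke_weight k != 0.
Proof.
rewrite mulf_neq0 ?invr_neq0 ?vandermonde_prod_neq0//.
by apply/prodf_neq0 => l _; exact: disk_den_neq0.
Qed.

(** In terms of the Pick matrix K and of the diagonal matrix D of the weights:
    K D K^T is the inverse of the conjugate of D. After multiplication by the
    product of the 1 - (z j)^* z l, this is [lagrange_pick_identity] at
    t = (z j)^*, whose right-hand side vanishes for j != i. *)
Lemma disk_pick_inverse i j :
  \sum_k (1 - z k * (z i)^* )^-1 * blaschke_weight k * (1 - z k * (z j)^* )^-1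
  = (i == j)%:R * ((blaschke_weight j)^* )^-1.
Proof.
have D := disk_den_neq0; have V := vandermonde_prod_neq0 z_inj.
have P0 : \prod_l (1 - (z j)^* * z l) != 0.
  by apply/prodf_neq0 => l _; exact: D.
have := lagrange_pick_identity z_inj (fun l => (z l)^*) (z j)^* i => L.
apply: (mulIf P0); rewrite mulr_suml.
transitivity (\prod_(l | l != i) ((z j)^* - (z l)^*)).
  rewrite -L; apply: eq_bigr => k _; rewrite /blaschke_weight.
  rewrite [\prod_l (1 - (z l)^* * z k)](bigD1 i)//= [\prod_l (1 - (z j)^* * z l)](bigD1 k)//=.
  set A := \prod_(l | l != i) _; set B := \prod_(l | l != k) (1 - _).
  have h1 := D i k; have h2 := D j k; have h3 := V k.
  have E1 : 1 - z k * (z i)^* = 1 - (z i)^* * z k by rewrite mulrC.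
  have E2 : 1 - z k * (z j)^* = 1 - (z j)^* * z k by rewrite mulrC.
  by rewrite E1 E2; field; rewrite h1 h2 h3.
have [<-|ij] := eqVneq i j; last first.
  by rewrite (bigD1 j) 1?eq_sym//= subrr !mul0r.
rewrite mul1r /blaschke_weight rmorphM fmorphV /= invfM invrK.
set P := \prod_l (1 - (z l)^* * z i); set Q := \prod_(l | l != i) (z i - z l).
have P1 : P^* != 0 by rewrite conjC_eq0; apply/prodf_neq0 => l _; exact: D.
have -> : \prod_l (1 - (z i)^* * z l) = P^*.
  rewrite rmorph_prod; apply: eq_bigr => l _.
  by rewrite /= rmorphB rmorph1 rmorphM /= conjCK mulrC.
rewrite mulrAC mulVf// mul1r rmorph_prod; apply: eq_bigr => l _; by rewrite /= rmorphB.
Qed.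
End DiskPickMatrix.

Section DualOfLine.
Variables (C : numClosedFieldType) (U : lmodType C) (hd : {dot U for conjC}).
Variables (N m : nat) (k : 'I_N -> U) (y : 'I_N -> 'rV[C]_m).
Local Notation "''[' u , v ]" := (dotmx (C := C) (n := m) u v) : ring_scope.
Variables (z : 'I_N -> C) (v : 'rV[C]_m) (o : 'I_N).
Hypothesis v1 : '[v, v] = 1.
Hypothesis y_line : forall i, y i = z i *: v.
Hypothesis y_inj : injective y.
Hypothesis y_ball : forall i, '[y i, y i] < 1.
Hypothesis y_o : y o = 0.
Hypothesis k_gram : forall i j, hd (k i) (k j) = (1 - '[y j, y i])^-1.

Lemma line_dot i j : '[y j, y i] = z j * (z i)^*.
Proof. by rewrite !y_line dotmxZl dotmxZr v1 mulr1. Qed.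

Lemma line_coord_inj : injective z.
Proof. by move=> i j zij; apply: y_inj; rewrite !y_line zij. Qed.

Lemma line_coord_disk i : `|z i| < 1.
Proof.
rewrite -(@ltr_pXn2r _ 2) ?nnegrE// expr1n normCK -line_dot; exact: y_ball.
Qed.

(** The coefficients kappa form the row o of the inverse of the Pick matrix,
    which [disk_pick_inverse] makes explicit. Since z o = 0, the weight of o is
    the inverse of the product of the - z i. *)
Lemma extremal_dual_of_line : exists kappa : 'I_N -> C,
  (forall j, hd (k j) (\sum_i kappa i *: k i) = (j == o)%:R) /\
  hd (\sum_i kappa i *: k i) (\sum_i kappa i *: k i) * \prod_(i | i != o) '[y i, y i] = 1.
Proof.
have zo : z o = 0.
  have /eqP := y_o; rewrite y_line scaler_eq0 => /orP[/eqP//|/eqP v0].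
  by move: v1; rewrite v0 dotmx0l => /eqP; rewrite eq_sym oner_eq0.
pose d := blaschke_weight z.
have d0 i : d i != 0 := blaschke_weight_neq0 line_coord_inj line_coord_disk i.
pose kappa i := (d i * (d o)^* )^*.
have dual j : hd (k j) (\sum_i kappa i *: k i) = (j == o)%:R.
  have H := disk_pick_inverse line_coord_inj line_coord_disk j o.
  rewrite dot_sumr.
  transitivity ((d o)^* * ((j == o)%:R * ((d o)^* )^-1)); last first.
    by rewrite mulrCA mulfV ?mulr1// conjC_eq0 d0.
  rewrite -H mulr_sumr; apply: eq_bigr => i _.
  rewrite dotZr k_gram line_dot /kappa conjCK zo conjC0 mulr0 subr0 invr1 mulr1 /d.
  ring.
exists kappa; split=> //.
rewrite {1}dot_suml (bigD1 o)//= [X in (_ + X) * _]big1 => [|j /negbTE jo]; last first.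
  by rewrite dotZl dual jo mulr0.
rewrite dotZl dual eqxx mulr1 addr0 /kappa.
have -> : d o = (\prod_(i | i != o) (- z i))^-1.
  rewrite /d /blaschke_weight big1 => [|l _]; last by rewrite zo mulr0 subr0.
  by rewrite mul1r; congr _^-1; apply: eq_bigr => l _; rewrite zo sub0r.
have -> : \prod_(i | i != o) '[y i, y i] =
    (\prod_(i | i != o) - z i) * (\prod_(i | i != o) - z i)^*.
  rewrite rmorph_prod -big_split; apply: eq_bigr => i _ /=.
  by rewrite line_dot rmorphN mulrNN.
have Z0 : \prod_(i | i != o) - z i != 0.
  apply/prodf_neq0 => i io; rewrite oppr_eq0; apply: contraNneq io => zi.
  by apply/eqP/line_coord_inj; rewrite zo.
rewrite rmorphM /= conjCK fmorphV.
have Z1 : (\prod_(i | i != o) - z i)^* != 0 by rewrite conjC_eq0.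
by field; rewrite Z0 Z1.
Qed.
End DualOfLine.

(** * Gram matrices of points of the ball, and conjugations *)

Section PickKernels.
Variables (C : numClosedFieldType) (n : nat).
Implicit Types (g : 'I_n -> 'I_n -> C).

(** The Gram matrix g is a rescaling of that of the kernels 1 / (1 - <w, z>) at
    the points y. *)
Definition pick_form m g (y : 'I_n -> 'rV[C]_m) : Prop :=
  exists2 l : 'I_n -> C, forall i, l i != 0 &
    forall i j, g i j = l i * (l j)^* * (1 - dotmx (y j) (y i))^-1.

Lemma pick_form_recenter m g (x : 'I_n -> 'rV[C]_m) b :
  (forall i, dotmx (x i) (x i) < 1) -> pick_form g x ->
  pick_form g (fun i => ball_inv (x b) (x i)).
Proof.
move=> xB [l l0 gl].
have s0 : ball_s (x b) != 0 by rewrite gt_eqF// ball_s_gt0.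
exists (fun i => l i * (ball_s (x b) / (1 - dotmx (x b) (x i)))).
  move=> i; apply: mulf_neq0 => //; apply: mulf_neq0 => //.
  by rewrite invr_neq0 ?ball_den_neq0.
move=> i j; rewrite gl ball_inv_dot//.
rewrite !rmorphM fmorphV rmorphB rmorph1 /= ball_s_conj// -(dotmxC (x j) (x b)).
rewrite ball_s_sqr// subKr.
have h1 := ball_den_neq0 (xB j) (xB b); have h2 := ball_den_neq0 (xB b) (xB i).
have h3 := ball_den_neq0 (xB j) (xB i).
by field; rewrite h1 h2 h3 s0.
Qed.

(** With the base points at 0, the entries of g at o determine the scalars up to
    a common factor of modulus one, so that g determines the inner products of
    the points, whatever the dimension. *)
Lemma pick_form_dot m m' g (y : 'I_n -> 'rV[C]_m) (w : 'I_n -> 'rV[C]_m') o :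
  pick_form g y -> pick_form g w -> y o = 0 -> w o = 0 ->
  forall i j, dotmx (y j) (y i) = dotmx (w j) (w i).
Proof.
move=> [l l0 gl] [l' l'0 gl'] yo wo i j.
have E t : l o * (l t)^* = l' o * (l' t)^*.
  have := gl o t; rewrite gl' yo wo !dotmx0r !subr0 invr1 !mulr1 => ->//.
have Ei := congr1 conjC (E i); rewrite !rmorphM /= !conjCK in Ei.
have oo0 : l o * (l o)^* != 0 by rewrite mulf_neq0 ?conjC_eq0.
have El : l i * (l j)^* = l' i * (l' j)^*.
  apply: (mulfI oo0).
  transitivity (((l o)^* * l i) * (l o * (l j)^*)); first by ring.
  by rewrite Ei E [in RHS]E; ring.
have ij0 : l i * (l j)^* != 0 by rewrite mulf_neq0 ?conjC_eq0.
have := gl i j; rewrite gl' -El => /(mulfI ij0)/invr_inj/addrI/oppr_inj ->//.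
Qed.

Lemma pick_form_orthogonal m (G : 'M[C]_n) (y : 'I_n -> 'rV[C]_m) (l : 'I_n -> C) :
  (forall i, l i != 0) ->
  (forall i j, G i j = l i * (l j)^* * (1 - dotmx (y j) (y i))^-1) ->
  G *m G^T = 1%:M ->
  forall i j, \sum_s (1 - dotmx (y s) (y i))^-1 * (l s)^* ^+ 2
                * (1 - dotmx (y s) (y j))^-1 = (i == j)%:R * (l i) ^- 2.
Proof.
move=> l0 gl GG i j.
have lij : l i * l j != 0 by rewrite mulf_neq0.
apply: (mulfI lij); transitivity ((i == j)%:R : C).
  have /matrixP/(_ i j) := GG; rewrite [LHS]mxE [RHS]mxE => <-.
  rewrite mulr_sumr; apply: eq_bigr => s _; rewrite [_^T _ _]mxE !gl; ring.
have [<-|_] := eqVneq i j; last by rewrite mul0r mulr0.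
by rewrite mul1r -expr2 mulfV// expf_neq0.
Qed.

Lemma pick_form_normalized_angle m (y : 'I_n -> 'rV[C]_m) (l : 'I_n -> C) o j :
  (forall i, l i != 0) -> (forall i, dotmx (y i) (y i) < 1) -> y o = 0 ->
  1 - `|l o * (l j)^* * (1 - dotmx (y j) (y o))^-1| ^+ 2 /
      (l o * (l o)^* * (l j * (l j)^* * (1 - dotmx (y j) (y j))^-1)) = dotmx (y j) (y j).
Proof.
move=> l0 yB yo; rewrite yo dotmx0r subr0 invr1 mulr1 normrM norm_conjC exprMn !normCK.
have h1 := l0 o; have h2 := l0 j.
have h3 : (l o)^* != 0 by rewrite conjC_eq0.
have h4 : (l j)^* != 0 by rewrite conjC_eq0.
have h5 := ball_den_neq0 (yB j) (yB j).
by field; rewrite h1 h2 h3 h4 h5.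
Qed.

(** A unit vector is asked for even if all the y i vanish; this is why the
    lemmas below assume 0 < m. *)
Definition on_line m (y : 'I_n -> 'rV[C]_m) : Prop :=
  exists2 v, dotmx v v = 1 & exists c : 'I_n -> C, forall i, y i = c i *: v.

Lemma on_line_multiple m (y : 'I_n -> 'rV[C]_m) u : (0 < m)%N ->
  (forall j, exists c, y j = c *: u) -> on_line y.
Proof.
move=> m0 /choice[c yc].
have [u0|u0] := eqVneq u 0.
  exists (delta_mx 0 (Ordinal m0)); first exact: dotmx_delta.
  by exists (fun=> 0) => i; rewrite yc u0 scaler0 scale0r.
have n0 : 0 < sqrtC (dotmx u u) by rewrite sqrtC_gt0 dotmx_gt0.
exists (unit_dir u); first exact: unit_dir_norm.
exists (fun i => c i * sqrtC (dotmx u u)) => i.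
by rewrite yc scalerA mulfK// gt_eqF.
Qed.

Lemma on_line_of_proportional m (y : 'I_n -> 'rV[C]_m) i : (0 < m)%N -> y i != 0 ->
  (forall j, dotmx (y i) (y i) *: y j = dotmx (y j) (y i) *: y i) -> on_line y.
Proof.
move=> m0 yi0 prop; apply: (@on_line_multiple m y (y i) m0) => j.
exists (dotmx (y j) (y i) / dotmx (y i) (y i)).
have yy : dotmx (y i) (y i) != 0 by rewrite dotmx_eq0.
by apply: (scalerI yy); rewrite prop scalerA mulrCA mulfV ?mulr1.
Qed.

Lemma on_line_zero m (y : 'I_n -> 'rV[C]_m) : (0 < m)%N -> (forall i, y i = 0) -> on_line y.
Proof.
by move=> m0 y0; apply: (@on_line_multiple m y 0 m0) => j; exists 0; rewrite y0 scaler0.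
Qed.

Lemma on_line_of_parallel m (y : 'I_n -> 'rV[C]_m) : (0 < m)%N ->
  (forall i j, parallel (y i) (y j)) -> on_line y.
Proof.
move=> m0 par; have [y0|/existsNP[i /eqP yi0]] := pselect (forall i, y i = 0).
  exact: on_line_zero.
by apply: (on_line_of_proportional m0 yi0) => j; exact: parallel_eqn.
Qed.

End PickKernels.

Section Conjugations.
Variables (C : numClosedFieldType).

(** The square norms of u + v and 'i *: u + v give the two combinations of
    <J u, J v> and <J v, J u> that determine them. *)
Lemma conjugation_polarization (U : lmodType C) (hd : {dot U for conjC}) (J : U -> U) :
  (forall a u v, J (a *: u + v) = a^* *: J u + J v) ->
  (forall u, hd (J u) (J u) = hd u u) -> forall u v, hd (J u) (J v) = hd v u.
Proof.
move=> Jl JN u v.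
have E (a : C) : a^* * hd (J u) (J v) + a * hd (J v) (J u) =
    a * hd u v + a^* * hd v u.
  have := JN (a *: u + v); rewrite Jl !dotDl !dotDr !dotZl !dotZr !JN conjCK => H.
  move/eqP: H; rewrite -subr_eq0 => /eqP H; apply/eqP; rewrite -subr_eq0.
  by rewrite -[X in _ == X]H; apply/eqP; ring.
have E1 := E 1; have Ei := E 'i.
rewrite conjC1 !mul1r in E1; rewrite conjCi in Ei.
have i0 : 'i != 0 :> C by exact: neq0Ci.
have Ei' : - hd (J u) (J v) + hd (J v) (J u) = hd u v - hd v u.
  by apply: (mulfI i0); rewrite !mulrDr !mulrN -!mulNr Ei.
apply: (mulfI (_ : 2 != 0 :> C)); first by rewrite pnatr_eq0.
transitivity ((hd (J u) (J v) + hd (J v) (J u)) - (- hd (J u) (J v) + hd (J v) (J u))); first by ring.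
by rewrite E1 Ei'; ring.
Qed.

Variables (U : vectType C) (hd : {dot U for conjC}) (n : nat) (k d : 'I_n -> U).
Hypothesis k_basis : basis_of fullv [tuple k i | i < n].
Hypothesis d_dual : forall i j, hd (k i) (d j) = (i == j)%:R.

(** The conjugate linear extension of k_i |-> d_i is an isometry when the two
    bases have conjugate Gram matrices, and then it also maps d_i to k_i. *)
Lemma conjugation_of_dual_gram : (forall i j, hd (d i) (d j) = hd (k j) (k i)) ->
  exists J : U -> U, [/\ forall a u v, J (a *: u + v) = a^* *: J u + J v,
    forall u, hd (J u) (J u) = hd u u, involutive J & forall i, J (k i) = d i].
Proof.
move=> dk; have expand u := kern_dual_expand k_basis u d_dual.
pose J u := \sum_i (hd u (d i))^* *: d i.
have Jl a u v : J (a *: u + v) = a^* *: J u + J v.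
  rewrite /J scaler_sumr -big_split; apply: eq_bigr => i _ /=.
  by rewrite dotDl dotZl rmorphD rmorphM scalerDl scalerA.
have Jd u v : hd (J u) (J v) = hd v u.
  rewrite [v in RHS]expand [u in RHS]expand /J !dot_suml.
  rewrite (eq_bigr (fun i => \sum_j (hd u (d i))^* * (hd v (d j) * hd (k j) (k i)))) => [|i _].
    rewrite exchange_big; apply: eq_bigr => j _ /=; rewrite dotZl dot_sumr mulr_sumr.
    by apply: eq_bigr => i _; rewrite dotZr; ring.
  rewrite dotZl dot_sumr mulr_sumr; apply: eq_bigr => j _.
  by rewrite dotZr conjCK dk.
have Jk i : J (k i) = d i.
  rewrite /J (bigD1 i)//= big1 => [|j ji]; last by rewrite d_dual eq_sym (negbTE ji) conjC0 scale0r.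
  by rewrite d_dual eqxx conjC1 scale1r addr0.
have J0 : J 0 = 0 by rewrite /J big1// => i _; rewrite dot0l conjC0 scale0r.
have Jdk i : J (d i) = k i.
  rewrite [LHS]expand (bigD1 i)//= big1 => [|j ji].
    by rewrite -{2}Jk Jd d_dual eqxx scale1r addr0.
  by rewrite -(Jk j) Jd d_dual (negbTE ji) scale0r.
exists J; split=> // u; rewrite [RHS]expand {2}/J.
rewrite (big_morph J (id1 := 0) (op1 := +%R)) => [| x y|//].
  apply: eq_bigr => i _; have := Jl (hd u (d i))^* (d i) 0.
  by rewrite !addr0 J0 addr0 conjCK Jdk.
by have := Jl 1 x y; rewrite conjC1 !scale1r.
Qed.
End Conjugations.

(** * The conditions on the space in terms of a line *)

Section Rescaling.
Variables (R : realType) (n : nat).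
Local Notation C := R[i].
Implicit Types (H D : fdRKHS R n).

Lemma gramE H i j : gram H i j = hdot H (kern H i) (kern H j).
Proof. by rewrite mxE. Qed.

Lemma fdRKHS_dual_exists H : exists d : 'I_n -> H, dual_basis d.
Proof. exact: (dual_basis_exists (hdot H) (kern_basis H)). Qed.

Definition rescale H (c : 'I_n -> C) (c0 : forall i, c i != 0) : fdRKHS R n :=
  FdRKHS (hdot H) (rescaled_basis (kern_basis H) c0).

Lemma gram_rescale H c c0 i j :
  gram (@rescale H c c0) i j = c i * (c j)^* * gram H i j.
Proof. by rewrite !gramE /= dotZl dotZr mulrA. Qed.

Lemma rescaling_rescale H c c0 : rescaling H (@rescale H c c0).
Proof.
exists (fun i => (c i)^-1) => [i|i j]; first by rewrite invr_neq0.
rewrite gram_rescale fmorphV; have h1 := c0 i.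
have h2 : (c j)^* != 0 by rewrite conjC_eq0.
by field; rewrite h1 h2.
Qed.

Lemma rescaling_pick_form H D m (y : 'I_n -> 'rV[C]_m) : rescaling H D ->
  pick_form (fun i j => gram H i j) y <-> pick_form (fun i j => gram D i j) y.
Proof.
move=> [r r0 HD]; have r0' i : (r i)^* != 0 by rewrite conjC_eq0.
split=> [[l l0 gl]|[l l0 gl]].
  exists (fun i => l i / r i) => [i|i j]; first by rewrite mulf_neq0 ?invr_neq0.
  have := gl i j; rewrite HD => E; apply: (mulfI (mulf_neq0 (r0 i) (r0' j))).
  rewrite E rmorphM fmorphV /=; have h1 := r0 i; have h2 := r0' j.
  rewrite -[in LHS](mulfK h1 (l i)) -[in LHS](mulfK h2 (l j)^*).
  by rewrite [in LHS](mulrAC (l i)) [in LHS](mulrAC (l j)^*); ring.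
exists (fun i => r i * l i) => [i|i j]; first by rewrite mulf_neq0.
by rewrite HD gl rmorphM /=; ring.
Qed.

Variables (H : fdRKHS R n) (m : nat) (y : 'I_n -> 'rV[C]_m) (l : 'I_n -> C).
Hypothesis l0 : forall i, l i != 0.
Hypothesis gl : forall i j, gram H i j = l i * (l j)^* * (1 - dotmx (y j) (y i))^-1.
Let k i : H := (l i)^-1 *: kern H i.

Lemma linv_neq0 i : (l i)^-1 != 0. Proof. by rewrite invr_neq0. Qed.

Lemma normalized_gram i j : hdot H (k i) (k j) = (1 - dotmx (y j) (y i))^-1.
Proof.
rewrite /k dotZl dotZr -gramE gl fmorphV; have h1 := l0 i.
have h2 : (l j)^* != 0 by rewrite conjC_eq0.
by rewrite !mulrA (mulrAC (l i)^-1) mulVf// mul1r mulVf// mul1r.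
Qed.

Lemma normalized_free (a : 'I_n -> C) : \sum_i a i *: k i = 0 -> forall i, a i = 0.
Proof. exact: (basis_coef0 (rescaled_basis (kern_basis H) linv_neq0)). Qed.
End Rescaling.

Section Conditions.
Variables (R : realType) (n : nat).
Local Notation C := R[i].

Lemma orthogonal_of_conjugation (H : fdRKHS R n) : r_orthogonal H ->
  exists2 D : fdRKHS R n, rescaling H D & orthogonal_matrix (gram D).
Proof.
move=> [D HD [J [d [[Jl JN _] dual Jk]]]]; exists D => //.
have Gu : gram D \in unitmx := gram_unit (hdot D) (kern_basis D).
split=> //; rewrite [invmx _](dual_gram (kern_basis D) dual).
have JN' u : hdot D (J u) (J u) = hdot D u u.
  by rewrite -!dot_norm_sqr JN.
apply/matrixP => i j; rewrite [LHS]mxE [RHS]mxE gramE -!Jk.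
exact: (conjugation_polarization Jl JN').
Qed.

Lemma conjugation_of_orthogonal (H : fdRKHS R n) :
  (exists2 D : fdRKHS R n, rescaling H D & orthogonal_matrix (gram D)) -> r_orthogonal H.
Proof.
move=> [D HD [Gu GT]]; exists D => //.
have [d dual] := fdRKHS_dual_exists D.
have dk i j : hdot D (d i) (d j) = hdot D (kern D j) (kern D i).
  have /matrixP/(_ i j) := etrans (esym GT) (dual_gram (kern_basis D) dual).
  by rewrite [LHS]mxE [RHS]mxE gramE => ->.
have [J [Jl JN JJ Jk]] := conjugation_of_dual_gram (kern_basis D) dual dk.
exists J, d; split=> //; split=> // u.
by rewrite /dot_norm JN.
Qed.
End Conditions.

Section Lines.
Variables (R : realType) (n m : nat).
Local Notation C := R[i].
Local Notation "''[' u , v ]" := (dotmx (C := C) (n := m) u v) : ring_scope.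
Variables (H : fdRKHS R n.+1) (y : 'I_n.+1 -> 'rV[C]_m).
Hypothesis m0 : (0 < m)%N.
Hypothesis y_ball : forall i, '[y i, y i] < 1.
Hypothesis y_0 : y ord0 = 0.
Hypothesis y_pick : pick_form (fun i j => gram H i j) y.

Lemma on_line_of_orthogonal : orthogonal_matrix (gram H) -> on_line y.
Proof.
move=> [Gu GT]; have [l l0 gl] := y_pick.
have [y0|/existsNP[i /eqP yi0]] := pselect (forall i, y i = 0).
  exact: on_line_zero m0 y0.
have i0 : i != ord0 by apply: contraNneq yi0 => ->; rewrite y_0.
have l0' j : (l j)^* != 0 by rewrite conjC_eq0.
pose d j := (l j)^* ^+ 2; pose eps j := (l j) ^- 2.
have KdK := pick_form_orthogonal l0 gl (etrans (congr1 (mulmx _) (esym GT)) (mulmxV Gu)).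
have epsd j : eps j * (d j)^* = 1.
  by rewrite /eps /d rmorphXn /= conjCK mulVf// expf_neq0.
exact: (on_line_of_proportional m0 yi0 (line_of_orthogonal_rescaling
  (normalized_free l0) y_ball (normalized_gram l0 gl) KdK epsd y_0 i0 yi0)).
Qed.

Let point_product (d : 'I_n.+1 -> H) : Prop :=
  hdot H (kern H ord0) (kern H ord0) * hdot H (d ord0) (d ord0) *
    \prod_(j < n.+1 | j != ord0)
      (1 - `|gram H ord0 j| ^+ 2 / (gram H ord0 ord0 * gram H j j)) = 1.

(** When y ord0 = 0, the squared distances to the base point are the <y_j, y_j>,
    and the normalized kernel of the base point has norm one. *)
Lemma point_productE (d : 'I_n.+1 -> H) l :
  (forall i, l i != 0) ->
  (forall i j, gram H i j = l i * (l j)^* * (1 - '[y j, y i])^-1) ->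
  let k := (l ord0)^* *: d ord0 in
  point_product d <-> hdot H k k * \prod_(j | j != ord0) '[y j, y j] = 1.
Proof.
move=> l0 gl k; rewrite /point_product -gramE gl y_0 dotmx0l subr0 invr1 mulr1.
rewrite /k dotZl dotZr conjCK.
rewrite (eq_bigr (fun j => '[y j, y j])) => [|j _].
  by rewrite (mulrCA (l ord0)^*) mulrA.
rewrite !gl; exact: (pick_form_normalized_angle j l0 y_ball y_0).
Qed.

Lemma on_line_of_product d : dual_basis d -> point_product d ->
  injective y -> on_line y.
Proof.
move=> dual; have [l l0 gl] := y_pick => /(point_productE d l0 gl) P y_inj.
have yn0 i : i != ord0 -> y i != 0.
  by apply: contraNneq => yi; apply/eqP/y_inj; rewrite yi y_0.
(* the coefficients of the dual vector on the normalized kernels *)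
have [kappa kE] := basis_span (rescaled_basis (kern_basis H) (linv_neq0 l0)) ((l ord0)^* *: d ord0).
have dualk j : hdot H ((l j)^-1 *: kern H j) ((l ord0)^* *: d ord0) = (j == ord0)%:R.
  rewrite dotZl dotZr dual conjCK; have [->|] := eqVneq j ord0.
    by rewrite mulr1 mulVf.
  by rewrite !mulr0.
rewrite kE in P dualk.
have [y0|/existsNP[i /eqP yi0]] := pselect (forall i, y i = 0).
  exact: on_line_zero m0 y0.
have i0 : i != ord0 by apply: contraNneq yi0 => ->; rewrite y_0.
apply: (on_line_multiple m0 (u := y i)) => j.
exact: (line_of_extremal_dual (normalized_free l0) y_ball (normalized_gram l0 gl)
  y_0 yn0 dualk P).
Qed.

Lemma product_of_on_line d : dual_basis d -> on_line y -> injective y -> point_product d.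
Proof.
move=> dual [v v1 [z yz]] y_inj; have [l l0 gl] := y_pick.
apply/(point_productE d l0 gl).
have [kappa [dualk P]] := extremal_dual_of_line v1 yz y_inj y_ball y_0 (normalized_gram l0 gl).
suff -> : (l ord0)^* *: d ord0 = \sum_i kappa i *: ((l i)^-1 *: kern H i) by [].
apply: (eval_inj (hd := hdot H) (rescaled_basis (kern_basis H) (linv_neq0 l0))) => j.
rewrite [LHS]dotC [RHS]dotC; congr (_^*); rewrite [RHS]dualk.
rewrite dotZl dotZr dual conjCK; have [->|] := eqVneq j ord0.
  by rewrite mulr1 mulVf.
by rewrite !mulr0.
Qed.

(** By [disk_pick_inverse] the Pick matrix is orthogonal after multiplication of
    the kernels by square roots of the conjugate weights. *)
Lemma orthogonal_of_on_line : on_line y -> injective y ->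
  exists2 D : fdRKHS R n.+1, rescaling H D & orthogonal_matrix (gram D).
Proof.
move=> [v v1 [z yz]] y_inj; have [l l0 gl] := y_pick.
have z_inj := line_coord_inj yz y_inj.
have z_disk := line_coord_disk v1 yz y_ball.
have yy := line_dot v1 yz.
pose w := blaschke_weight z; have w0 := blaschke_weight_neq0 z_inj z_disk.
pose mu i := sqrtC (w i)^*.
have mu2 i : mu i ^+ 2 = (w i)^* by rewrite sqrtCK.
have mu0 i : mu i != 0 by rewrite sqrtC_eq0 conjC_eq0 w0.
have c0 i : mu i / l i != 0 by rewrite mulf_neq0 ?invr_neq0.
exists (rescale H c0); first exact: rescaling_rescale.
set G := gram _.
have GE i j : G i j = mu i * (mu j)^* * (1 - z j * (z i)^* )^-1.
  rewrite /G gram_rescale gl yy rmorphM fmorphV /=.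
  have h1 := l0 i; have h2 : (l j)^* != 0 by rewrite conjC_eq0.
  rewrite -[in RHS](divfK h1 (mu i)) -[in RHS](divfK h2 (mu j)^*); ring.
have GG : G *m G^T = 1%:M.
  apply/matrixP => i j; rewrite [LHS]mxE [RHS]mxE.
  transitivity (mu i * mu j * ((i == j)%:R * ((w j)^* )^-1)).
    rewrite -(disk_pick_inverse z_inj z_disk) mulr_sumr; apply: eq_bigr => s _.
    rewrite [_^T _ _]mxE !GE.
    have -> : blaschke_weight z s = ((mu s)^* )^+ 2 by rewrite -rmorphXn /= mu2 conjCK.
    by ring.
  have [<-|] := eqVneq i j; last by rewrite mul0r mulr0.
  by rewrite mul1r -expr2 mu2 mulfV// conjC_eq0 w0.
have [Gu _] := mulmx1_unit GG; split=> //.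
by rewrite -[LHS]mulmx1 -GG mulKmx.
Qed.
End Lines.

(** * The equivalences *)

Section ModelSpaces.
Variables (R : realType) (n : nat).
Local Notation C := R[i].
Local Notation disk := (unit_disk (R := R)).

(** The embedding takes u to the combination of Szego kernels with the
    coordinates of u. It is onto the model space because a function of the model
    space is determined by its values at the zeros. *)
Lemma model_RKHS_of_gram (c : C) (z : 'I_n -> disk) (D : fdRKHS R n) :
  c != 0 -> injective z ->
  (forall i k, gram D i k = (1 - val (z k) * (val (z i))^* )^-1) ->
  is_model_RKHS (blaschke c z) z D.
Proof.
move=> c0 z_inj gD; have [d dual] := fdRKHS_dual_exists D.
have hk i k : hdot D (kern D i) (kern D k) = (1 - val (z k) * (val (z i))^* )^-1.
  by rewrite -gD gramE.
pose j (u : D) := szego_comb z (fun i => hdot D u (d i)).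
have expand (u : D) := kern_dual_expand (kern_basis D) u dual.
have jz u i : j u (z i) = hdot D u (kern D i).
  rewrite [u in RHS]expand dot_suml; apply: eq_bigr => s _.
  by rewrite dotZl hk.
have jh u := szego_comb_hcoef z (fun i => hdot D u (d i)).
exists j; split.
- move=> a u v w; rewrite /j /szego_comb mulr_sumr -big_split; apply: eq_bigr => i _ /=.
  by rewrite dotDl dotZl mulrDl mulrA.
- split.
  + by move=> u _; exact: szego_comb_model.
  + move=> u v _ _ juv; apply: (eval_inj (hd := hdot D) (kern_basis D)) => i.
    by rewrite -!jz juv.
  + move=> f fB; pose u := \sum_i f (z i) *: d i.
    have uk i : hdot D u (kern D i) = f (z i).
      rewrite /u dot_suml (bigD1 i)//= big1 => [|s /negbTE si].
        by rewrite dotZl dotC dual eqxx conjC1 mulr1 addr0.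
      by rewrite dotZl dotC dual eq_sym si conjC0 mulr0.
    exists u => //; apply/funext => w; apply/esym.
    by apply: (model_space_szego_comb z_inj c0 fB) => i; rewrite -uk -jz.
- move=> u v; rewrite (hardy_dot_szego_comb _ _ (jh v)) [u in RHS]expand dot_suml.
  by apply: eq_bigr => i _; rewrite dotZl -/(j v) jz -dotC.
move=> i w; rewrite /j /szego_comb (bigD1 i)//= big1 => [|s si].
  by rewrite dual eqxx mul1r addr0.
by rewrite dual eq_sym (negbTE si) mul0r.
Qed.

Lemma gram_of_model_RKHS (B : disk -> C) (z : 'I_n -> disk) (D : fdRKHS R n) :
  is_model_RKHS B z D ->
  forall i k, gram D i k = (1 - val (z k) * (val (z i))^* )^-1.
Proof.
move=> [j [_ _ jdot jk]] i k; rewrite gramE -jdot.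
pose S s (w : disk) : C := (1 - val w * (val (z s))^* )^-1.
have jE s : j (kern D s) = S s by apply/funext => w; exact: jk.
have SE s : S s = szego_comb z (fun t => (t == s)%:R).
  apply/funext => w; rewrite /szego_comb (bigD1 s)//= big1 => [|t /negbTE ts].
    by rewrite eqxx mul1r addr0.
  by rewrite ts mul0r.
have hS s : hcoef (S s) (fun m => (val (z s))^* ^+ m).
  exact: (szego_hcoef (conj_disk_lt1 (z s))).
rewrite !jE (SE i) (hardy_dot_szego_comb _ _ (hS k)) (bigD1 i)//= big1 => [|t /negbTE ti].
  by rewrite eqxx mul1r addr0 /S fmorphV rmorphB rmorph1 rmorphM /= conjCK mulrC.
by rewrite ti mul0r.
Qed.
End ModelSpaces.

Section LineModels.
Variables (R : realType) (n m : nat).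
Local Notation C := R[i].
Variables (H : fdRKHS R n.+1) (y : 'I_n.+1 -> 'rV[C]_m).
Hypothesis m0 : (0 < m)%N.
Hypothesis y_ball : forall i, dotmx (y i) (y i) < 1.
Hypothesis y_0 : y ord0 = 0.
Hypothesis y_pick : pick_form (fun i j => gram H i j) y.

Lemma model_of_on_line : on_line y -> injective y -> r_model_space H.
Proof.
move=> [v v1 [z yz]] y_inj; have [l l0 gl] := y_pick.
have z_disk i : z i \in unit_disk (R := R).
  by apply/mem_set; exact: (line_coord_disk v1 yz y_ball i).
exists 1, (fun i => SigSub (z_disk i)), (rescale H (linv_neq0 l0)); split.
- exact: normr1.
- move=> i j /(congr1 val) zij; exact: (line_coord_inj yz y_inj zij).
- apply: model_RKHS_of_gram; first exact: oner_neq0.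
    move=> i j /(congr1 val) zij; exact: (line_coord_inj yz y_inj zij).
  move=> i j; rewrite gramE; apply: etrans (normalized_gram l0 gl i j) _.
  by rewrite (line_dot v1 yz).
exact: rescaling_rescale.
Qed.

(** The zeros, also after recentring, are row vectors with a single entry, hence
    pairwise parallel. Their inner products are those of the y i. *)
Lemma on_line_of_model : r_model_space H -> on_line y.
Proof.
move=> [c [z [D [_ _ /gram_of_model_RKHS gD HD]]]].
pose w i : 'rV[C]_1 := const_mx (val (z i)).
have wdot i j : dotmx (w j) (w i) = val (z j) * (val (z i))^*.
  by rewrite dotmx_sum big_ord1 !mxE.
have wB i : dotmx (w i) (w i) < 1.
  by rewrite wdot -normCK exprn_ilt1// disk_lt1.
have wD : pick_form (fun i j => gram D i j) w.
  exists (fun=> 1) => [i|i j]; first exact: oner_neq0.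
  by rewrite conjC1 !mul1r wdot gD.
pose w' i := ball_inv (w ord0) (w i).
have w'H : pick_form (fun i j => gram H i j) w' :=
  pick_form_recenter ord0 wB ((rescaling_pick_form w HD).2 wD).
have w'0 : w' ord0 = 0 by exact: (ball_inv_center (wB ord0)).
have yw := pick_form_dot y_pick w'H y_0 w'0.
apply: (on_line_of_parallel m0) => i j; rewrite /parallel !yw.
exact: parallel_rV1.
Qed.
End LineModels.

Section GeodesicLines.
Variables (R : realType) (n m : nat).
Local Notation C := R[i].
Variable x : 'I_n.+1 -> 'rV[C]_m.
Hypothesis m0 : (0 < m)%N.
Hypothesis x_ball : forall i, unit_ball R m (x i).

Lemma geodesic_of_on_line b : on_line (fun i => ball_inv (x b) (x i)) ->
  in_one_geodesic [set x i | i in [set: 'I_n.+1]].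
Proof.
move=> [v v1 [c yc]]; apply: (line_geodesic m0 (x_ball b) v1) => _ [i _ <-].
by split; [exact: x_ball|exists (c i); exact: yc].
Qed.

Lemma on_line_of_triples :
  (forall i j : 'I_n.+1, (0 < i)%N -> (i < j)%N ->
     in_one_geodesic [set x ord0; x i; x j]) ->
  on_line (fun i => ball_inv (x ord0) (x i)).
Proof.
move=> tri; apply: (on_line_of_parallel m0) => i j.
have par (i' j' : 'I_n.+1) : (0 < i')%N -> (i' < j')%N ->
    parallel (ball_inv (x ord0) (x i')) (ball_inv (x ord0) (x j')).
  move=> i0 ij; have T := tri i' j' i0 ij.
  have T0 : [set x ord0; x i'; x j'] (x ord0) by left; left.
  have Ti : [set x ord0; x i'; x j'] (x i') by left; right.
  have Tj : [set x ord0; x i'; x j'] (x j') by right.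
  exact: (geodesic_parallel T T0 Ti Tj).2.
have c0 : ball_inv (x ord0) (x ord0) = 0 := ball_inv_center (x_ball ord0).
case: (posnP i) => [i0|i0].
  by rewrite (_ : i = ord0) ?c0; [exact: parallel0l|apply: val_inj].
case: (posnP j) => [j0|j0].
  rewrite (_ : j = ord0) ?c0; last by apply: val_inj.
  by apply: parallelC; exact: parallel0l.
case: (ltngtP i j) => [ij|ji|ij]; [exact: par|apply: parallelC; exact: par|].
by rewrite (val_inj ij : i = j); exact: parallel_refl.
Qed.
End GeodesicLines.

Theorem theorem3p1 (R : realType) (m n : nat) (DA : drury_arveson R m)
    (X : 'I_n.+1 -> unit_ball R m) (H : fdRKHS R n.+1)
    (m_gt0 : (0 < m)%N) (X_inj : injective X)
    (HX : rescaling_of_DA DA X H) :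
  [<-> in_one_geodesic [set val (X i) | i in [set: 'I_n.+1]];
       forall i j : 'I_n.+1, (0 < i)%N -> (i < j)%N ->
         in_one_geodesic [set val (X ord0); val (X i); val (X j)];
       exists s : 'S_n.+1, exists2 m1 : 'I_n.+1 -> R[i],
         extremal_multiplier (renumber s H) m1 &
         m1 ord0 = \prod_(j < n.+1 | j != ord0) delta (renumber s H) ord0 j;
       r_orthogonal H;
       exists2 D : fdRKHS R n.+1, rescaling H D & orthogonal_matrix (gram D);
       r_model_space H].
Proof.
pose x i := val (X i).
have xB i : dotmx (x i) (x i) < 1 := set_valP (X i).
have x_inj : injective x by move=> i j /val_inj/X_inj.
have Hx : pick_form (fun i j => gram H i j) x.
  case: HX => D [f [f_iso f_kern]] HD.
  apply/(rescaling_pick_form x HD); exists (fun=> 1) => [i|i j]; first exact: oner_neq0.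
  by rewrite conjC1 !mul1r gramE -f_iso !f_kern rkernelE.
pose y b i := ball_inv (x b) (x i).
have yB b i : dotmx (y b i) (y b i) < 1 := ball_inv_in (xB b) (xB i).
have y_inj b : injective (y b).
  move=> i j yij; exact: x_inj (ball_inv_inj (xB b) (xB i) (xB j) yij).
have y0 b : y b b = 0 := ball_inv_center (xB b).
have Hy b : pick_form (fun i j => gram H i j) (y b) := pick_form_recenter b xB Hx.
have line_of_geodesic : in_one_geodesic [set x i | i in [set: 'I_n.+1]] ->
    on_line (y ord0).
  move=> G; apply: (on_line_of_parallel m_gt0) => i j.
  have mem t : [set x i | i in [set: 'I_n.+1]] (x t) by exists t.
  by have [_] := geodesic_parallel G (mem ord0) (mem i) (mem j).
tfae.
- move=> [G hG XG] i j _ _; exists G => // z [[]|] ->; apply: XG; by eexists.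
- move=> /(on_line_of_triples m_gt0 xB) yl; exists 1%g.
  set H1 := renumber 1%g H.
  have gE i j : gram H1 i j = gram H i j by rewrite !gramE /= !perm1.
  have H1y : pick_form (fun i j => gram H1 i j) (y ord0).
    by have [l l0 gl] := Hy ord0; exists l => // i j; rewrite gE gl.
  have [d dual] := fdRKHS_dual_exists H1.
  apply/(extremal_product_iff dual).
  exact: (product_of_on_line (yB ord0) (y0 ord0) H1y dual yl (y_inj ord0)).
- move=> [s]; set H1 := renumber s H => E; apply: conjugation_of_orthogonal.
  have [d dual] := fdRKHS_dual_exists H1.
  pose w i := y (s ord0) (s i).
  have H1w : pick_form (fun i j => gram H1 i j) w.
    have [l l0 gl] := Hy (s ord0); exists (fun i => l (s i)) => [i|i j]; first exact: l0.
    apply: etrans _ (gl (s i) (s j)).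
    exact: etrans (gramE H1 i j) (esym (gramE H (s i) (s j))).
  have w_inj : injective w by move=> i j /y_inj/perm_inj.
  (* the base point is now s ord0; the geodesic found from it serves for ord0 *)
  have wl : on_line w.
    have wB i : dotmx (w i) (w i) < 1 := yB (s ord0) (s i).
    have w0 : w ord0 = 0 := y0 (s ord0).
    have P := (extremal_product_iff dual).1 E.
    exact: (on_line_of_product m_gt0 wB w0 H1w dual P w_inj).
  have yl : on_line (y (s ord0)).
    have [v v1 [c wc]] := wl; exists v => //; exists (fun i => c (s^-1%g i)) => i.
    exact: etrans (esym (congr1 (y (s ord0)) (permKV s i))) (wc (s^-1%g i)).
  have yl0 := line_of_geodesic (geodesic_of_on_line m_gt0 xB yl).
  exact: (orthogonal_of_on_line (yB ord0) (Hy ord0) yl0 (y_inj ord0)).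
- exact: orthogonal_of_conjugation.
- move=> [D HD GD].
  have Dy := (rescaling_pick_form (y ord0) HD).1 (Hy ord0).
  have yl := on_line_of_orthogonal m_gt0 (yB ord0) (y0 ord0) Dy GD.
  exact: (model_of_on_line (yB ord0) (Hy ord0) yl (y_inj ord0)).
- move=> /(on_line_of_model m_gt0 (y0 ord0) (Hy ord0)).
  exact: geodesic_of_on_line.
Qed.
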